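(* Let $\mathcal M$ be a 4-dimensional manifold with an N-generic metric $g$, whose selfdual part of the Weyl tensor is in addition algebraically special at all points of $\mathcal M$. Let $\mathcal N$ be the corresponding field of multiple principal (selfdual) totally null 2-planes on $\mathcal M$. Consider the 2-forms $A_Z=A(Z,\,\cdot\,,\,\cdot\,)$, where $A$ is the Cotton tensor of $g$ and $Z$ is a complex-valued vector field on $\mathcal M$. If for every vector field $Z\in\mathcal N$ the 2-form $A_Z$ is antiselfdual at each point of $\mathcal M$, then the field $\mathcal N$ is integrable, $[\mathcal N,\mathcal N]\subset\mathcal N$, on $\mathcal M$.
   Context: $g$ is a complex-valued metric (a nondegenerate symmetric complex bilinear form on ${\rm T}^{\mathbb C}\mathcal M$; real metrics of any signature are included by complex bilinear extension). A field of totally null 2-planes is a (smooth) complex rank-2 subbundle $\mathcal N\subset{\rm T}^{\mathbb C}\mathcal M$ with $g_{|\mathcal N}\equiv0$; given an orientation, it is selfdual or antiselfdual according to whether the Hodge star (normalized to square to the identity on bivectors and 2-forms) acts on $n_1\wedge n_2$, $n_1,n_2\in\mathcal N$, as $+1$ or $-1$. Curvature: $R(e_c,e_d)e_b=R^a{}_{bcd}e_a$, $R_{ab}=R^c{}_{acb}$, $R=g^{ab}R_{ab}$, Schouten tensor $\mathsf P_{ab}=\tfrac12R_{ab}-\tfrac1{12}Rg_{ab}$, Weyl tensor $C_{abcd}=R_{abcd}+g_{ad}\mathsf P_{cb}-g_{ac}\mathsf P_{db}+g_{bc}\mathsf P_{da}-g_{bd}\mathsf P_{ca}$, Cotton tensor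 $A_{abc}=\nabla_b\mathsf P_{ca}-\nabla_c\mathsf P_{ba}$, $A(X,Y,Z)=A_{abc}X^aY^bZ^c$. A null frame is a local frame $(m,p,n,k)$ of ${\rm T}^{\mathbb C}\mathcal M$ with $g(m,p)=g(n,k)=1$, all other products of frame vectors zero; take it such that ${\rm Span}_{\mathbb C}(m,k)$ is selfdual. With $(\theta^1,\theta^2,\theta^3,\theta^4)$ the coframe dual to $(m,p,n,k)$, the selfdual 2-forms are spanned by $\theta^2\wedge\theta^3$, $\theta^1\wedge\theta^4$, $\theta^1\wedge\theta^2-\theta^3\wedge\theta^4$ and the antiselfdual 2-forms by $\theta^1\wedge\theta^3$, $\theta^2\wedge\theta^4$, $\theta^1\wedge\theta^2+\theta^3\wedge\theta^4$. The selfdual part of the Weyl tensor has components $\Psi_0=C(m,k,m,k)$, $\Psi_1=C(m,k,n,k)$, $\Psi_2=C(m,k,p,n)$, $\Psi_3=C(p,n,m,p)$, $\Psi_4=C(p,n,p,n)$. The selfdual totally null plane ${\rm Span}_{\mathbb C}(m+zn,k-zp)$ (or ${\rm Span}_{\mathbb C}(n,p)$ for $z=\infty$) is principal if $z$ is a root in $\mathbb C\cup\{\infty\}$ of $\Psi_4z^4-4\Psi_3z^3+6\Psi_2z^2+4\Psi_1z+\Psi_0$, and multiple principal if $z$ is a multiple root. The selfdual part of the Weyl tensor is algebraically special at a point if a multiple principal plane exists there. In a frame with $\mathcal N={\rm Span}_{\mathbb C}(m,k)$, $\mathcal N$ is multiple principal iff $\Psi_0\equiv\Psi_1\equiv0$.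 The metric $g$ is N-generic if the points where its selfdual part of the Weyl tensor vanishes belong to closed sets without interior in $\mathcal M$. *)

(* Defs.v *)
From HB Require Import structures.
From mathcomp Require Export all_boot all_order all_algebra.
From mathcomp Require Export all_classical all_reals all_analysis.
From mathcomp Require Export complex.

Set Implicit Arguments.
Unset Strict Implicit.
Unset Printing Implicit Defensive.

Export Order.TTheory GRing.Theory Num.Theory.
Export numFieldNormedType.Exports.

Local Open Scope classical_set_scope.
Local Open Scope ring_scope.
Local Open Scope complex_scope.

Section Smoothness.
Variable R : realType.
Local Notation V := 'rV[R]_4.

(* [smooth_upto k U f]: all partial derivatives of [f] of order at most [k]
   exist and are continuous at the points of the open set [U]. *)
Fixpoint smooth_upto (k : nat) (U : set V) (f : V -> R) : Prop :=
  (forall x, U x -> {for x, continuous f}) /\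
  (if k is k'.+1 then
     forall a : 'I_4, (forall x, U x -> derivable f x (delta_mx 0 a)) /\
                      smooth_upto k' U (fun x => 'D_(delta_mx 0 a) f x)
   else True).

Definition smooth (U : set V) (f : V -> R) : Prop :=
  forall k, smooth_upto k U f.

(* [R[i]] carries no normed [R]-module structure in the library, so complex
   functions of real variables are differentiated componentwise. *)
Definition csmooth (U : set V) (f : V -> R[i]) : Prop :=
  smooth U (fun x => complex.Re (f x)) /\ smooth U (fun x => complex.Im (f x)).

Definition cpartial (a : 'I_4) (f : V -> R[i]) (x : V) : R[i] :=
  'D_(delta_mx 0 a) (fun y => complex.Re (f y)) x +i*
  'D_(delta_mx 0 a) (fun y => complex.Im (f y)) x.

End Smoothness.

(* A 4-manifold is given by a smooth atlas; the atlas need not be maximal.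
   Chart [i] is the homeomorphism [phi i] from [dom i] onto its open image,
   with inverse [psi i]; values outside these sets are irrelevant. *)
Record manifold4 (R : realType) := Manifold4 {
  carrier :> topologicalType;
  hausdorff : hausdorff_space carrier;
  countable_basis : @second_countable carrier;
  chart : Type;
  dom : chart -> set carrier;
  phi : chart -> carrier -> 'rV[R]_4;
  psi : chart -> 'rV[R]_4 -> carrier;
  dom_open : forall i, open (dom i);
  dom_cover : forall p, exists i, dom i p;
  img_open : forall i, open (phi i @` dom i);
  phiK : forall i p, dom i p -> psi i (phi i p) = p;
  phi_cont : forall i p, dom i p -> {for p, continuous (phi i)};
  psi_cont : forall i x, (phi i @` dom i) x -> {for x, continuous (psi i)};
  transition_smooth : forall i j (b : 'I_4),
    smooth (phi i @` (dom i `&` dom j)) (fun x => phi j (psi i x) 0 b)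
}.

Section Fields.
Variables (R : realType) (M : manifold4 R).
Local Notation C := R[i].
Local Notation V := 'rV[R]_4.

Definition img (i : chart M) : set V := phi i @` dom i.

(* Domain, map and complexified Jacobian of the change of charts.  Tangent
   vectors are row vectors of components in the coordinate basis, and so
   transform by right multiplication by [cjac]. *)
Definition overlap (i j : chart M) : set V := phi i @` (dom i `&` dom j).
Definition transition (i j : chart M) (x : V) : V := phi j (psi i x).
Definition cjac (i j : chart M) (x : V) : 'M[C]_4 :=
  map_mx (real_complex R) (jacobian (transition i j) x).

(* Complex tensor fields are given by their components in all the charts. *)
Record cmetric := CMetric {
  gmx :> chart M -> V -> 'M[C]_4;
  gmx_smooth : forall i a b, csmooth (img i) (fun x => gmx i x a b);
  gmx_sym : forall i x, img i x -> (gmx i x)^T = gmx i x;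
  gmx_nondeg : forall i x, img i x -> gmx i x \in unitmx;
  gmx_transform : forall i j x, overlap i j x ->
    gmx i x = cjac i j x *m gmx j (transition i j x) *m (cjac i j x)^T
}.

(* An orientation of a complex-valued metric: a complex 4-form [vol] (here its
   component on the coordinate basis) normalized by [vol ^ 2 = det g], which is
   what makes the Hodge star below square to the identity in every signature.
   For a real metric this amounts to an orientation of the manifold. *)
Record orientation (g : cmetric) := Orientation {
  vol :> chart M -> V -> C;
  vol_smooth : forall i, csmooth (img i) (vol i);
  vol_sqr : forall i x, img i x -> vol i x ^+ 2 = \det (g i x);
  vol_transform : forall i j x, overlap i j x ->
    vol i x = \det (cjac i j x) * vol j (transition i j x)
}.

Record cvector_field := CVectorField {
  vf :> chart M -> V -> 'rV[C]_4;
  vf_smooth : forall i a, csmooth (img i) (fun x => vf i x 0 a);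
  vf_transform : forall i j x, overlap i j x ->
    vf j (transition i j x) = vf i x *m cjac i j x
}.

Record plane_field := PlaneField {
  plane :> chart M -> V -> {vspace 'rV[C]_4};
  plane_dim : forall i x, img i x -> \dim (plane i x) = 2%N;
  plane_smooth : forall i x, img i x ->
    exists (W : set V) (X Y : V -> 'rV[C]_4),
      [/\ open W, W x & W `<=` img i] /\
      (forall a, csmooth W (fun y => X y 0 a) /\ csmooth W (fun y => Y y 0 a)) /\
      (forall y, W y -> plane i y = <<[:: X y; Y y]>>%VS);
  plane_transform : forall i j x, overlap i j x -> forall v : 'rV[C]_4,
    (v \in plane i x) = (v *m cjac i j x \in plane j (transition i j x))
}.

Definition section_of (N : plane_field) (X : cvector_field) : Prop :=
  forall i x, img i x -> X i x \in N i x.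

Definition lie_bracket (X Y : V -> 'rV[C]_4) (x : V) : 'rV[C]_4 :=
  \row_a \sum_b (X x 0 b * cpartial b (fun y => Y y 0 a) x -
                 Y x 0 b * cpartial b (fun y => X y 0 a) x).

Definition integrable_planes (N : plane_field) : Prop :=
  forall X Y : cvector_field, section_of N X -> section_of N Y ->
  forall i x, img i x -> lie_bracket (X i) (Y i) x \in N i x.

End Fields.

(* At a point, [G] is the matrix of the metric and [w] the component of
   the normalized volume form. *)
Section PointwiseAlgebra.
Variable R : realType.
Local Notation C := R[i].
Implicit Types (G F B : 'M[C]_4) (w : C) (u v m p n k : 'rV[C]_4).

Definition gdot G u v : C := (u *m G *m v^T) 0 0.

Definition levi_civita (a b c d : 'I_4) : C :=
  \det (\matrix_(r < 4, s < 4) (tnth [tuple a; b; c; d] r == s)%:R).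

(* star(F)_ab = 1/2 w eps_abcd g^ce g^df F_ef *)
Definition hodge G w F : 'M[C]_4 :=
  \matrix_(a, b) (2^-1 * w * \sum_c \sum_d levi_civita a b c d *
                  (invmx G *m F *m (invmx G)^T) c d).

(* Hodge star on bivectors: lower both indices, apply [hodge], raise them. *)
Definition hodge_bivector G w B : 'M[C]_4 :=
  invmx G *m hodge G w (G *m B *m G^T) *m (invmx G)^T.

Definition wedge u v : 'M[C]_4 := u^T *m v - v^T *m u.

Definition antiselfdual_2form G w F : Prop := hodge G w F = - F.

Definition totally_null_space G (S : {vspace 'rV[C]_4}) : Prop :=
  {in S &, forall u v, gdot G u v = 0}.

Definition selfdual_space G w (S : {vspace 'rV[C]_4}) : Prop :=
  {in S &, forall u v, hodge_bivector G w (wedge u v) = wedge u v}.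

(* Null frames for which the plane spanned by [m] and [k] is selfdual. *)
Definition null_frame G w m p n k : Prop :=
  [/\ gdot G m p = 1 /\ gdot G n k = 1,
      [/\ gdot G m m = 0, gdot G p p = 0, gdot G n n = 0 & gdot G k k = 0],
      [/\ gdot G m n = 0, gdot G m k = 0, gdot G p n = 0 & gdot G p k = 0] &
      selfdual_space G w <<[:: m; k]>>%VS].

Definition tensor4 := 'I_4 -> 'I_4 -> 'I_4 -> 'I_4 -> C.
Implicit Type W : tensor4.

Definition eval4 W (u1 u2 u3 u4 : 'rV[C]_4) : C :=
  \sum_a \sum_b \sum_c \sum_d
    W a b c d * u1 0 a * u2 0 b * u3 0 c * u4 0 d.

Definition selfdual_part G w W : tensor4 := fun a b c d =>
  2^-1 * (W a b c d + hodge G w (\matrix_(e, f) W e f c d) a b).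

Definition weyl_quartic W m p n k : {poly C} :=
  let Psi0 := eval4 W m k m k in
  let Psi1 := eval4 W m k n k in
  let Psi2 := eval4 W m k p n in
  let Psi3 := eval4 W p n m p in
  let Psi4 := eval4 W p n p n in
  Psi4 *: 'X^4 - (4 * Psi3) *: 'X^3 + (6 * Psi2) *: 'X^2
    + (4 * Psi1) *: 'X + Psi0%:P.

(* A multiple root of the quartic in the extended plane; [None] is infinity,
   which is a multiple root when the coefficients of X^4 and X^3 vanish.  If the
   quartic is zero then every point is a multiple root. *)
Definition multiple_root (q : {poly C}) (z : option C) : Prop :=
  if z is Some z' then ('X - z'%:P) ^+ 2 %| q else (size q <= 3)%N.

Definition frame_plane m p n k (z : option C) : {vspace 'rV[C]_4} :=
  if z is Some z' then <<[:: (m + z' *: n)%R; (k - z' *: p)%R]>>%VS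
  else <<[:: n; p]>>%VS.

Definition multiple_principal_plane G w W (S : {vspace 'rV[C]_4}) : Prop :=
  exists m p n k, null_frame G w m p n k /\
    exists2 z, multiple_root (weyl_quartic W m p n k) z
             & S = frame_plane m p n k z.

Definition algebraically_special_tensor G w W : Prop :=
  exists S, multiple_principal_plane G w W S.

End PointwiseAlgebra.

Section Curvature.
Variable R : realType.
Local Notation C := R[i].
Local Notation V := 'rV[R]_4.
Variable g : V -> 'M[C]_4.
Implicit Types (a b c d e : 'I_4) (x : V).

(* nabla_(d_b) d_c = christoffel a b c d_a *)
Definition christoffel a b c x : C :=
  2^-1 * \sum_d invmx (g x) a d *
    (cpartial b (fun y => g y d c) x + cpartial c (fun y => g y d b) x
     - cpartial d (fun y => g y b c) x).

(* R^a_bcd, where R(d_c, d_d) d_b = R^a_bcd d_a *)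
Definition riemann_up a b c d x : C :=
  cpartial c (christoffel a d b) x - cpartial d (christoffel a c b) x
  + \sum_e (christoffel a c e x * christoffel e d b x
            - christoffel a d e x * christoffel e c b x).

Definition riemann a b c d x : C := \sum_e g x a e * riemann_up e b c d x.

Definition ricci a b x : C := \sum_c riemann_up c a c b x.

Definition scalar_curvature x : C :=
  \sum_a \sum_b invmx (g x) a b * ricci a b x.

Definition schouten a b x : C :=
  2^-1 * ricci a b x - 12^-1 * scalar_curvature x * g x a b.

Definition weyl x : tensor4 R := fun a b c d =>
  riemann a b c d x + g x a d * schouten c b x - g x a c * schouten d b x
  + g x b c * schouten d a x - g x b d * schouten c a x.

(* nabla_b P_ca *)
Definition nabla_schouten b c a x : C :=
  cpartial b (schouten c a) x
  - \sum_e (christoffel e b c x * schouten e a x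
            + christoffel e b a x * schouten c e x).

Definition cotton a b c x : C :=
  nabla_schouten b c a x - nabla_schouten c b a x.

Definition cotton_2form (Z : V -> 'rV[C]_4) x : 'M[C]_4 :=
  \matrix_(b, c) \sum_a Z x 0 a * cotton a b c x.

End Curvature.

(* The properties below are tensorial, hence do not depend on the chart in
   which they are tested. *)
Section Conditions.
Variables (R : realType) (M : manifold4 R) (g : cmetric M) (w : orientation g).

Definition selfdual_weyl (i : chart M) (x : 'rV[R]_4) : tensor4 R :=
  selfdual_part (g i x) (w i x) (weyl (g i) x).

Definition selfdual_weyl_zeros : set M :=
  [set p | exists2 i, dom i p &
             forall a b c d, selfdual_weyl i (phi i p) a b c d = 0].

Definition N_generic : Prop :=
  exists F : set M, [/\ closed F, F° = set0 & selfdual_weyl_zeros `<=` F].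

Definition algebraically_special_at (p : M) : Prop :=
  forall i, dom i p ->
    algebraically_special_tensor (g i (phi i p)) (w i (phi i p))
      (weyl (g i) (phi i p)).

Definition totally_null (N : plane_field M) : Prop :=
  forall i x, img i x -> totally_null_space (g i x) (N i x).

Definition selfdual (N : plane_field M) : Prop :=
  forall i x, img i x -> selfdual_space (g i x) (w i x) (N i x).

Definition multiple_principal (N : plane_field M) : Prop :=
  forall i x, img i x ->
    multiple_principal_plane (g i x) (w i x) (weyl (g i) x) (N i x).

Definition cotton_antiselfdual (Z : cvector_field M) : Prop :=
  forall i x, img i x ->
    antiselfdual_2form (g i x) (w i x) (cotton_2form (g i) (Z i) x).

End Conditions.

(* Main.v *)
From HB Require Import structures.
Require Import Defs.
From mathcomp Require Import perm ring lra.

(** The contracted Bianchi identity reads nabla^a C_abcd = A_bcd.  Let the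
    sections X, Y span N near a point.  That N is multiple principal means
    C(X,Y,X,.) = C(X,Y,Y,.) = 0; differentiating this, contracting with the
    metric and using that A_X, A_Y are antiselfdual gives Psi_2 gamma = 0, where
    gamma, the restriction to N of e |-> g(nabla_e X, Y), vanishes exactly when
    [X,Y] lies in N.  If [X,Y] leaves N at some point, then X and Y are
    independent there, so they span N nearby, gamma stays nonzero and Psi_2
    vanishes on an open set.  There C(X,Y,.,.) = 0, and differentiating as
    before gives Psi_3 = 0 and then Psi_4 = 0: the selfdual part of the Weyl
    tensor vanishes on an open set, against N-genericity.  As the offending
    sections themselves span N nearby, local sections never have to be extended
    to global ones. *)

Set Implicit Arguments.
Unset Strict Implicit.
Unset Printing Implicit Defensive.

Local Open Scope classical_set_scope.
Local Open Scope ring_scope.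
Local Open Scope complex_scope.

(** * Smooth functions on open sets *)

(** A null frame completing X and Y is found at each point separately, with no control on how p and
    n vary. Only X, Y and tensors are therefore differentiated, and a condition must be expressed
    through X and Y before its derivative is taken; the frame is chosen afterwards. The conditions
    Psi_0 = Psi_1 = 0 and C(X,Y,.,.) = 0 already have this form. The condition Psi_3 = 0 does not,
    since its natural expression contracts C with m /\ p - n /\ k; [commutator_form] replaces it.

    The tensor identities are proved over a commutative ring with four commuting derivations. Smooth
    functions on an open set form such a ring, and evaluation at a point of the set is a morphism to
    the complex numbers. An equation between ring elements holds at all points of the set, which is
    what permits differentiating it.

    The three steps produce 3 gamma Psi_2, 2 gamma Psi_3 and 2 gamma Psi_4, whence the assumptions
    that 2 and 3 can be cancelled.

    For Z in N, g([X,Y],Z) is an alternating bilinear function of the values of X and Y at the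
    point, since derivatives can be moved onto Z; this is why it vanishes where X and Y are
    dependent. *)

Section SmoothUpto.
Variable R : realType.
Local Notation V := 'rV[R]_4.
Implicit Types (U : set V) (f g : V -> R).

Lemma near_continuous (f g : V -> R) x : (\near x, f x = g x) ->
  {for x, continuous f} -> {for x, continuous g}.
Proof.
move=> fg cf; have fgx : f x = g x := nbhs_singleton fg.
have cfx : f @ x --> f x by exact: cf.
change (g @ x --> g x); rewrite -fgx.
exact: cvg_trans (near_eq_cvg fg) cfx.
Qed.

(** Derivatives at a point of the open set [U] depend only on values in [U]. Most closure properties
    below need this, because the formula for the derivative of a compound function is known only on
    [U]. *)
Lemma smooth_upto_ext k U f g : open U -> (forall x, U x -> f x = g x) ->
  smooth_upto k U f -> smooth_upto k U g.
Proof.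
move=> oU; have near_fg (f' g' : V -> R) x : (forall x, U x -> f' x = g' x) ->
    U x -> \near x, f' x = g' x.
  by move=> fg Ux; near=> y; apply: fg; near: y; exact: open_nbhs_nbhs.
elim: k f g => [|k IH] f g fg [cf sf].
  by split=> // x Ux; apply: near_continuous (near_fg _ _ _ fg Ux) (cf _ Ux).
split=> [x Ux|a]; first exact: near_continuous (near_fg _ _ _ fg Ux) (cf _ Ux).
have [df sdf] := sf a; split=> [x Ux|].
  exact: near_eq_derivable (near_fg _ _ _ fg Ux) (df _ Ux).
by apply: IH sdf => x Ux; exact: near_eq_derive (near_fg _ _ _ fg Ux).
Unshelve. all: by end_near. Qed.

Lemma smooth_upto_cont k U f : smooth_upto k U f ->
  forall x, U x -> {for x, continuous f}.
Proof. by case: k => [|k] []. Qed.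

Lemma smooth_uptoW k U f : smooth_upto k.+1 U f -> smooth_upto k U f.
Proof.
elim: k f => [|k IH] f [cf sf]; split=> // a.
by have [df sdf] := sf a; split=> //; exact: IH.
Qed.

Lemma smooth_upto_sub k U U' f : U' `<=` U -> smooth_upto k U f ->
  smooth_upto k U' f.
Proof.
move=> UU'; elim: k f => [|k IH] f [cf sf]; split; try by move=> x /UU'; exact: cf.
  by [].
move=> a; have [df sdf] := sf a; split; first by move=> x /UU'; exact: df.
exact: IH.
Qed.

Lemma smooth_upto_cst k U (c : R) : smooth_upto k U (fun=> c).
Proof.
elim: k c => [|k IH] c; (split; first by move=> x _; exact: cst_continuous) => //.
move=> a; split=> [x _|]; first exact: derivable_cst.
have -> : (fun x : V => 'D_(delta_mx 0 a) (fun=> c) x) = fun=> 0.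
  by apply/funext => x; exact: derive_cst.
exact: IH.
Qed.

Lemma smooth_uptoD k U f g : open U -> smooth_upto k U f -> smooth_upto k U g ->
  smooth_upto k U (fun x => f x + g x).
Proof.
move=> oU; elim: k f g => [|k IH] f g [cf sf] [cg sg];
  (split; first by move=> x Ux; apply: continuousD; [exact: cf|exact: cg]) => //.
move=> a; have [df sdf] := sf a; have [dg sdg] := sg a; split.
  by move=> x Ux; apply: derivableD; [exact: df|exact: dg].
apply: smooth_upto_ext (IH _ _ sdf sdg) => // x Ux.
by rewrite -deriveD//; [exact: df|exact: dg].
Qed.

Lemma smooth_uptoM k U f g : open U -> smooth_upto k U f -> smooth_upto k U g ->
  smooth_upto k U (fun x => f x * g x).
Proof.
move=> oU; elim: k f g => [|k IH] f g sf sg;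
  (split; first by move=> x Ux; apply: continuousM;
     [exact: smooth_upto_cont sf _ Ux|exact: smooth_upto_cont sg _ Ux]) => //.
move=> a; have [df sdf] := sf.2 a; have [dg sdg] := sg.2 a; split.
  by move=> x Ux; apply: derivableM; [exact: df|exact: dg].
have := smooth_uptoD oU (IH _ _ (smooth_uptoW sf) sdg) (IH _ _ (smooth_uptoW sg) sdf).
apply: smooth_upto_ext => // x Ux.
by rewrite -[RHS]/('D__ (f * g) x) deriveM//; [exact: df|exact: dg].
Qed.

Lemma smooth_uptoN k U f : open U -> smooth_upto k U f ->
  smooth_upto k U (fun x => - f x).
Proof.
move=> oU sf; apply: smooth_upto_ext (smooth_uptoM oU (smooth_upto_cst k U (-1)) sf) => //.
by move=> x _; rewrite mulN1r.
Qed.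

Lemma smooth_uptoV k U f : open U -> (forall x, U x -> f x != 0) ->
  smooth_upto k U f -> smooth_upto k U (fun x => (f x)^-1).
Proof.
move=> oU f0; elim: k => [|k IH] sf;
  (split; first by move=> x Ux; apply: continuousV;
     [exact: f0|exact: smooth_upto_cont sf _ Ux]) => //.
move=> a; have [df sdf] := sf.2 a; split.
  by move=> x Ux; apply: derivableV; [exact: f0|exact: df].
(* D(1/f) = - (1/f)^2 Df, so 1/f is needed only to the lower order, where the induction hypothesis
   applies. *)
have sV := IH (smooth_uptoW sf).
have := smooth_uptoM oU (smooth_uptoN oU (smooth_uptoM oU sV sV)) sdf.
apply: smooth_upto_ext => // x Ux.
by rewrite deriveV//; [rewrite expr2 invfM|exact: f0|exact: df].
Qed.

(** Restriction to a line, the form in which the one-variable mean value theorem can be used. *)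
Lemma derivable_line f (x u : V) (t : R) :
  derivable f (x + t *: u) u ->
  is_derive t (1 : R) (fun s => f (x + s *: u)) ('D_u f (x + t *: u)).
Proof.
have E : (fun h => h^-1 *: (((fun s => f (x + s *: u)) \o shift t) (h *: (1 : R)) - f (x + t *: u)))
    = (fun h => h^-1 *: ((f \o shift (x + t *: u)) (h *: u) - f (x + t *: u))).
  apply/funext => h /=; congr (_ *: (f _ - _)).
  by rewrite [h *: 1]mulr1 scalerDl addrCA.
by move=> df; split; rewrite /derivable /derive E.
Qed.

(* Two applications of the mean value theorem to the second difference of [f]
   on a small parallelogram. *)
Lemma second_difference f F U (u v x : V) (s : R) : 0 < s ->
  F = 'D_v ('D_u f) ->
  (forall a b, 0 <= a <= s -> 0 <= b <= s -> U (x + a *: u + b *: v)) ->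
  (forall y, U y -> derivable f y u) ->
  (forall y, U y -> derivable ('D_u f) y v) ->
  exists a b, [/\ 0 <= a <= s, 0 <= b <= s &
    f (x + s *: u + s *: v) - f (x + s *: v) - f (x + s *: u) + f x =
    F (x + a *: u + b *: v) * s ^+ 2].
Proof.
move=> s0 -> sU df ddf.
pose Phi (a : R) := f (x + a *: u + s *: v) - f (x + a *: u).
pose dPhi (a : R) := 'D_u f (x + a *: u + s *: v) - 'D_u f (x + a *: u).
have s00 : 0 <= s <= s by rewrite lexx ltW.
have z00 : 0 <= (0 : R) <= s by rewrite lexx ltW.
have isF a : 0 <= a <= s -> is_derive a (1 : R) Phi (dPhi a).
  move=> ha; rewrite /Phi /dPhi; apply: is_deriveB.
    have -> : (fun a => f (x + a *: u + s *: v)) = (fun a => f ((x + s *: v) + a *: u)).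
      by apply/funext => r; rewrite addrAC.
    by rewrite addrAC; apply: derivable_line; rewrite addrAC; apply/df/sU.
  apply: derivable_line; apply: df.
  by have := sU a 0 ha z00; rewrite scale0r addr0.
have cF (G dG : R -> R) : (forall a, 0 <= a <= s -> is_derive a (1 : R) G (dG a)) ->
    {within `[0, s], continuous G}.
  move=> isG; apply: derivable_within_continuous => a; rewrite in_itv /= => ha.
  by have [] := isG a ha.
have [a] : exists2 c, c \in `]0, s[%R & Phi s - Phi 0 = dPhi c * (s - 0).
  apply: MVT => //; last exact: cF isF.
  by move=> c; rewrite in_itv /= => /andP[c0 cs]; apply: isF; rewrite !ltW.
rewrite in_itv /= => /andP[a0 as_] Fs.
have ha : 0 <= a <= s by rewrite !ltW.
have isG b : 0 <= b <= s -> is_derive b (1 : R)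
    (fun b => 'D_u f (x + a *: u + b *: v)) ('D_v ('D_u f) (x + a *: u + b *: v)).
  by move=> hb; apply: derivable_line; apply/ddf/sU.
have [b] : exists2 c, c \in `]0, s[%R &
    'D_u f (x + a *: u + s *: v) - 'D_u f (x + a *: u + 0 *: v) =
    'D_v ('D_u f) (x + a *: u + c *: v) * (s - 0).
  apply: (MVT s0 _ (cF _ _ isG)) => c cs'; apply: isG; move: cs'; by rewrite in_itv /= => /andP[c0 cs]; rewrite !ltW.
rewrite in_itv /= => /andP[b0 bs] Gs.
exists a, b; split; rewrite ?ltW //.
move: Fs; rewrite /Phi /dPhi subr0 scale0r !addr0.
move: Gs; rewrite subr0 scale0r addr0 => -> E.
rewrite expr2 mulrA -E; ring.
Qed.

Lemma near_continuous2 (F G : V -> R) x U e : 0 < e -> nbhs x U ->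
  {for x, continuous F} -> {for x, continuous G} ->
  exists2 d, 0 < d & forall y, `|x - y| < d ->
    U y /\ `|F x - F y| < e /\ `|G x - G y| < e.
Proof.
move=> e0 nU /cvgrPdist_lt/(_ e e0) nF /cvgrPdist_lt/(_ e e0) nG.
have : \forall y \near x, U y /\ `|F x - F y| < e /\ `|G x - G y| < e.
  near=> y; split; first by near: y.
  by split; near: y.
by move=> /nbhs_normP[d /= d0 dP]; exists d.
Unshelve. all: by end_near. Qed.

(** The second difference on a small parallelogram is symmetric in [u] and [v], and equals s^2 times
    a value of [F] as well as s^2 times a value of [G], both taken near x. Continuity at x does the
    rest. *)
Lemma schwarz_at f F G U (u v x : V) : open U -> U x ->
  (forall y, U y -> derivable f y u) -> (forall y, U y -> derivable f y v) ->
  (forall y, U y -> derivable ('D_u f) y v) ->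
  (forall y, U y -> derivable ('D_v f) y u) ->
  F = 'D_v ('D_u f) -> G = 'D_u ('D_v f) ->
  {for x, continuous F} -> {for x, continuous G} -> G x = F x.
Proof.
move=> oU Ux du dv duv dvu FE GE cF cG.
apply/eqP/negPn/negP => FG.
pose e := `|G x - F x| / 2.
have e0 : 0 < e by rewrite divr_gt0 ?normr_gt0 ?subr_eq0.
have [d d0 dP] := near_continuous2 e0 (open_nbhs_nbhs (conj oU Ux)) cF cG.
(* Ensures s (|u| + |v|) < d, so that the parallelogram stays within distance d of x; the 1 keeps
   the denominator positive. *)
pose s := d / (1 + `|u| + `|v|) / 2.
have n0 : 0 < 1 + `|u| + `|v| by rewrite -addrA ltr_wpDr // addr_ge0.
have s0 : 0 < s by rewrite /s !divr_gt0.
have dist r t : 0 <= r <= s -> 0 <= t <= s ->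
    `|x - (x + r *: u + t *: v)| < d.
  move=> /andP[r0 rs] /andP[t0 ts]; rewrite -addrA opprD addrA subrr sub0r normrN.
  apply: le_lt_trans (ler_normD _ _) _; rewrite !normrZ !ger0_norm //.
  apply: le_lt_trans (lerD (ler_wpM2r (normr_ge0 u) rs) (ler_wpM2r (normr_ge0 v) ts)) _.
  rewrite -mulrDr /s -!mulrA gtr_pMr // mulrA -invfM ltr_pdivrMl ?mulr_gt0 //.
  by have := normr_ge0 u; have := normr_ge0 v; lra.
have sU r t : 0 <= r <= s -> 0 <= t <= s -> U (x + r *: u + t *: v).
  by move=> hr ht; have [] := dP _ (dist r t hr ht).
have sU' r t : 0 <= r <= s -> 0 <= t <= s -> U (x + r *: v + t *: u).
  by move=> hr ht; rewrite addrAC; apply: sU.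
have [p [q [hp hq E1]]] := second_difference s0 FE sU du duv.
have [p' [q' [hp' hq' E2]]] := second_difference s0 GE sU' dv dvu.
have FG' : F (x + p *: u + q *: v) = G (x + p' *: v + q' *: u).
  have s2 : s ^+ 2 != 0 by rewrite expf_neq0 // gt_eqF.
  apply: (mulIf s2); rewrite -E1 -E2; rewrite [x + _ + _]addrAC; ring.
have [_ [Fe _]] := dP _ (dist p q hp hq).
have := dist q' p' hq' hp'; rewrite addrAC => /dP [_ [_ Ge]].
have : `|G x - F x| < e + e.
  have -> : G x - F x = (G x - G (x + p' *: v + q' *: u)) - (F x - F (x + p *: u + q *: v)).
    by rewrite FG'; ring.
  by apply: le_lt_trans (ler_normB _ _) _; rewrite ltrD.
by rewrite /e -splitr ltxx.
Qed.

Lemma derive_symm k U f a b x : open U -> smooth_upto k.+2 U f -> U x ->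
  'D_(delta_mx 0 a) ('D_(delta_mx 0 b) f) x =
  'D_(delta_mx 0 b) ('D_(delta_mx 0 a) f) x.
Proof.
move=> oU [_ sf] Ux; have [du [_ sdu]] := sf a; have [dv [_ sdv]] := sf b.
have [duv sduv] := sdu b; have [dvu sdvu] := sdv a.
exact: (schwarz_at oU Ux du dv duv dvu (erefl _) (erefl _)
  (smooth_upto_cont sduv Ux) (smooth_upto_cont sdvu Ux)).
Qed.

End SmoothUpto.

(** * Complex-valued smooth functions of real variables *)

Section ComplexSmooth.
Variable R : realType.
Local Notation V := 'rV[R]_4.
Local Notation C := R[i].
Implicit Types (U : set V) (f g : V -> C).

Lemma ReD (x y : C) : complex.Re (x + y) = complex.Re x + complex.Re y.
Proof. by case: x y => [a b] [c d]. Qed.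
Lemma ImD (x y : C) : complex.Im (x + y) = complex.Im x + complex.Im y.
Proof. by case: x y => [a b] [c d]. Qed.
Lemma ReM (x y : C) : complex.Re (x * y) =
  complex.Re x * complex.Re y - complex.Im x * complex.Im y.
Proof. by case: x y => [a b] [c d]. Qed.
Lemma ImM (x y : C) : complex.Im (x * y) =
  complex.Re x * complex.Im y + complex.Im x * complex.Re y.
Proof. by case: x y => [a b] [c d]. Qed.
Lemma complexE (x y : C) : complex.Re x = complex.Re y ->
  complex.Im x = complex.Im y -> x = y.
Proof. by case: x y => [a b] [c d] /= -> ->. Qed.

Lemma csmooth_ext U f g : open U -> (forall x, U x -> f x = g x) ->
  csmooth U f -> csmooth U g.
Proof.
move=> oU fg [sr si]; split=> k; [apply: smooth_upto_ext (sr k)|apply: smooth_upto_ext (si k)] => // x Ux;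
  by rewrite fg.
Qed.

Lemma csmooth_sub U U' f : U' `<=` U -> csmooth U f -> csmooth U' f.
Proof. by move=> UU' [sr si]; split=> k; [apply: smooth_upto_sub (sr k)|apply: smooth_upto_sub (si k)]. Qed.

Lemma csmooth_cst U (c : C) : csmooth U (fun=> c).
Proof. by split=> k; exact: smooth_upto_cst. Qed.

Lemma csmoothD U f g : open U -> csmooth U f -> csmooth U g ->
  csmooth U (fun x => f x + g x).
Proof.
move=> oU [fr fi] [gr gi]; split=> k.
  by under eq_fun do rewrite ReD; apply: smooth_uptoD.
by under eq_fun do rewrite ImD; apply: smooth_uptoD.
Qed.

Lemma csmoothM U f g : open U -> csmooth U f -> csmooth U g ->
  csmooth U (fun x => f x * g x).
Proof.
move=> oU [fr fi] [gr gi]; split=> k.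
  under eq_fun do rewrite ReM.
  by apply: smooth_uptoD => //; [apply: smooth_uptoM|apply/smooth_uptoN/smooth_uptoM].
by under eq_fun do rewrite ImM; apply: smooth_uptoD => //; apply: smooth_uptoM.
Qed.

(** 1/f is the conjugate of f times 1/|f|^2, and |f|^2 is a real function without zeros on [U]. *)
Lemma csmoothV U f : open U -> (forall x, U x -> f x != 0) -> csmooth U f ->
  csmooth U (fun x => (f x)^-1).
Proof.
move=> oU f0 [fr fi].
have sn k : smooth_upto k U (fun x => (complex.Re (f x) * complex.Re (f x) + complex.Im (f x) * complex.Im (f x))^-1).
  apply: smooth_uptoV => //.
    move=> x /f0; apply: contra_neq => E.
    apply: complexE => /=; apply/eqP; rewrite -sqrf_eq0 expr2 eq_le; apply/andP; split.
    - by have := sqr_ge0 (complex.Im (f x)); rewrite expr2; lra.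
    - by rewrite -expr2 sqr_ge0.
    - by have := sqr_ge0 (complex.Re (f x)); rewrite expr2; lra.
    - by rewrite -expr2 sqr_ge0.
  by apply: smooth_uptoD => //; apply: smooth_uptoM.
split=> k.
  apply: smooth_upto_ext (smooth_uptoM oU (fr k) (sn k)) => // x Ux.
  by case: (f x) => a b /=; rewrite !expr2.
apply: smooth_upto_ext (smooth_uptoN oU (smooth_uptoM oU (fi k) (sn k))) => // x Ux.
by case: (f x) => a b /=; rewrite !expr2.
Qed.

Lemma csmooth_partial U a f : csmooth U f -> csmooth U (cpartial a f).
Proof. by move=> [fr fi]; split=> k; [case: (fr k.+1)|case: (fi k.+1)] => _ /(_ a) []. Qed.

Lemma csmooth_neq0_open U f x : open U -> csmooth U f -> U x -> f x != 0 ->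
  \forall y \near x, f y != 0.
Proof.
move=> oU [fr fi] Ux fx0.
have cont (h : V -> R) : {for x, continuous h} -> h x != 0 -> \forall y \near x, h y != 0.
  move=> ch hx; have chx : h @ x --> h x := ch.
  have : \forall z \near h x, z != 0 by apply: open_nbhs_nbhs; split => //; exact: open_neq.
  by move=> /chx.
have [r0|r0] := eqVneq (complex.Re (f x)) 0; last first.
  have := cont _ (smooth_upto_cont (fr 0%N) Ux) r0.
  by apply: filterS => y; apply: contra_neq => ->.
have i0 : complex.Im (f x) != 0.
  by apply: contra_neq fx0 => i0; apply: complexE.
have := cont _ (smooth_upto_cont (fi 0%N) Ux) i0.
by apply: filterS => y; apply: contra_neq => ->.
Qed.

Lemma csmooth_derivable U f a x : csmooth U f -> U x ->
  derivable (fun y => complex.Re (f y)) x (delta_mx 0 a) /\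
  derivable (fun y => complex.Im (f y)) x (delta_mx 0 a).
Proof.
by move=> [fr fi] Ux; have [_ /(_ a) [? _]] := fr 1%N; have [_ /(_ a) [? _]] := fi 1%N; split; auto.
Qed.

Lemma cpartial_ext U f g a x : open U -> (forall y, U y -> f y = g y) -> U x ->
  cpartial a f x = cpartial a g x.
Proof.
move=> oU fg Ux; have E : \forall y \near x, f y = g y.
  by near=> y; apply: fg; near: y; exact: open_nbhs_nbhs.
by apply: complexE => /=; apply: near_eq_derive; apply: filterS E => y ->.
Unshelve. all: by end_near. Qed.

Lemma deriveMB (a b c d : V -> R) x v : derivable a x v -> derivable b x v ->
  derivable c x v -> derivable d x v ->
  'D_v (fun y => a y * b y - c y * d y) x =
  'D_v a x * b x + a x * 'D_v b x - ('D_v c x * d x + c x * 'D_v d x).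
Proof.
move=> da db dc dd; rewrite (deriveB (derivableM da db) (derivableM dc dd)).
rewrite (deriveM da db) (deriveM dc dd) /GRing.scale /=.
move: ('D_v a x) ('D_v b x) ('D_v c x) ('D_v d x) => *; ring.
Qed.

Lemma deriveMD (a b c d : V -> R) x v : derivable a x v -> derivable b x v ->
  derivable c x v -> derivable d x v ->
  'D_v (fun y => a y * b y + c y * d y) x =
  'D_v a x * b x + a x * 'D_v b x + ('D_v c x * d x + c x * 'D_v d x).
Proof.
move=> da db dc dd; rewrite (deriveD (derivableM da db) (derivableM dc dd)).
rewrite (deriveM da db) (deriveM dc dd) /GRing.scale /=.
move: ('D_v a x) ('D_v b x) ('D_v c x) ('D_v d x) => *; ring.
Qed.

Lemma cpartialD U f g a x : csmooth U f -> csmooth U g -> U x ->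
  cpartial a (fun y => f y + g y) x = cpartial a f x + cpartial a g x.
Proof.
move=> sf sg Ux; have [fr fi] := csmooth_derivable a sf Ux.
have [gr gi] := csmooth_derivable a sg Ux.
rewrite /cpartial.
under eq_fun do rewrite ReD; under [X in _ +i* 'D__ X _ ]eq_fun do rewrite ImD.
by rewrite (deriveD fr gr) (deriveD fi gi).
Qed.

Lemma cpartialM U f g a x : csmooth U f -> csmooth U g -> U x ->
  cpartial a (fun y => f y * g y) x = cpartial a f x * g x + f x * cpartial a g x.
Proof.
move=> sf sg Ux; have [fr fi] := csmooth_derivable a sf Ux.
have [gr gi] := csmooth_derivable a sg Ux.
rewrite /cpartial.
under eq_fun do rewrite ReM; under [X in _ +i* 'D__ X _ ]eq_fun do rewrite ImM.
rewrite (deriveMB fr gr fi gi) (deriveMD fr gi fi gr).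
apply: complexE; rewrite ?(ReD, ImD, ReM, ImM) /=; ring.
Qed.

Lemma cpartial_symm U f a b x : open U -> csmooth U f -> U x ->
  cpartial a (cpartial b f) x = cpartial b (cpartial a f) x.
Proof.
by move=> oU [fr fi] Ux; apply: complexE => /=; [have := fr 2%N|have := fi 2%N] => sf;
  exact: derive_symm oU sf Ux.
Qed.

End ComplexSmooth.

(** * The differential ring of smooth functions on an open set *)

Section SmoothRing.
Variables (R : realType) (U : set 'rV[R]_4) (oU : open U).
Local Notation V := 'rV[R]_4.
Local Notation C := R[i].

(* Functions smooth on [U], made into a ring by identifying those that agree on
   [U]: the representative vanishes outside [U]. *)
Record sfun := SFun {
  sfun_val :> V -> C;
  sfun_smooth : csmooth U sfun_val;
  sfun_out : forall x, ~ U x -> sfun_val x = 0 }.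

Lemma sfunP (f g : sfun) : (forall x, U x -> f x = g x) -> f = g.
Proof.
case: f g => [f sf f0] [g sg g0] /= fg.
have E : f = g by apply/funext => x; have [/fg//|nU] := pselect (U x); rewrite f0 ?g0.
by subst g; congr SFun; exact: Prop_irrelevance.
Qed.

Definition cut (f : V -> C) (x : V) : C := if pselect (U x) then f x else 0.

Lemma cutE f x : U x -> cut f x = f x.
Proof. by rewrite /cut; case: pselect. Qed.

Lemma cut_out f x : ~ U x -> cut f x = 0.
Proof. by rewrite /cut; case: pselect. Qed.

Lemma cut_smooth f : csmooth U f -> csmooth U (cut f).
Proof. by apply: csmooth_ext => // x Ux; rewrite cutE. Qed.

Definition to_sfun f (sf : csmooth U f) : sfun := SFun (cut_smooth sf) (@cut_out f).

Lemma to_sfunE f (sf : csmooth U f) x : U x -> to_sfun sf x = f x.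
Proof. exact: cutE. Qed.

(* The argument, on which the ring instance depends, is recorded in the type. *)
Definition sring of open U : Type := sfun.
Local Notation A := (sring oU).

Definition sfun_cst (c : C) : A := to_sfun (csmooth_cst U c).
Definition sfun_add (f g : A) : A :=
  to_sfun (csmoothD oU (sfun_smooth f) (sfun_smooth g)).
Definition sfun_mul (f g : A) : A :=
  to_sfun (csmoothM oU (sfun_smooth f) (sfun_smooth g)).
Definition sfun_opp (f : A) : A := sfun_mul (sfun_cst (-1)) f.

HB.instance Definition _ := gen_eqMixin A.
HB.instance Definition _ := gen_choiceMixin A.

Let sfunE := to_sfunE.

Fact sfun_addA : associative sfun_add.
Proof. by move=> f g h; apply: sfunP => x Ux; rewrite !sfunE // addrA. Qed.
Fact sfun_addC : commutative sfun_add.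
Proof. by move=> f g; apply: sfunP => x Ux; rewrite !sfunE // addrC. Qed.
Fact sfun_add0 : left_id (sfun_cst 0) sfun_add.
Proof. by move=> f; apply: sfunP => x Ux; rewrite !sfunE // add0r. Qed.
Fact sfun_addN : left_inverse (sfun_cst 0) sfun_opp sfun_add.
Proof. by move=> f; apply: sfunP => x Ux; rewrite !sfunE // mulN1r addNr. Qed.
Fact sfun_mulA : associative sfun_mul.
Proof. by move=> f g h; apply: sfunP => x Ux; rewrite !sfunE // mulrA. Qed.
Fact sfun_mulC : commutative sfun_mul.
Proof. by move=> f g; apply: sfunP => x Ux; rewrite !sfunE // mulrC. Qed.
Fact sfun_mul1 : left_id (sfun_cst 1) sfun_mul.
Proof. by move=> f; apply: sfunP => x Ux; rewrite !sfunE // mul1r. Qed.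
Fact sfun_mulD : left_distributive sfun_mul sfun_add.
Proof. by move=> f g h; apply: sfunP => x Ux; rewrite !sfunE // mulrDl. Qed.

HB.instance Definition _ := GRing.isZmodule.Build A
  sfun_addA sfun_addC sfun_add0 sfun_addN.
(** The structure allows 0 = 1, which does occur when [U] is empty. *)
HB.instance Definition _ := GRing.Zmodule_isComPzRing.Build A
  sfun_mulA sfun_mulC sfun_mul1 sfun_mulD.

Definition ev (x : V) (f : A) : C := f x.

Definition sfun_D (a : 'I_4) (f : A) : A :=
  to_sfun (csmooth_partial a (sfun_smooth f)).

Implicit Types f g : A.

Lemma evD x f g : U x -> ev x (f + g) = ev x f + ev x g.
Proof. exact: sfunE. Qed.
Lemma evM x f g : U x -> ev x (f * g) = ev x f * ev x g.
Proof. exact: sfunE. Qed.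
Lemma ev0 x : U x -> ev x 0 = 0.
Proof. exact: sfunE. Qed.
Lemma ev1 x : U x -> ev x 1 = 1.
Proof. exact: sfunE. Qed.
Lemma evN x f : U x -> ev x (- f) = - ev x f.
Proof. by move=> Ux; apply/eqP; rewrite -addr_eq0 -evD // addNr ev0. Qed.
Lemma ev_to_sfun (f : V -> C) (sf : csmooth U f) x : U x -> ev x (to_sfun sf) = f x.
Proof. exact: sfunE. Qed.

Lemma ev_ext f g : (forall x, U x -> ev x f = ev x g) -> f = g.
Proof. exact: sfunP. Qed.

(** [F] is any function agreeing with [f] on [U], so that coordinate expressions defined on the
    whole space can be differentiated inside the ring. *)
Lemma ev_D (F : V -> C) (f : A) a x : (forall y, U y -> F y = ev y f) -> U x ->
  cpartial a F x = ev x (sfun_D a f).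
Proof. by move=> Ff Ux; rewrite /sfun_D ev_to_sfun //; exact: cpartial_ext Ff Ux. Qed.

Lemma sfun_DD a : {morph sfun_D a : f g / f + g}.
Proof.
move=> f g; apply: ev_ext => x Ux; rewrite evD // /sfun_D !ev_to_sfun //.
rewrite -(cpartialD a (sfun_smooth f) (sfun_smooth g) Ux).
by apply: cpartial_ext oU _ Ux => y Uy; exact: evD.
Qed.

Lemma sfun_DM a f g : sfun_D a (f * g) = sfun_D a f * g + f * sfun_D a g.
Proof.
apply: ev_ext => x Ux; rewrite evD // !evM // /sfun_D !ev_to_sfun //.
rewrite -(cpartialM a (sfun_smooth f) (sfun_smooth g) Ux).
by apply: cpartial_ext oU _ Ux => y Uy; exact: evM.
Qed.

Lemma sfun_DC a b f : sfun_D a (sfun_D b f) = sfun_D b (sfun_D a f).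
Proof.
apply: ev_ext => x Ux.
have E a' b' : ev x (sfun_D a' (sfun_D b' f)) = cpartial a' (cpartial b' f) x.
  by symmetry; apply: ev_D Ux => y Uy; rewrite /sfun_D ev_to_sfun.
have Eab := E a b; have Eba := E b a.
exact (etrans Eab (etrans (cpartial_symm a b oU (sfun_smooth f) Ux) (esym Eba))).
Qed.

(** Outside [U] every element evaluates to 0, so evaluation is a ring morphism only at points of
    [U]; taking the point in the subtype makes it one without side conditions. *)
Definition evp (p : {x | U x}) f : C := f (sval p).

Fact evp_zmod p : zmod_morphism (evp p).
Proof. by move=> f g; rewrite -[LHS]/(ev _ _) evD ?evN //; exact: svalP. Qed.
Fact evp_monoid p : monoid_morphism (evp p).
Proof.
by split=> [|f g]; rewrite -[LHS]/(ev _ _) ?ev1 ?evM //; exact: svalP.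
Qed.

HB.instance Definition _ p := GRing.isZmodMorphism.Build A C (evp p) (evp_zmod p).
HB.instance Definition _ p := GRing.isMonoidMorphism.Build A C (evp p) (evp_monoid p).

Lemma evp_ext f g : (forall p, evp p f = evp p g) -> f = g.
Proof. by move=> E; apply: ev_ext => x Ux; exact: (E (exist _ x Ux)). Qed.

Lemma evp_D (F : V -> C) f a p : (forall q, F (sval q) = evp q f) ->
  cpartial a F (sval p) = evp p (sfun_D a f).
Proof.
by move=> E; apply: ev_D; [move=> y Uy; exact: (E (exist _ y Uy))|exact: svalP].
Qed.

Lemma evp_to_sfun (F : V -> C) (sF : csmooth U F) p : evp p (to_sfun sF) = F (sval p).
Proof. by apply: to_sfunE; exact: svalP. Qed.

Lemma evp_cst c p : evp p (sfun_cst c) = c.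
Proof. exact: evp_to_sfun. Qed.

End SmoothRing.

(** * Curvature over a commutative differential ring *)

Section DifferentialRing.
Variables (A : comPzRingType) (D : 'I_4 -> A -> A).
Hypothesis DD : forall e, {morph D e : x y / x + y}.
Hypothesis DM : forall e x y, D e (x * y) = D e x * y + x * D e y.
Hypothesis DC : forall a b x, D a (D b x) = D b (D a x).
Variables (g h : 'M[A]_4) (i2 i12 : A).
Hypothesis gsym : forall a b, g a b = g b a.
Hypothesis gh : g *m h = 1%:M.
Hypothesis i2E : 2 * i2 = 1.
Hypothesis i12E : 12 * i12 = 1.
Implicit Types (a b c d e f : 'I_4).

Lemma D0 e : D e 0 = 0.
Proof. by apply: (addrI (D e 0)); rewrite -DD !addr0. Qed.

Lemma DN e x : D e (- x) = - D e x.
Proof. by apply/eqP; rewrite -addr_eq0 -DD addNr D0. Qed.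

Lemma DB e x y : D e (x - y) = D e x - D e y.
Proof. by rewrite DD DN. Qed.

Lemma D1 e : D e 1 = 0.
Proof. by apply: (addrI (D e 1)); rewrite addr0 -[in RHS](mulr1 1) DM mulr1 mul1r. Qed.

Lemma Dnat e n : D e n%:R = 0.
Proof. by elim: n => [|n IH]; [exact: D0|rewrite -addn1 natrD DD IH D1 addr0]. Qed.

(** The constants 1/2 and 1/12 enter only as ring elements inverse to numerals; differentiating n x
    = 1 shows that derivations kill them. *)
Lemma D_inv_nat e n x : n%:R * x = 1 -> D e x = 0.
Proof.
move=> nx; have : D e (n%:R * x) = 0 by rewrite nx D1.
rewrite DM Dnat mul0r add0r => E.
by rewrite -[D e x]mul1r -nx mulrAC E mul0r.
Qed.

Lemma Di2 e : D e i2 = 0. Proof. exact: D_inv_nat i2E. Qed.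
Lemma Di12 e : D e i12 = 0. Proof. exact: D_inv_nat i12E. Qed.

Lemma Dsum e (I : finType) (F : I -> A) : D e (\sum_i F i) = \sum_i D e (F i).
Proof. exact: (big_morph _ (DD e) (D0 e)). Qed.

Definition dM e (M : 'M[A]_4) := map_mx (D e) M.

Lemma dMD e M N : dM e (M + N) = dM e M + dM e N.
Proof. by apply/matrixP => i j; rewrite !mxE DD. Qed.

Lemma dMN e M : dM e (- M) = - dM e M.
Proof. by apply/matrixP => i j; rewrite !mxE DN. Qed.

Lemma dMM e M N : dM e (M *m N) = dM e M *m N + M *m dM e N.
Proof.
apply/matrixP => i j; rewrite !mxE Dsum -big_split /=.
by apply: eq_bigr => k _; rewrite DM !mxE.
Qed.

Lemma dMC a b M : dM a (dM b M) = dM b (dM a M).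
Proof. by apply/matrixP => i j; rewrite !mxE DC. Qed.

Lemma dM_tr e M : dM e M^T = (dM e M)^T.
Proof. by apply/matrixP => i j; rewrite !mxE. Qed.

Lemma dM1 e : dM e 1%:M = 0.
Proof. by apply/matrixP => i j; rewrite !mxE; case: eqP; rewrite ?D1 ?D0. Qed.

Lemma addmE (M N : 'M[A]_4) i j : (M + N) i j = M i j + N i j.
Proof. by rewrite mxE. Qed.
Lemma oppmE (M : 'M[A]_4) i j : (- M) i j = - M i j.
Proof. by rewrite mxE. Qed.
Lemma zeromE i j : (0 : 'M[A]_4) i j = 0.
Proof. by rewrite mxE. Qed.

Lemma gT : g^T = g.
Proof. by apply/matrixP => a b; rewrite mxE. Qed.

Lemma hTg : h^T *m g = 1%:M.
Proof. by rewrite -{1}gT -trmx_mul gh trmx1. Qed.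

Lemma hT : h^T = h.
Proof. by rewrite -[h^T]mulmx1 -gh mulmxA hTg mul1mx. Qed.

Lemma hg : h *m g = 1%:M.
Proof. by rewrite -{1}hT hTg. Qed.

Lemma hsym a b : h a b = h b a.
Proof. by rewrite -{1}hT mxE. Qed.

Lemma sum_mul1 (M N : 'M[A]_4) (F : 'I_4 -> A) a : M *m N = 1%:M ->
  \sum_f M a f * (\sum_b N f b * F b) = F a.
Proof.
move=> MN; transitivity ((M *m N *m (\col_b F b)) a 0); last by rewrite MN mul1mx mxE.
rewrite -mulmxA mxE; apply: eq_bigr => f _; rewrite mxE; congr (_ * _).
by apply: eq_bigr => b _; rewrite mxE.
Qed.

Definition sum_gh F a := @sum_mul1 g h F a gh.
Definition sum_hg F a := @sum_mul1 h g F a hg.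

Definition Gam a b c : A :=
  i2 * \sum_d h a d * (D b (g d c) + D c (g d b) - D d (g b c)).

Lemma Gam_sym a b c : Gam a b c = Gam a c b.
Proof.
congr (_ * _); apply: eq_bigr => d _; congr (_ * _).
by rewrite (gsym b c); ring.
Qed.

Definition Gm e : 'M[A]_4 := \matrix_(a, b) Gam a e b.

Lemma g_Gam a b c : \sum_f g a f * Gam f b c =
  i2 * (D b (g a c) + D c (g a b) - D a (g b c)).
Proof.
under eq_bigr do rewrite /Gam mulrCA.
by rewrite -big_distrr /= (sum_gh (fun d => D b (g d c) + D c (g d b) - D d (g b c))).
Qed.

(** Metric compatibility, nabla g = 0: between the two lowered Christoffel symbols all derivatives
    of g cancel except those in the direction e, which add up. *)
Lemma dg e : dM e g = (Gm e)^T *m g + g *m Gm e.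
Proof.
apply/matrixP => a b; rewrite !mxE.
under eq_bigr do rewrite !mxE mulrC gsym.
under [X in _ = _ + X]eq_bigr do rewrite !mxE.
rewrite !g_Gam (gsym b a) (gsym e a) (gsym e b) (gsym b e) -mulrDr.
have -> : D e (g a b) + D a (g e b) - D b (g a e) + (D e (g a b) + D b (g a e) - D a (g e b))
  = 2 * D e (g a b) by ring.
by rewrite mulrA (mulrC i2) i2E mul1r.
Qed.

Lemma dh e : dM e h = - (h *m (Gm e)^T) - Gm e *m h.
Proof.
have E : dM e g *m h + g *m dM e h = 0 by rewrite -dMM gh dM1.
have : h *m (dM e g *m h + g *m dM e h) = 0 by rewrite E mulmx0.
rewrite mulmxDr !mulmxA hg mul1mx => /eqP; rewrite addrC addr_eq0 => /eqP ->.
rewrite dg mulmxDr mulmxDl -!mulmxA gh mulmx1 (mulmxA h g) hg mul1mx.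
by rewrite opprD.
Qed.

Definition Rm c d : 'M[A]_4 :=
  dM c (Gm d) - dM d (Gm c) + (Gm c *m Gm d - Gm d *m Gm c).

Lemma RmE a b c d : Rm c d a b = D c (Gam a d b) - D d (Gam a c b)
  + \sum_e (Gam a c e * Gam e d b - Gam a d e * Gam e c b).
Proof.
by rewrite !mxE big_split /= sumrN; congr (_ + (_ - _)); apply: eq_bigr => e _; rewrite !mxE.
Qed.

Lemma Rm_anti c d : Rm c d = - Rm d c.
Proof. by rewrite /Rm; rewrite !opprD !opprK [- _ + dM _ _]addrC [- _ + Gm _ *m _]addrC. Qed.

Lemma Rm_cyc a b c d : Rm c d a b + Rm d b a c + Rm b c a d = 0.
Proof.
rewrite !RmE !big_split /= !sumrN.
rewrite (Gam_sym a d b) (Gam_sym a c b) (Gam_sym a d c).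
under [\sum_i Gam a d i * Gam i b c]eq_bigr do rewrite (Gam_sym _ b).
under [\sum_i Gam a b i * Gam i d c]eq_bigr do rewrite (Gam_sym _ d).
under [\sum_i Gam a c i * Gam i d b]eq_bigr do rewrite (Gam_sym _ d).
ring.
Qed.

(** Expanding D_c D_d g = D_d D_c g by metric compatibility, used twice, leaves exactly the
    symmetric part of the lowered curvature. *)
Lemma Rm_g c d : (Rm c d)^T *m g + g *m Rm c d = 0.
Proof.
have E : dM c (dM d g) - dM d (dM c g) = 0 by rewrite dMC subrr.
move: E; rewrite !dg !dMD !dMM !dg !dM_tr.
rewrite !mulmxDr !mulmxDl !mulmxA => E.
have -> : (Rm c d)^T = (dM c (Gm d))^T - (dM d (Gm c))^T +
   ((Gm d)^T *m (Gm c)^T - (Gm c)^T *m (Gm d)^T).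
  by rewrite /Rm -!trmx_mul; apply/matrixP=> i j; rewrite mxE !(addmE, oppmE) ![_^T _ _]mxE.
rewrite ?(mulmxDr, mulmxDl) ?(mulmxN, mulNmx) ?mulmxA -E.
by apply/matrixP => i j; rewrite !(addmE, oppmE); ring.
Qed.

(** The curvature matrices are the commutators of the operators D_c + [Gm c], and this is their
    Jacobi identity. *)
Lemma Rm_bianchi c d e :
  dM e (Rm c d) + (Gm e *m Rm c d - Rm c d *m Gm e) +
  (dM c (Rm d e) + (Gm c *m Rm d e - Rm d e *m Gm c)) +
  (dM d (Rm e c) + (Gm d *m Rm e c - Rm e c *m Gm d)) = 0.
Proof.
rewrite /Rm !(dMD, dMN) !dMM ?(mulmxDr, mulmxDl, mulmxN, mulNmx) ?mulmxA.
rewrite (dMC c e) (dMC d e) (dMC d c).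
by apply/matrixP => i j; rewrite !(addmE, oppmE, zeromE); ring.
Qed.

Definition riem a b c d : A := \sum_e g a e * Rm c d e b.

Lemma riemE a b c d : riem a b c d = (g *m Rm c d) a b.
Proof. by rewrite mxE. Qed.

Lemma riem_anti34 a b c d : riem a b c d = - riem a b d c.
Proof.
by rewrite /riem -sumrN; apply: eq_bigr => e _; rewrite (Rm_anti c d) oppmE mulrN.
Qed.

Lemma riem_anti12 a b c d : riem a b c d = - riem b a c d.
Proof.
apply/eqP; rewrite -addr_eq0 !riemE; apply/eqP.
have := congr1 (fun M : 'M[A]_4 => M b a) (Rm_g c d); rewrite addmE zeromE => <-.
congr (_ + _); rewrite [LHS]mxE [RHS]mxE; apply: eq_bigr => e _.
by rewrite [in RHS]mxE mulrC gsym.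
Qed.

Lemma riem_cyc a b c d : riem a b c d + riem a c d b + riem a d b c = 0.
Proof.
rewrite /riem -!big_split big1 //= => e _.
by rewrite -!mulrDr Rm_cyc mulr0.
Qed.

Lemma mul2I (x y : A) : 2 * x = 2 * y -> x = y.
Proof. by move=> E; rewrite -[x]mul1r -[y]mul1r -i2E mulrAC E mulrAC. Qed.

Lemma halfE (x : A) : x = 2 * (i2 * x).
Proof. by rewrite mulrA i2E mul1r. Qed.

(** The signed sum of the cyclic identities for the four choices of leading index collapses, by
    skew-symmetry in each pair, to 2 (R_abcd - R_cdab). *)
Lemma riem_pair a b c d : riem a b c d = riem c d a b.
Proof.
apply: mul2I; apply/eqP; rewrite -subr_eq0; apply/eqP.
transitivity ((riem a b c d + riem a c d b + riem a d b c)
  - (riem b c d a + riem b d a c + riem b a c d)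
  - (riem c d a b + riem c a b d + riem c b d a)
  + (riem d a b c + riem d b c a + riem d c a b)); last by rewrite !riem_cyc; ring.
rewrite (riem_anti12 b a) (riem_anti12 c a) (riem_anti34 a c b) (riem_anti12 d a)
  (riem_anti12 c b) (riem_anti12 d b) (riem_anti34 b d c) (riem_anti12 d c); ring.
Qed.

(** The connection term of one lower index: [nab2], [nab3] and [nab4] subtract one such term for
    each index. *)
Definition cs (T : 'I_4 -> A) e a := \sum_f Gam f e a * T f.

Lemma eq_cs T S e a : T =1 S -> cs T e a = cs S e a.
Proof. by move=> E; apply: eq_bigr => f _; rewrite E. Qed.

Lemma csD T S e a : cs (fun f => T f + S f) e a = cs T e a + cs S e a.
Proof. by rewrite -big_split /=; apply: eq_bigr => f _; rewrite mulrDr. Qed.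

Lemma csN T e a : cs (fun f => - T f) e a = - cs T e a.
Proof. by rewrite -sumrN; apply: eq_bigr => f _; rewrite mulrN. Qed.

Lemma csZ x T e a : cs (fun f => x * T f) e a = x * cs T e a.
Proof. by rewrite big_distrr /=; apply: eq_bigr => f _; rewrite mulrCA. Qed.

Lemma csZr x T e a : cs (fun f => T f * x) e a = cs T e a * x.
Proof. by rewrite big_distrl /=; apply: eq_bigr => f _; rewrite mulrA. Qed.

Lemma cs_sum (I : finType) (F : I -> 'I_4 -> A) e a :
  cs (fun f => \sum_i F i f) e a = \sum_i cs (F i) e a.
Proof. by rewrite exchange_big /=; apply: eq_bigr => f _; rewrite big_distrr. Qed.

Definition nab2 (S : 'I_4 -> 'I_4 -> A) e a b :=
  D e (S a b) - cs (fun f => S f b) e a - cs (fun f => S a f) e b.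

Definition nab4 (T : 'I_4 -> 'I_4 -> 'I_4 -> 'I_4 -> A) e a b c d :=
  D e (T a b c d) - cs (fun f => T f b c d) e a - cs (fun f => T a f c d) e b
  - cs (fun f => T a b f d) e c - cs (fun f => T a b c f) e d.

(** This is nabla_e R^f_bcd; the commutator with [Gm e] accounts for the upper index and the lower
    index b together. *)
Definition nabRm e c d f b : A :=
  (dM e (Rm c d) + (Gm e *m Rm c d - Rm c d *m Gm e)) f b
  - cs (fun k => Rm k d f b) e c - cs (fun k => Rm c k f b) e d.

Lemma nab4_riem e a b c d : nab4 riem e a b c d = \sum_f g a f * nabRm e c d f b.
Proof.
have -> : \sum_f g a f * nabRm e c d f b =
    (g *m (dM e (Rm c d) + (Gm e *m Rm c d - Rm c d *m Gm e))) a b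
    - cs (fun k => riem a b k d) e c - cs (fun k => riem a b c k) e d.
  rewrite mxE [X in _ - X - _]cs_sum [X in _ - _ - X]cs_sum -!sumrN -!big_split /=.
  by apply: eq_bigr => f _; rewrite /nabRm !mulrDr !mulrN !csZ.
rewrite /nab4; congr (_ - _ - _).
have -> : D e (riem a b c d) = (dM e (g *m Rm c d)) a b by rewrite riemE [RHS]mxE.
rewrite dMM dg.
have -> : cs (fun f => riem f b c d) e a = ((Gm e)^T *m (g *m Rm c d)) a b.
  by rewrite mxE; apply: eq_bigr => f _; rewrite riemE !mxE.
have -> : cs (fun f => riem a f c d) e b = (g *m Rm c d *m Gm e) a b.
  by rewrite mxE; apply: eq_bigr => f _; rewrite riemE [Gm e f b]mxE mulrC.
rewrite ?(mulmxDr, mulmxDl, mulmxN, mulNmx) ?mulmxA !(addmE, oppmE); ring.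
Qed.

Lemma nabRm_anti e c d f b : nabRm e c d f b = - nabRm e d c f b.
Proof.
rewrite /nabRm (Rm_anti c d).
rewrite (@eq_cs _ (fun k => - Rm d k f b)); last by move=> k; rewrite Rm_anti oppmE.
rewrite (@eq_cs (fun k => Rm c k f b) (fun k => - Rm k c f b)); last by move=> k; rewrite Rm_anti oppmE.
rewrite !csN !dMN ?(mulmxN, mulNmx) !(addmE, oppmE); ring.
Qed.

(** The connection terms of the two form indices cancel in pairs because the Christoffel symbols are
    symmetric, leaving the matrix identity [Rm_bianchi]. *)
Lemma nabRm_cyc e c d f b : nabRm e c d f b + nabRm c d e f b + nabRm d e c f b = 0.
Proof.
have E := congr1 (fun M : 'M[A]_4 => M f b) (Rm_bianchi c d e).
have S x y z : cs (fun k => Rm z k f b) x y = - cs (fun k => Rm k z f b) x y.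
  by rewrite -csN; apply: eq_cs => k; rewrite Rm_anti oppmE.
have C x y z : cs (fun k => Rm k z f b) x y = cs (fun k => Rm k z f b) y x.
  by apply: eq_bigr => k _; rewrite Gam_sym.
move: E; rewrite zeromE => <-; rewrite /nabRm !S (C d e) (C d c) (C c e) !(addmE, oppmE); ring.
Qed.

Definition Ric a b : A := \sum_c Rm c b c a.

Lemma nabRm_trace c d b : \sum_e nabRm c e d e b = nab2 Ric c b d.
Proof.
rewrite /nab2 /Ric Dsum !cs_sum /nabRm.
under eq_bigr do rewrite !(addmE, oppmE).
rewrite !big_split /= !sumrN.
have -> : \sum_i (Gm c *m Rm i d) i b = \sum_i cs (fun k => Rm k d i b) c i.
  under eq_bigr do rewrite mxE; rewrite exchange_big /=; apply: eq_bigr => k _.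
  by apply: eq_bigr => i _; rewrite mxE.
have -> : \sum_i (Rm i d *m Gm c) i b = \sum_i cs (fun f => Rm i d i f) c b.
  by apply: eq_bigr => i _; rewrite mxE; apply: eq_bigr => k _; rewrite [Gm c k b]mxE mulrC.
have -> : \sum_i dM c (Rm i d) i b = \sum_i D c (Rm i d i b).
  by apply: eq_bigr => i _; rewrite mxE.
ring.
Qed.

(** Contraction of the second Bianchi identity: one term is the divergence, the two others are
    traces of the curvature and give derivatives of the Ricci tensor. *)
Lemma div_riem b c d : \sum_e \sum_a h e a * nab4 riem e a b c d =
  nab2 Ric c b d - nab2 Ric d b c.
Proof.
under eq_bigr => e _.
  under eq_bigr do rewrite nab4_riem.
  rewrite sum_hg.
  over.
rewrite -!nabRm_trace -sumrN -big_split /=; apply: eq_bigr => e _.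
have := nabRm_cyc e c d e b.
rewrite (nabRm_anti c d e) => /eqP; rewrite addr_eq0 => /eqP E.
by rewrite -E; ring.
Qed.

(** Since nabla g^-1 = 0, contraction with [h] commutes with covariant differentiation; [Dh] in the
    proof is that vanishing in components. *)
Lemma trace_nab2 S e : \sum_b \sum_c h b c * nab2 S e b c =
  D e (\sum_b \sum_c h b c * S b c).
Proof.
rewrite Dsum.
have Dh b c : D e (h b c) = - (\sum_f h b f * Gam c e f) - \sum_f Gam b e f * h f c.
  have -> : D e (h b c) = (dM e h) b c by rewrite mxE.
  rewrite dh !(addmE, oppmE) !mxE; congr (- _ - _); apply: eq_bigr => f _; by rewrite !mxE.
under [RHS]eq_bigr => b _.
  rewrite Dsum; under eq_bigr do rewrite DM Dh mulrBl mulNr.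
  rewrite !big_split /= !sumrN.
  over.
rewrite !big_split /= !sumrN.
under eq_bigr => b _.
  under eq_bigr do rewrite /nab2 !mulrBr.
  rewrite !big_split /= !sumrN.
  over.
rewrite !big_split /= !sumrN.
have -> : \sum_i \sum_j h i j * cs (fun f => S f j) e i =
   \sum_i \sum_j (\sum_f Gam i e f * h f j) * S i j.
  rewrite exchange_big [RHS]exchange_big /=; apply: eq_bigr => j _.
  under eq_bigr do rewrite /cs big_distrr /=.
  rewrite exchange_big /=; apply: eq_bigr => f _; rewrite big_distrl /=.
  by apply: eq_bigr => i _; ring.
have -> : \sum_i \sum_j h i j * cs (fun f => S i f) e j =
   \sum_i \sum_j (\sum_f h i f * Gam j e f) * S i j.
  apply: eq_bigr => i _.
  under eq_bigr do rewrite /cs big_distrr /=.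
  rewrite exchange_big /=; apply: eq_bigr => f _; rewrite big_distrl /=.
  by apply: eq_bigr => j _; ring.
ring.
Qed.

Lemma trace23_nab4 T e a d : \sum_b \sum_c h b c * nab4 T e a b c d =
  nab2 (fun x y => \sum_b \sum_c h b c * T x b c y) e a d.
Proof.
rewrite /nab2 -trace_nab2 !cs_sum -!sumrN -!big_split /=; apply: eq_bigr => b _.
rewrite !cs_sum -!sumrN -!big_split /=; apply: eq_bigr => c _.
by rewrite !csZ /nab4 /nab2; ring.
Qed.

Lemma Rm_riem a b c d : Rm c d a b = \sum_f h a f * riem f b c d.
Proof. by rewrite /riem (sum_hg (fun e => Rm c d e b)). Qed.

Lemma Ric_riem a b : Ric a b = \sum_c \sum_f h c f * riem f a c b.
Proof. by apply: eq_bigr => c _; exact: Rm_riem. Qed.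

Lemma Ric_sym a b : Ric a b = Ric b a.
Proof.
rewrite !Ric_riem exchange_big /=; apply: eq_bigr => c _; apply: eq_bigr => f _.
by rewrite hsym riem_pair.
Qed.

Lemma trace23_riem a d : \sum_b \sum_c h b c * riem a b c d = - Ric a d.
Proof.
rewrite Ric_riem exchange_big -sumrN; apply: eq_bigr => c _; rewrite -sumrN.
by apply: eq_bigr => f _; rewrite riem_anti12 hsym mulrN.
Qed.

Definition Scal : A := \sum_a \sum_b h a b * Ric a b.

Lemma cs_g e a d : cs (fun f => g f d) e a + cs (fun f => g a f) e d = D e (g a d).
Proof.
have -> : D e (g a d) = (dM e g) a d by rewrite mxE.
rewrite dg addmE !mxE; congr (_ + _); apply: eq_bigr => f _; rewrite !mxE //.
by rewrite mulrC.
Qed.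

Lemma eq_nab2 S S' e a b : S =2 S' -> nab2 S e a b = nab2 S' e a b.
Proof.
by move=> E; rewrite /nab2 E; congr (_ - _ - _); apply: eq_cs => f; rewrite E.
Qed.

Lemma nab2N S e a b : nab2 (fun x y => - S x y) e a b = - nab2 S e a b.
Proof. by rewrite /nab2 DN !csN; ring. Qed.

Lemma nab2_sym S e a b : (forall x y, S x y = S y x) -> nab2 S e a b = nab2 S e b a.
Proof.
move=> E; rewrite /nab2 (E a b) addrAC; congr (_ - _ - _); apply: eq_cs => f; exact: E.
Qed.

(** Tracing [div_riem] over b and c gives minus the divergence of the Ricci tensor on one side, that
    divergence minus D_d R on the other. *)
Lemma div_Ric d : 2 * (\sum_e \sum_a h e a * nab2 Ric e a d) = D d Scal.
Proof.
have : \sum_b \sum_c h b c * (\sum_e \sum_a h e a * nab4 riem e a b c d) =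
       \sum_b \sum_c h b c * (nab2 Ric c b d - nab2 Ric d b c).
  by apply: eq_bigr => b _; apply: eq_bigr => c _; rewrite div_riem.
have -> : \sum_b \sum_c h b c * (\sum_e \sum_a h e a * nab4 riem e a b c d) =
  \sum_e \sum_a h e a * (\sum_b \sum_c h b c * nab4 riem e a b c d).
  under eq_bigr do (under eq_bigr do (rewrite big_distrr /=; under eq_bigr do rewrite big_distrr /=);
    rewrite exchange_big /=; under eq_bigr do rewrite exchange_big /=).
  rewrite exchange_big /=; apply: eq_bigr => e _; rewrite exchange_big /=.
  apply: eq_bigr => a _; rewrite big_distrr /=; apply: eq_bigr => b _.
  by rewrite big_distrr /=; apply: eq_bigr => c _; ring.
under eq_bigr do under eq_bigr do
  rewrite trace23_nab4 (eq_nab2 _ _ _ trace23_riem) nab2N mulrN.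
under eq_bigr do rewrite sumrN.
rewrite sumrN.
under [RHS]eq_bigr do under eq_bigr do rewrite mulrBr.
under [RHS]eq_bigr do rewrite big_split /= sumrN.
rewrite big_split /= sumrN (trace_nab2 Ric d) -/Scal.
have -> : \sum_i \sum_j h i j * nab2 Ric j i d = \sum_e \sum_a h e a * nab2 Ric e a d.
  rewrite exchange_big; apply: eq_bigr => e _; apply: eq_bigr => a _; by rewrite hsym.
set X := \sum_e _; move=> E; have -> : D d Scal = X - (X - D d Scal) by ring.
by rewrite -E; ring.
Qed.

Definition Sch a b : A := i2 * Ric a b - i12 * Scal * g a b.

Lemma Sch_sym a b : Sch a b = Sch b a.
Proof. by rewrite /Sch Ric_sym gsym. Qed.

Lemma Ric_Sch a b : Ric a b = 2 * Sch a b + 2 * i12 * Scal * g a b.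
Proof. by rewrite /Sch [LHS]halfE; ring. Qed.

Lemma nab2_Sch e a b : nab2 Sch e a b = i2 * nab2 Ric e a b - i12 * D e Scal * g a b.
Proof.
rewrite /nab2 /Sch DB !DM Di2 Di12 -(cs_g e a b) !csD !csN !csZ; ring.
Qed.

(** 1/4 - 1/12 = 1/6: half of the Ricci divergence D R / 2, less the term with 1/12 in the Schouten
    tensor. *)
Lemma i12_6 : i2 * i2 - i12 = 2 * i12.
Proof.
have E : i2 * i2 = 3 * i12.
  transitivity ((12 * i12) * (i2 * i2)); first by rewrite i12E mul1r.
  transitivity (3 * i12 * ((2 * i2) * (2 * i2))); first by ring.
  by rewrite i2E; ring.
by rewrite E; ring.
Qed.

Lemma div_Sch d : \sum_e \sum_a h e a * nab2 Sch e d a = 2 * i12 * D d Scal.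
Proof.
rewrite -i12_6 mulrBl.
have tr : \sum_e \sum_a h e a * (D e Scal * g d a) = D d Scal.
  rewrite exchange_big /=.
  transitivity (\sum_a g d a * (\sum_e h a e * D e Scal)); last by rewrite sum_gh.
  apply: eq_bigr => a _; rewrite !big_distrr /=; apply: eq_bigr => e _.
  by rewrite (hsym e a); ring.
have -> : \sum_e \sum_a h e a * nab2 Sch e d a =
  i2 * (\sum_e \sum_a h e a * nab2 Ric e a d) - i12 * (\sum_e \sum_a h e a * (D e Scal * g d a)).
  rewrite !big_distrr -sumrN -big_split /=; apply: eq_bigr => e _.
  rewrite !big_distrr -sumrN -big_split /=; apply: eq_bigr => a _.
  by rewrite nab2_Sch (nab2_sym _ _ _ Ric_sym); ring.
rewrite tr -div_Ric; congr (_ - _).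
by rewrite [LHS]halfE; ring.
Qed.

Definition Weyl a b c d : A :=
  riem a b c d + g a d * Sch c b - g a c * Sch d b + g b c * Sch d a - g b d * Sch c a.

Lemma Weyl_anti12 a b c d : Weyl a b c d = - Weyl b a c d.
Proof. by rewrite /Weyl riem_anti12; ring. Qed.

Lemma Weyl_anti34 a b c d : Weyl a b c d = - Weyl a b d c.
Proof. by rewrite /Weyl riem_anti34; ring. Qed.

Lemma Weyl_pair a b c d : Weyl a b c d = Weyl c d a b.
Proof.
rewrite /Weyl riem_pair (gsym a d) (gsym a c) (gsym b c) (gsym b d).
by rewrite (Sch_sym b c) (Sch_sym b d) (Sch_sym a c) (Sch_sym a d); ring.
Qed.

Lemma Weyl_cyc a b c d : Weyl a b c d + Weyl a c d b + Weyl a d b c = 0.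
Proof.
rewrite -(riem_cyc a b c d) /Weyl (gsym c b) (gsym d b) (gsym d c).
by rewrite (Sch_sym b c) (Sch_sym b d) (Sch_sym d c); ring.
Qed.

Lemma trace_g : \sum_b \sum_c h b c * g b c = 4.
Proof.
have := congr1 (fun M : 'M[A]_4 => \tr M) hg; rewrite mxtrace1 => <-.
by apply: eq_bigr => b _; rewrite mxE; apply: eq_bigr => c _; rewrite gsym.
Qed.

(** Dimension four enters here through the trace of g: the Schouten terms contribute (4 - 1 - 1)
    P_ad plus a multiple of g_ad, which is the Ricci tensor. *)
Lemma trace23_Weyl a d : \sum_b \sum_c h b c * Weyl a b c d = 0.
Proof.
have trS : \sum_b \sum_c h b c * Sch b c = 2 * i12 * Scal.
  have -> : \sum_b \sum_c h b c * Sch b c = i2 * Scal - i12 * Scal * (\sum_b \sum_c h b c * g b c).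
    rewrite /Scal big_distrr [X in _ - X]big_distrr -sumrN -big_split /=; apply: eq_bigr => b _.
    rewrite big_distrr [X in _ - X]big_distrr -sumrN -big_split /=; apply: eq_bigr => c _.
    by rewrite /Sch -/Scal; ring.
  have E : i2 = 2 * (i2 * i2 - i12) + 2 * i12.
    by transitivity (2 * (i2 * i2)); [exact: halfE|ring].
  by rewrite i12_6 in E; rewrite trace_g E; ring.
have t1 : \sum_b \sum_c h b c * (g a c * Sch d b) = Sch d a.
  under eq_bigr do under eq_bigr do rewrite mulrCA.
  rewrite exchange_big /=; under eq_bigr do rewrite -big_distrr /=.
  by under eq_bigr do under eq_bigr do rewrite hsym; rewrite (sum_gh (Sch d)).
have t2 : \sum_b \sum_c h b c * (g b d * Sch c a) = Sch d a.
  under eq_bigr do (under eq_bigr do rewrite mulrCA; rewrite -big_distrr /= gsym).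
  by rewrite (sum_gh (fun c => Sch c a)).
have -> : \sum_b \sum_c h b c * Weyl a b c d =
   \sum_b \sum_c h b c * riem a b c d + g a d * (\sum_b \sum_c h b c * Sch b c)
   - \sum_b \sum_c h b c * (g a c * Sch d b) + (\sum_b \sum_c h b c * g b c) * Sch d a
   - \sum_b \sum_c h b c * (g b d * Sch c a).
  rewrite [g a d * _]big_distrr [_ * Sch d a]big_distrl -!sumrN -!big_split /=; apply: eq_bigr => b _.
  rewrite [g a d * _]big_distrr [_ * Sch d a]big_distrl -!sumrN -!big_split /=; apply: eq_bigr => c _.
  by rewrite /Weyl (Sch_sym c b); ring.
rewrite trS t1 t2 trace_g trace23_riem Ric_Sch (Sch_sym a d); ring.
Qed.

Definition Cot a b c : A := nab2 Sch b c a - nab2 Sch c b a.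

(** By [cs_g] the derivatives of the factors g are compensated by their connection terms, so only P
    is differentiated. *)
Lemma nab4_kulkarni_nomizu T P e a b c d :
  nab4 (fun a b c d =>
    T a b c d + g a d * P c b - g a c * P d b + g b c * P d a - g b d * P c a) e a b c d =
  nab4 T e a b c d + g a d * nab2 P e c b - g a c * nab2 P e d b
  + g b c * nab2 P e d a - g b d * nab2 P e c a.
Proof.
rewrite /nab4 /nab2 !(DD, DN) !DM -!(cs_g e) !csD !csN !csZ !csZr; ring.
Qed.

Lemma nab4_Weyl e a b c d : nab4 Weyl e a b c d = nab4 riem e a b c d
  + g a d * nab2 Sch e c b - g a c * nab2 Sch e d b
  + g b c * nab2 Sch e d a - g b d * nab2 Sch e c a.
Proof. exact: nab4_kulkarni_nomizu. Qed.

(** The Ricci terms give twice the antisymmetrized derivative of P and the Schouten terms take one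
    copy away, so the Cotton tensor appears with coefficient n - 3 = 1. The remaining multiples of D
    R cancel because the divergence of P is D R / 6. *)
Lemma div_Weyl b c d : \sum_e \sum_a h e a * nab4 Weyl e a b c d = Cot b c d.
Proof.
have tr X d' : \sum_e \sum_a h e a * (g a d' * X e) = X d'.
  under eq_bigr do under eq_bigr do rewrite mulrCA (gsym _ d').
  rewrite exchange_big /=; under eq_bigr do rewrite -big_distrr /=.
  by under eq_bigr do under eq_bigr do rewrite hsym; rewrite sum_gh.
have -> : \sum_e \sum_a h e a * nab4 Weyl e a b c d =
   \sum_e \sum_a h e a * nab4 riem e a b c d
   + \sum_e \sum_a h e a * (g a d * nab2 Sch e c b)
   - \sum_e \sum_a h e a * (g a c * nab2 Sch e d b)
   + g b c * (\sum_e \sum_a h e a * nab2 Sch e d a)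
   - g b d * (\sum_e \sum_a h e a * nab2 Sch e c a).
  rewrite [g b c * _]big_distrr [g b d * _]big_distrr -!sumrN -!big_split /=; apply: eq_bigr => e _.
  rewrite [g b c * _]big_distrr [g b d * _]big_distrr -!sumrN -!big_split /=; apply: eq_bigr => a _.
  by rewrite nab4_Weyl; ring.
rewrite (tr (fun e => nab2 Sch e c b)) (tr (fun e => nab2 Sch e d b)) !div_Sch div_riem.
have nR x y z : nab2 Ric x y z = 2 * nab2 Sch x y z + 2 * i12 * D x Scal * g y z.
  by rewrite nab2_Sch [LHS]halfE; ring.
rewrite !nR /Cot (nab2_sym c b d Sch_sym) (nab2_sym d c b Sch_sym); ring.
Qed.

Implicit Types (X Y Z V : 'I_4 -> A).

Definition con (S : 'I_4 -> A) X : A := \sum_a S a * X a.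

Lemma eq_con S S' X : S =1 S' -> con S X = con S' X.
Proof. by move=> E; apply: eq_bigr => a _; rewrite E. Qed.

Lemma conD S S' X : con (fun a => S a + S' a) X = con S X + con S' X.
Proof. by rewrite -big_split /=; apply: eq_bigr => a _; rewrite mulrDl. Qed.

Lemma conN S X : con (fun a => - S a) X = - con S X.
Proof. by rewrite -sumrN; apply: eq_bigr => a _; rewrite mulNr. Qed.

Lemma conB S S' X : con (fun a => S a - S' a) X = con S X - con S' X.
Proof. by rewrite -conN -conD. Qed.

Lemma con0 X : con (fun=> 0) X = 0.
Proof. by apply: big1 => a _; rewrite mul0r. Qed.

Lemma con_mulr S X x : con (fun a => S a * x) X = con S X * x.
Proof. by rewrite big_distrl /=; apply: eq_bigr => a _; rewrite mulrAC. Qed.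

Lemma con_exchange (S : 'I_4 -> 'I_4 -> A) X Y :
  con (fun a => con (S a) Y) X = con (fun b => con (S^~ b) X) Y.
Proof.
transitivity (\sum_a \sum_b S a b * X a * Y b).
  apply: eq_bigr => a _; rewrite big_distrl; apply: eq_bigr => b _; exact: mulrAC.
by rewrite exchange_big; apply: eq_bigr => b _; rewrite big_distrl.
Qed.

Lemma cs_con (S : 'I_4 -> 'I_4 -> A) X e a :
  cs (fun f => con (S f) X) e a = con (fun b => cs (S^~ b) e a) X.
Proof.
rewrite /cs /con; under eq_bigr do rewrite big_distrr /=.
rewrite exchange_big /=; apply: eq_bigr => b _; rewrite big_distrl /=.
by apply: eq_bigr => f _; rewrite mulrA.
Qed.

Definition nabv X e a := D e (X a) + \sum_f Gam a e f * X f.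

Lemma leibniz1 S X e :
  D e (con S X) = con (fun a => D e (S a) - cs S e a) X + con S (nabv X e).
Proof.
rewrite conD conN.
have -> : con (cs S e) X = \sum_a S a * \sum_f Gam a e f * X f.
  transitivity (\sum_a \sum_f Gam f e a * S f * X a).
    by apply: eq_bigr => a _; rewrite big_distrl.
  rewrite exchange_big /=; apply: eq_bigr => f _; rewrite big_distrr /=.
  by apply: eq_bigr => a _; ring.
have -> : con S (nabv X e) = con S (fun a => D e (X a)) + \sum_a S a * \sum_f Gam a e f * X f.
  by rewrite -big_split /=; apply: eq_bigr => a _; rewrite mulrDr.
have -> : D e (con S X) = con (fun a => D e (S a)) X + con S (fun a => D e (X a)).
  by rewrite Dsum -big_split /=; apply: eq_bigr => a _; rewrite DM.
ring.
Qed.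

(** Leibniz rules are built one slot at a time: once its last slot is filled, a tensor obeys the
    rule for one slot fewer, and [leibniz1] treats the slot set aside. *)
Lemma leibniz2 S X Y e : D e (con (fun a => con (S a) Y) X) =
  con (fun a => con (nab2 S e a) Y) X
  + con (fun a => con (S a) (nabv Y e)) X + con (fun a => con (S a) Y) (nabv X e).
Proof.
rewrite leibniz1; congr (_ + _); rewrite -conD; apply: eq_con => a.
by rewrite leibniz1 cs_con /nab2 !conB; ring.
Qed.

Definition nab3 (T : 'I_4 -> 'I_4 -> 'I_4 -> A) e a b c := D e (T a b c)
  - cs (fun f => T f b c) e a - cs (fun f => T a f c) e b - cs (fun f => T a b f) e c.

Lemma leibniz3 T X Y Z e : D e (con (fun a => con (fun b => con (T a b) Z) Y) X) =
  con (fun a => con (fun b => con (nab3 T e a b) Z) Y) X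
  + con (fun a => con (fun b => con (T a b) (nabv Z e)) Y) X
  + con (fun a => con (fun b => con (T a b) Z) (nabv Y e)) X
  + con (fun a => con (fun b => con (T a b) Z) Y) (nabv X e).
Proof.
rewrite leibniz2; congr (_ + _ + _); rewrite -conD; apply: eq_con => a.
rewrite -conD; apply: eq_con => b.
by rewrite /nab2 leibniz1 !cs_con /nab3 !conB; ring.
Qed.

Definition ev4 (T : 'I_4 -> 'I_4 -> 'I_4 -> 'I_4 -> A) X Y Z V : A :=
  con (fun a => con (fun b => con (fun c => con (T a b c) V) Z) Y) X.

Lemma leibniz4 T X Y Z V e : D e (ev4 T X Y Z V) =
  ev4 (nab4 T e) X Y Z V + ev4 T X Y Z (nabv V e) + ev4 T X Y (nabv Z e) V
  + ev4 T X (nabv Y e) Z V + ev4 T (nabv X e) Y Z V.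
Proof.
rewrite /ev4 leibniz3; congr (_ + _ + _ + _); rewrite -conD; apply: eq_con => a.
rewrite -conD; apply: eq_con => b; rewrite -conD; apply: eq_con => c.
by rewrite /nab3 leibniz1 !cs_con /nab4 !conB; ring.
Qed.

Definition gd X Y : A := con (fun a => con (g a) Y) X.

Lemma gd_sym X Y : gd X Y = gd Y X.
Proof. by rewrite /gd con_exchange; apply: eq_con => a; apply: eq_con => b. Qed.

Lemma leibniz_gd X Y e : D e (gd X Y) = gd (nabv X e) Y + gd X (nabv Y e).
Proof.
rewrite /gd leibniz2.
have -> : con (fun a => con (nab2 (fun a b => g a b) e a) Y) X = 0.
  apply: big1 => a _; rewrite [con _ _]big1 ?mul0r // => b _.
  by rewrite /nab2 -cs_g; ring.
ring.
Qed.

(** The term in which the derivative falls on [V] is again a value of the constraint and drops out;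
    those with the derivative of [X] or [Y] remain and will produce gamma. *)
Lemma derive_constraint0 T X Y : (forall V, ev4 T X Y X V = 0) -> forall e V,
  ev4 (nab4 T e) X Y X V + ev4 T X Y (nabv X e) V
  + ev4 T X (nabv Y e) X V + ev4 T (nabv X e) Y X V = 0.
Proof.
by move=> H e V; have := D0 e; rewrite -(H V) leibniz4 H addr0 => ->.
Qed.

Lemma derive_constraint0' T X Y : (forall V, ev4 T X Y Y V = 0) -> forall e V,
  ev4 (nab4 T e) X Y Y V + ev4 T X Y (nabv Y e) V
  + ev4 T X (nabv Y e) Y V + ev4 T (nabv X e) Y Y V = 0.
Proof.
by move=> H e V; have := D0 e; rewrite -(H V) leibniz4 H addr0 => ->.
Qed.

Lemma derive_constraint1 T X Y : (forall Z V, ev4 T X Y Z V = 0) -> forall e Z V,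
  ev4 (nab4 T e) X Y Z V + ev4 T X (nabv Y e) Z V + ev4 T (nabv X e) Y Z V = 0.
Proof.
by move=> H e Z V; have := D0 e; rewrite -(H Z V) leibniz4 !H !addr0 => ->.
Qed.

(* Vanishes identically iff [T] annihilates, in its last two slots, the
   bivectors obtained by commuting [X /\ Y] with arbitrary ones; if [X /\ Y] is
   a selfdual null bivector, these span the orthogonal of [X /\ Y] among the
   selfdual bivectors. *)
Definition commutator_form T X Y U V Z W : A :=
  ev4 T U V X Z * gd Y W - ev4 T U V Y Z * gd X W
  - ev4 T U V X W * gd Y Z + ev4 T U V Y W * gd X Z.

(** Terms with a derivative of [U], [V], [Z] or [W] are themselves values of the vanishing form; the
    proof subtracts these four. *)
Lemma derive_commutator_form T X Y :
  (forall U V Z W, commutator_form T X Y U V Z W = 0) -> forall e U V Z W,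
  commutator_form (nab4 T e) X Y U V Z W
  + (ev4 T U V (nabv X e) Z * gd Y W - ev4 T U V Y Z * gd (nabv X e) W
     - ev4 T U V (nabv X e) W * gd Y Z + ev4 T U V Y W * gd (nabv X e) Z)
  + (ev4 T U V X Z * gd (nabv Y e) W - ev4 T U V (nabv Y e) Z * gd X W
     - ev4 T U V X W * gd (nabv Y e) Z + ev4 T U V (nabv Y e) W * gd X Z) = 0.
Proof.
move=> H e U V Z W; have : D e (commutator_form T X Y U V Z W) = 0 by rewrite H D0.
rewrite /commutator_form !(DD, DN) !DM !leibniz4 !leibniz_gd => E.
have := H (nabv U e) V Z W; have := H U (nabv V e) Z W.
have := H U V (nabv Z e) W; have := H U V Z (nabv W e).
rewrite /commutator_form => H4 H3 H2 H1.
apply: etrans (subrr 0); rewrite -{1}E -[X in _ = _ - X]addr0 -{1}H4 -[X in _ = _ - (_ + X)]addr0.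
rewrite -{1}H3 -[X in _ = _ - (_ + (_ + X))]addr0 -{1}H2 -H1; ring.
Qed.

Definition bracket X Y a : A := \sum_b (X b * D b (Y a) - Y b * D b (X a)).

Lemma bracket_nabv X Y a : bracket X Y a = \sum_b (X b * nabv Y b a - Y b * nabv X b a).
Proof.
rewrite /bracket /nabv !big_split /= !sumrN.
under [in RHS]eq_bigr do rewrite mulrDr.
under [X in _ = _ - X]eq_bigr do rewrite mulrDr.
rewrite !big_split /=.
have -> : \sum_b Y b * (\sum_f Gam a b f * X f) = \sum_b X b * (\sum_f Gam a b f * Y f).
  under eq_bigr do rewrite big_distrr /=.
  rewrite exchange_big /=; apply: eq_bigr => b _; rewrite big_distrr /=.
  by apply: eq_bigr => f _; rewrite (Gam_sym a f b); ring.
ring.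
Qed.

(** The connection is torsion-free, and orthogonality to Z moves each derivative from X or Y onto Z.
    The right-hand side involves only the pointwise values of X and Y. *)
Lemma gd_bracket X Y Z : gd X Z = 0 -> gd Y Z = 0 -> gd (bracket X Y) Z =
  \sum_b (Y b * gd X (nabv Z b) - X b * gd Y (nabv Z b)).
Proof.
move=> XZ YZ.
have sk U b : gd U Z = 0 -> gd (nabv U b) Z = - gd U (nabv Z b).
  by move=> UZ; apply/eqP; rewrite -addr_eq0 -leibniz_gd UZ D0.
transitivity (\sum_b (X b * gd (nabv Y b) Z - Y b * gd (nabv X b) Z)).
  have gE U V : gd U V = con (fun a => con (g a) V) U by [].
  rewrite gE /con; under eq_bigr do rewrite bracket_nabv big_distrr /=.
  rewrite exchange_big /=; apply: eq_bigr => b _.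
  rewrite !gE /con !big_distrr -sumrN -big_split /=; apply: eq_bigr => a _.
  by rewrite -/(con (g a) Z); ring.
by apply: eq_bigr => b _; rewrite !sk //; ring.
Qed.

End DifferentialRing.

(** * Weyl tensors in a null frame *)

(** Iterated lifts are the shape that [big_ord_recl] produces when a sum over four indices is
    expanded. *)
Notation o0 := (ord0 : 'I_4).
Notation o1 := (lift ord0 ord0 : 'I_4).
Notation o2 := (lift ord0 (lift ord0 ord0) : 'I_4).
Notation o3 := (lift ord0 (lift ord0 (lift ord0 ord0)) : 'I_4).

Lemma ord4P (P : 'I_4 -> Prop) : P o0 -> P o1 -> P o2 -> P o3 -> forall i, P i.
Proof.
move=> P0 P1 P2 P3; case=> [[|[|[|[|//]]]] h].
- by have -> : Ordinal h = o0 by exact: val_inj.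
- by have -> : Ordinal h = o1 by exact: val_inj.
- by have -> : Ordinal h = o2 by exact: val_inj.
- by have -> : Ordinal h = o3 by exact: val_inj.
Qed.

(* The frame is (m, p, n, k), so that the indices paired by the metric are
   o0, o1 and o2, o3. *)
Record weyl_like (K : comPzRingType) (T : 'I_4 -> 'I_4 -> 'I_4 -> 'I_4 -> K) : Prop := WeylLike {
  wl12 : forall a b c d, T a b c d = - T b a c d;
  wl34 : forall a b c d, T a b c d = - T a b d c;
  wl_pair : forall a b c d, T a b c d = T c d a b;
  wl_cyc : forall a b c d, T a b c d + T a c d b + T a d b c = 0;
  wl_tr : forall a d, T a o0 o1 d + T a o1 o0 d + T a o2 o3 d + T a o3 o2 d = 0 }.

Section WeylComponents.
Variable K : comPzRingType.
Hypothesis K2 : forall x : K, 2 * x = 0 -> x = 0.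
Variables (T : 'I_4 -> 'I_4 -> 'I_4 -> 'I_4 -> K) (wT : weyl_like T).

Lemma wl0 a c d : T a a c d = 0.
Proof. by apply: K2; rewrite mulr_natl mulr2n {1}(wl12 wT) addNr. Qed.

Lemma wl0' a c d : T c d a a = 0.
Proof. by rewrite (wl_pair wT) wl0. Qed.

Lemma add_eq0 (x y : K) : x + y = 0 -> x = - y.
Proof. by move/eqP; rewrite addr_eq0 => /eqP. Qed.

(** From here to [w0123], the trace and cyclic conditions are solved one component at a time. Ten
    independent components remain: 0303, 0103, 0312, 0112, 1212 for the selfdual part, which are
    Psi_0, -Psi_1, Psi_2, Psi_3, Psi_4, and 0202, 0102, 0213, 0113, 1313 for the antiselfdual
    part. *)
Lemma w0203 : T o0 o2 o0 o3 = 0.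
Proof.
apply: K2; have := wl_tr wT o0 o0; rewrite !wl0 !wl0' => E.
transitivity (- (0 + 0 + T o0 o2 o3 o0 + T o0 o3 o2 o0)); last by rewrite E oppr0.
rewrite (wl34 wT o0 o2 o3) (wl34 wT o0 o3 o2) (wl_pair wT o0 o3); ring.
Qed.

Lemma w1213 : T o1 o2 o1 o3 = 0.
Proof.
apply: K2; have := wl_tr wT o1 o1; rewrite !wl0 !wl0' => E.
transitivity (- (0 + 0 + T o1 o2 o3 o1 + T o1 o3 o2 o1)); last by rewrite E oppr0.
rewrite (wl34 wT o1 o2 o3) (wl34 wT o1 o3 o2) (wl_pair wT o1 o3); ring.
Qed.

Lemma w0212 : T o0 o2 o1 o2 = 0.
Proof.
apply: K2; have := wl_tr wT o2 o2; rewrite !wl0 !wl0' => E.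
transitivity (- (T o2 o0 o1 o2 + T o2 o1 o0 o2 + 0 + 0)); last by rewrite E oppr0.
rewrite (wl12 wT o2 o0) (wl12 wT o2 o1) (wl_pair wT o1 o2); ring.
Qed.

Lemma w0313 : T o0 o3 o1 o3 = 0.
Proof.
apply: K2; have := wl_tr wT o3 o3; rewrite !wl0 !wl0' => E.
transitivity (- (T o3 o0 o1 o3 + T o3 o1 o0 o3 + 0 + 0)); last by rewrite E oppr0.
rewrite (wl12 wT o3 o0) (wl12 wT o3 o1) (wl_pair wT o1 o3); ring.
Qed.

Lemma w0101 : T o0 o1 o0 o1 = T o0 o2 o1 o3 + T o0 o3 o1 o2.
Proof.
have E := wl_tr wT o0 o1; rewrite !wl0 in E.
apply/eqP; rewrite -subr_eq0 -E; apply/eqP.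
rewrite (wl34 wT o0 o2 o3) (wl34 wT o0 o3 o2); ring.
Qed.

Lemma w2323 : T o2 o3 o2 o3 = T o0 o2 o1 o3 + T o0 o3 o1 o2.
Proof.
have E := wl_tr wT o2 o3; rewrite !wl0 in E.
apply/eqP; rewrite -subr_eq0 -E; apply/eqP.
rewrite (wl12 wT o2 o0) (wl12 wT o2 o1) (wl_pair wT o1 o2); ring.
Qed.

Lemma w0223 : T o0 o2 o2 o3 = T o0 o1 o0 o2.
Proof.
have E := wl_tr wT o0 o2; rewrite !wl0 !wl0' in E.
apply/eqP; rewrite -subr_eq0 -oppr_eq0 -E; apply/eqP.
rewrite (wl34 wT o0 o2 o3); ring.
Qed.

Lemma w0323 : T o0 o3 o2 o3 = - T o0 o1 o0 o3.
Proof.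
have E := wl_tr wT o0 o3; rewrite !wl0 !wl0' in E.
by apply: add_eq0; rewrite -[RHS]E; ring.
Qed.

Lemma w1223 : T o1 o2 o2 o3 = - T o0 o1 o1 o2.
Proof.
have E := wl_tr wT o1 o2; rewrite !wl0 !wl0' in E.
apply: add_eq0; rewrite -oppr0 -[X in _ = - X]E (wl34 wT o1 o2 o3) (wl12 wT o1 o0); ring.
Qed.

Lemma w1323 : T o1 o3 o2 o3 = T o0 o1 o1 o3.
Proof.
have E := wl_tr wT o1 o3; rewrite !wl0 !wl0' in E.
apply/eqP; rewrite -subr_eq0 -E (wl12 wT o1 o0); apply/eqP; ring.
Qed.

Lemma w0123 : T o0 o1 o2 o3 = T o0 o2 o1 o3 - T o0 o3 o1 o2.
Proof.
have := wl_cyc wT o0 o1 o2 o3; rewrite -addrA => /add_eq0 ->.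
rewrite (wl34 wT o0 o2 o3); ring.
Qed.

End WeylComponents.

(* Sorts the indices of the first pair, of the second pair, and then the pairs,
   and expresses the result through the components that remain independent. *)
Ltac weyl_sort K2 w :=
  rewrite ?(wl0 K2 w) ?(wl0' K2 w)
   ?(wl12 w o1 o0) ?(wl12 w o2 o0) ?(wl12 w o3 o0) ?(wl12 w o2 o1) ?(wl12 w o3 o1) ?(wl12 w o3 o2)
   ?(wl34 w _ _ o1 o0) ?(wl34 w _ _ o2 o0) ?(wl34 w _ _ o3 o0)
   ?(wl34 w _ _ o2 o1) ?(wl34 w _ _ o3 o1) ?(wl34 w _ _ o3 o2)
   ?(wl_pair w o0 o2 o0 o1) ?(wl_pair w o0 o3 o0 o1) ?(wl_pair w o1 o2 o0 o1)
   ?(wl_pair w o1 o3 o0 o1) ?(wl_pair w o2 o3 o0 o1) ?(wl_pair w o0 o3 o0 o2)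
   ?(wl_pair w o1 o2 o0 o2) ?(wl_pair w o1 o3 o0 o2) ?(wl_pair w o2 o3 o0 o2)
   ?(wl_pair w o1 o2 o0 o3) ?(wl_pair w o1 o3 o0 o3) ?(wl_pair w o2 o3 o0 o3)
   ?(wl_pair w o1 o3 o1 o2) ?(wl_pair w o2 o3 o1 o2) ?(wl_pair w o2 o3 o1 o3)
   ?(w0203 K2 w) ?(w1213 K2 w) ?(w0212 K2 w) ?(w0313 K2 w) ?(w0101 K2 w) ?(w2323 K2 w)
   ?(w0223 K2 w) ?(w0323 K2 w) ?(w1223 K2 w) ?(w1323 K2 w) ?(w0123 w).

(** * Successive vanishing of Psi_2, Psi_3 and Psi_4 at a point, in frame components *)

Section NullFrame.
Variable K : comPzRingType.
Hypothesis K2 : forall x : K, 2 * x = 0 -> x = 0.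
Hypothesis K3 : forall x : K, 3 * x = 0 -> x = 0.
Implicit Types (T : 'I_4 -> 'I_4 -> 'I_4 -> 'I_4 -> K).

Section Derivative.
Variables (T : 'I_4 -> 'I_4 -> 'I_4 -> 'I_4 -> K) (wT : weyl_like T).
Variables (S : 'I_4 -> 'I_4 -> 'I_4 -> 'I_4 -> 'I_4 -> K).
Hypothesis wS : forall e, weyl_like (S e).

(** The divergence: the inverse metric pairs o0 with o1 and o2 with o3, and contracts the direction
    of differentiation with the first slot. *)
Definition frame_div j k l :=
  S o0 o1 j k l + S o1 o0 j k l + S o2 o3 j k l + S o3 o2 j k l.

(** Orthogonality to the selfdual bivectors m /\ k, p /\ n and m /\ p - n /\ k. *)
Definition antiselfdual_frame (F : 'I_4 -> 'I_4 -> K) :=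
  [/\ F o0 o3 = 0, F o1 o2 = 0 & F o0 o1 = F o2 o3].

Hypotheses (D0 : antiselfdual_frame (frame_div o0)) (D3 : antiselfdual_frame (frame_div o3)).

(** Reduces each goal below to one [ring] identity: four instances of a differentiated constraint
    plus one component of the divergence. *)
Lemma sum0 (x a b c d e : K) : a = 0 -> b = 0 -> c = 0 -> d = 0 -> e = 0 ->
  x = a + b + c + d + e -> x = 0.
Proof. by move=> -> -> -> -> -> ->; rewrite !addr0. Qed.

Ltac div_sort := rewrite /frame_div;
  weyl_sort K2 (wS o0); weyl_sort K2 (wS o1); weyl_sort K2 (wS o2);
  weyl_sort K2 (wS o3).

(** In spinors, the selfdual part of the divergence of a Weyl tensor is totally symmetric in its
    three indices of selfdual type. Hence components along n repeat components along m, and those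
    along p repeat those along k, up to a factor. This lemma and the next three extract in this way
    what the hypotheses on m and k say about n and p. *)
Lemma frame_div203 : frame_div o2 o0 o3 = 0.
Proof.
have [_ _ d0] := D0; apply: K2.
have : frame_div o0 o2 o3 - frame_div o0 o0 o1 = 0 by rewrite d0 subrr.
by move=> <-; div_sort; ring.
Qed.

Lemma frame_div103 : frame_div o1 o0 o3 = 0.
Proof.
have [_ _ d3] := D3; apply: K2.
have : frame_div o3 o0 o1 - frame_div o3 o2 o3 = 0 by rewrite d3 subrr.
by move=> <-; div_sort; ring.
Qed.

Lemma frame_div2G : frame_div o2 o0 o1 - frame_div o2 o2 o3 = 0.
Proof.
have [_ d0 _] := D0.
have : - frame_div o0 o1 o2 * 2 = 0 by rewrite d0 oppr0 mul0r.
by move=> <-; div_sort; ring.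
Qed.

Lemma frame_div1G : frame_div o1 o0 o1 - frame_div o1 o2 o3 = 0.
Proof.
have [_ d3 _] := D3.
have : frame_div o3 o1 o2 * 2 = 0 by rewrite d3 mul0r.
by move=> <-; div_sort; ring.
Qed.

(* nabla_i m = a_i m + b_i k + gam_i n  and  nabla_i k = c_i m + d_i k - gam_i p *)
Variables a b c d gam : 'I_4 -> K.

Section Level0.
Hypothesis T0303 : T o0 o3 o0 o3 = 0.
Hypothesis T0103 : T o0 o1 o0 o3 = 0.
Hypothesis L0m : forall i l, S i o0 o3 o0 l
  + (a i * T o0 o3 o0 l + b i * T o3 o3 o0 l + gam i * T o2 o3 o0 l)
  + (c i * T o0 o0 o0 l + d i * T o0 o3 o0 l - gam i * T o0 o1 o0 l)
  + (a i * T o0 o3 o0 l + b i * T o0 o3 o3 l + gam i * T o0 o3 o2 l) = 0.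
Hypothesis L0k : forall i l, S i o0 o3 o3 l
  + (a i * T o0 o3 o3 l + b i * T o3 o3 o3 l + gam i * T o2 o3 o3 l)
  + (c i * T o0 o0 o3 l + d i * T o0 o3 o3 l - gam i * T o0 o1 o3 l)
  + (c i * T o0 o3 o0 l + d i * T o0 o3 o3 l - gam i * T o0 o3 o1 l) = 0.

(** Contracting the direction of differentiation with the last slot turns the derivative terms into
    a component of the divergence, which is zero. The coefficients a, b, c, d keep m and k inside
    the plane and drop out by T0303 = T0103 = 0; the terms with gam in the three differentiated
    slots add up to -3 gam Psi_2. *)
Lemma level0 : gam o0 * T o0 o3 o1 o2 = 0 /\ gam o3 * T o0 o3 o1 o2 = 0.
Proof.
have [d0 _ _] := D0; have [d3 _ _] := D3; split; apply: K3.
- apply/eqP; rewrite -oppr_eq0; apply/eqP.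
  apply: (sum0 (L0m o0 o1) (L0m o1 o0) (L0m o2 o3) (L0m o3 o2) d0).
  by div_sort; weyl_sort K2 wT; rewrite T0303 T0103; ring.
- apply/eqP; rewrite -oppr_eq0; apply/eqP.
  apply: (sum0 (L0k o0 o1) (L0k o1 o0) (L0k o2 o3) (L0k o3 o2) d3).
  by div_sort; weyl_sort K2 wT; rewrite T0303 T0103; ring.
Qed.
End Level0.

Section Level1.
Hypothesis T03 : forall k l, T o0 o3 k l = 0.
Hypothesis L1 : forall i k l, S i o0 o3 k l
  + (a i * T o0 o3 k l + b i * T o3 o3 k l + gam i * T o2 o3 k l)
  + (c i * T o0 o0 k l + d i * T o0 o3 k l - gam i * T o0 o1 k l) = 0.

(** The same contraction with third slot n, respectively p. The divergence components needed are
    then along n and p, supplied by [frame_div203] and [frame_div103]. *)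
Lemma level1 : gam o0 * T o0 o1 o1 o2 = 0 /\ gam o3 * T o0 o1 o1 o2 = 0.
Proof.
have T2 := T03 o1 o2; have T1 : T o0 o1 o0 o3 = 0 by rewrite (wl_pair wT).
split; apply: K2.
- apply: (sum0 (L1 o0 o2 o1) (L1 o1 o2 o0) (L1 o2 o2 o3) (L1 o3 o2 o2) frame_div203).
  by div_sort; rewrite !T03; weyl_sort K2 wT; rewrite T2; ring.
- apply/eqP; rewrite -oppr_eq0; apply/eqP.
  apply: (sum0 (L1 o0 o1 o1) (L1 o1 o1 o0) (L1 o2 o1 o3) (L1 o3 o1 o2) frame_div103).
  by div_sort; rewrite !T03; weyl_sort K2 wT; rewrite T2; ring.
Qed.
End Level1.

Section Level2.
Hypothesis T03 : forall k l, T o0 o3 k l = 0.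
Hypothesis T0112 : T o0 o1 o1 o2 = 0.
Hypothesis L2 : forall i j k, S i j k o0 o1 - S i j k o2 o3 - 2 * gam i * T j k o1 o2 = 0.

(** [L2] is the derivative of C(., ., m /\ p - n /\ k) = 0. Its contraction with the first slot, the
    second being n or p, leaves only gam Psi_4. *)
Lemma level2 : gam o0 * T o1 o2 o1 o2 = 0 /\ gam o3 * T o1 o2 o1 o2 = 0.
Proof.
have T2 := T03 o1 o2; split; apply: K2; apply/eqP; rewrite -oppr_eq0; apply/eqP.
- have E := frame_div2G; rewrite -[LHS]opprK in E; move/eqP: E; rewrite oppr_eq0 => /eqP E.
  apply: (sum0 (L2 o0 o1 o2) (L2 o1 o0 o2) (L2 o2 o3 o2) (L2 o3 o2 o2) E).
  by rewrite /frame_div; weyl_sort K2 wT; rewrite ?T2 ?T0112; ring.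
- have E := frame_div1G; rewrite -[LHS]opprK in E; move/eqP: E; rewrite oppr_eq0 => /eqP E.
  apply/eqP; rewrite -oppr_eq0; apply/eqP.
  apply: (sum0 (L2 o0 o1 o1) (L2 o1 o0 o1) (L2 o2 o3 o1) (L2 o3 o2 o1) E).
  by rewrite /frame_div; weyl_sort K2 wT; rewrite ?T2 ?T0112; ring.
Qed.
End Level2.

End Derivative.

(** Components with 12 or with 01 - 23 in one pair are combinations of the selfdual components, all
    of which are now zero. *)
Lemma selfdual_components_vanish T : weyl_like T ->
  (forall k l, T o0 o3 k l = 0) -> T o0 o1 o1 o2 = 0 -> T o1 o2 o1 o2 = 0 ->
  forall k l, T o1 o2 k l = 0 /\ T o0 o1 k l = T o2 o3 k l.
Proof.
move=> w T03 T0112 T1212 k l; have T2 := T03 o1 o2; have T1 := T03 o0 o1.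
have T1' : T o0 o1 o0 o3 = 0 by rewrite (wl_pair w).
by elim/ord4P: k; elim/ord4P: l; split; weyl_sort K2 w; rewrite ?T2 ?T1' ?T0112 ?T1212; ring.
Qed.

Lemma level0_components T : weyl_like T ->
  T o0 o3 o0 o3 = 0 -> T o0 o1 o0 o3 = 0 -> T o0 o3 o1 o2 = 0 ->
  forall k l, T o0 o3 k l = 0.
Proof.
move=> w T0 T1 T2 k l.
by elim/ord4P: k; elim/ord4P: l; weyl_sort K2 w; rewrite ?T0 ?T1 ?T2; ring.
Qed.

Lemma level1_components T : weyl_like T ->
  (forall k l, T o0 o3 k l = 0) -> T o0 o1 o1 o2 = 0 ->
  forall k l, T k l o0 o1 = T k l o2 o3.
Proof.
move=> w T03 T0112 k l; have T2 := T03 o1 o2.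
have T1 : T o0 o1 o0 o3 = 0 by rewrite (wl_pair w).
by elim/ord4P: k; elim/ord4P: l; weyl_sort K2 w; rewrite ?T2 ?T1 ?T0112; ring.
Qed.

Lemma principal_components T : weyl_like T ->
  T o0 o3 o0 o3 = 0 -> T o0 o1 o0 o3 = 0 ->
  forall l, T o0 o3 o0 l = 0 /\ T o0 o3 o3 l = 0.
Proof.
move=> w T0 T1 l.
by elim/ord4P: l; split; weyl_sort K2 w; rewrite ?T0 ?T1; ring.
Qed.

End NullFrame.

(** * Contractions of tensors and expansion in a null frame *)

Section Contractions.
Variable K : comPzRingType.
Implicit Types (S : 'I_4 -> K) (T : 'I_4 -> 'I_4 -> 'I_4 -> 'I_4 -> K) (X Y Z V : 'I_4 -> K).

Definition lincomb (v : 'I_4 -> K) (u : 'I_4 -> 'I_4 -> K) a := \sum_i v i * u i a.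

Lemma con_lincomb S v u : con S (lincomb v u) = \sum_i v i * con S (u i).
Proof.
rewrite /con /lincomb; under eq_bigr do rewrite big_distrr /=.
rewrite exchange_big /=; apply: eq_bigr => i _; rewrite big_distrr /=.
by apply: eq_bigr => a _; ring.
Qed.

Lemma con_sum (F : 'I_4 -> 'I_4 -> K) (v : 'I_4 -> K) X :
  con (fun a => \sum_i v i * F i a) X = \sum_i v i * con (F i) X.
Proof.
rewrite /con; under eq_bigr do rewrite big_distrl /=.
rewrite exchange_big /=; apply: eq_bigr => i _; rewrite big_distrr /=.
by apply: eq_bigr => a _; ring.
Qed.

Lemma con_bigsum (F : 'I_4 -> 'I_4 -> K) X :
  con (fun a => \sum_i F i a) X = \sum_i con (F i) X.
Proof.
rewrite /con; under eq_bigr do rewrite big_distrl /=.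
by rewrite exchange_big.
Qed.

Lemma con_mull x S X : con (fun a => x * S a) X = x * con S X.
Proof. by rewrite big_distrr; apply: eq_bigr => a _; rewrite /= mulrA. Qed.

Lemma eq_ev4 T T' X Y Z V : (forall a b c d, T a b c d = T' a b c d) ->
  ev4 T X Y Z V = ev4 T' X Y Z V.
Proof.
by move=> E; rewrite /ev4; apply: eq_con => a; apply: eq_con => b; apply: eq_con => c;
  apply: eq_con => d.
Qed.

Lemma ev4D T T' X Y Z V :
  ev4 (fun a b c d => T a b c d + T' a b c d) X Y Z V = ev4 T X Y Z V + ev4 T' X Y Z V.
Proof.
rewrite /ev4 -conD; apply: eq_con => a; rewrite -conD; apply: eq_con => b.
by rewrite -conD; apply: eq_con => c; rewrite -conD.
Qed.

Lemma ev40 X Y Z V : ev4 (fun _ _ _ _ => 0 : K) X Y Z V = 0.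
Proof.
have z S W : S =1 (fun=> 0) -> con S W = 0.
  move=> E; rewrite (eq_con _ E); exact: con0.
by apply: (z) => a; apply: (z) => b; apply: (z) => c; exact: con0.
Qed.

Lemma ev4_swap23 T X Y Z V :
  ev4 T X Y Z V = ev4 (fun a c b d => T a b c d) X Z Y V.
Proof. by apply: eq_con => a; exact: con_exchange. Qed.

Lemma ev4_swap12 T X Y Z V :
  ev4 T X Y Z V = ev4 (fun b a c d => T a b c d) Y X Z V.
Proof. exact: con_exchange. Qed.

Lemma ev4_swap34 T X Y Z V :
  ev4 T X Y Z V = ev4 (fun a b d c => T a b c d) X Y V Z.
Proof. by apply: eq_con => a; apply: eq_con => b; exact: con_exchange. Qed.

Lemma ev4_lincomb1 T v u Y Z V :
  ev4 T (lincomb v u) Y Z V = \sum_i v i * ev4 T (u i) Y Z V.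
Proof. exact: con_lincomb. Qed.

Lemma ev4_lincomb2 T X v u Z V :
  ev4 T X (lincomb v u) Z V = \sum_i v i * ev4 T X (u i) Z V.
Proof. by rewrite /ev4 -con_sum; apply: eq_con => a; exact: con_lincomb. Qed.

Lemma ev4_lincomb3 T X Y v u V :
  ev4 T X Y (lincomb v u) V = \sum_i v i * ev4 T X Y (u i) V.
Proof.
rewrite /ev4 -con_sum; apply: eq_con => a; rewrite -con_sum; apply: eq_con => b.
exact: con_lincomb.
Qed.

Lemma ev4_lincomb4 T X Y Z v u :
  ev4 T X Y Z (lincomb v u) = \sum_i v i * ev4 T X Y Z (u i).
Proof.
rewrite /ev4 -con_sum; apply: eq_con => a; rewrite -con_sum; apply: eq_con => b.
by rewrite -con_sum; apply: eq_con => c; exact: con_lincomb.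
Qed.

Lemma gd_lincomb (g : 'M[K]_4) v u Y : gd g (lincomb v u) Y = \sum_i v i * gd g (u i) Y.
Proof. exact: con_lincomb. Qed.

Record weyl_tensor (H : 'M[K]_4) T : Prop := WeylTensor {
  wt12 : forall a b c d, T a b c d = - T b a c d;
  wt34 : forall a b c d, T a b c d = - T a b d c;
  wt_pair : forall a b c d, T a b c d = T c d a b;
  wt_cyc : forall a b c d, T a b c d + T a c d b + T a d b c = 0;
  wt_tr : forall a d, \sum_b \sum_c H b c * T a b c d = 0 }.

End Contractions.

Section Frame.
Variables (K : fieldType) (G H : 'M[K]_4) (u : 'I_4 -> 'I_4 -> K).
Hypothesis Gsym : forall a b, G a b = G b a.
Hypothesis GH : G *m H = 1%:M.
Implicit Types (T : 'I_4 -> 'I_4 -> 'I_4 -> 'I_4 -> K) (X Y Z V : 'I_4 -> K).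

Definition bar (i : 'I_4) : 'I_4 := tnth [tuple o1; o0; o3; o2] i.

Definition eta : 'M[K]_4 := \matrix_(i, j) (j == bar i)%:R.

Definition frame_mx : 'M[K]_4 := \matrix_(i, a) u i a.

Hypothesis fu : forall i j, gd G (u i) (u j) = (j == bar i)%:R.

Lemma frame_mxE : frame_mx *m G *m frame_mx^T = eta.
Proof.
apply/matrixP => i j; rewrite [RHS]mxE -fu gd_sym // mxE.
apply: eq_bigr => b _; rewrite [frame_mx^T b j]mxE [frame_mx j b]mxE; congr (_ * _).
rewrite mxE; apply: eq_bigr => a _; rewrite [frame_mx i a]mxE Gsym mulrC //.
Qed.

Lemma eta_mul (M : 'M[K]_4) i j : (eta *m M) i j = M (bar i) j.
Proof.
rewrite mxE (bigD1 (bar i)) //= big1 ?addr0 => [|k /negPf nk].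
  by rewrite mxE eqxx mul1r.
by rewrite mxE nk mul0r.
Qed.

Lemma barK : involutive bar.
Proof. by elim/ord4P; apply/val_inj. Qed.

Lemma eta2 : eta *m eta = 1%:M.
Proof.
by apply/matrixP => i j; rewrite eta_mul !mxE barK eq_sym.
Qed.

(** With E the frame matrix, E G E^T = [eta] and [eta] is an involution, so E is invertible and G^-1
    = E^T [eta] E. *)
Lemma inverse_metric_frame : H = frame_mx^T *m eta *m frame_mx.
Proof.
have E1 : frame_mx *m G *m (frame_mx^T *m eta) = 1%:M.
  by rewrite mulmxA frame_mxE eta2.
have E2 := mulmx1C E1.
by rewrite -[LHS]mul1mx -E2 -!mulmxA GH mulmx1.
Qed.

Lemma inverse_metricE a b : H a b = \sum_i u i a * u (bar i) b.
Proof.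
rewrite inverse_metric_frame -mulmxA mxE; apply: eq_bigr => i _.
by rewrite eta_mul !mxE.
Qed.

Lemma frame_trace (S : 'I_4 -> 'I_4 -> K) :
  \sum_i con (fun b => con (S b) (u (bar i))) (u i) = \sum_b \sum_c H b c * S b c.
Proof.
under [RHS]eq_bigr do under eq_bigr do rewrite inverse_metricE big_distrl /=.
under [RHS]eq_bigr do rewrite exchange_big /=.
rewrite [RHS]exchange_big /=; apply: eq_bigr => i _; apply: eq_bigr => b _.
by rewrite /con big_distrl /=; apply: eq_bigr => c _; ring.
Qed.

Lemma frame_expand V : V =1 lincomb (fun i => gd G V (u (bar i))) u.
Proof.
move=> a; rewrite /lincomb.
transitivity (\sum_b H a b * (\sum_c G b c * V c)).
  by rewrite (@sum_mul1 _ H G V a) // mulmx1C.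
under eq_bigr do rewrite inverse_metricE big_distrl /=.
rewrite exchange_big /=; apply: eq_bigr => i _.
under eq_bigr do rewrite -mulrA.
rewrite -big_distrr /= mulrC; congr (_ * _).
rewrite gd_sym // /gd /con; apply: eq_bigr => b _; by rewrite mulrC.
Qed.

Lemma sum_bar (F : 'I_4 -> 'I_4 -> K) :
  \sum_i F i (bar i) = F o0 o1 + F o1 o0 + F o2 o3 + F o3 o2.
Proof.
rewrite !big_ord_recl big_ord0 addr0 -!addrA; congr (_ + (_ + (_ + _)));
  by congr F; apply: val_inj.
Qed.

Definition fr T i j k l := ev4 T (u i) (u j) (u k) (u l).

Lemma fr_weyl T : weyl_tensor H T -> weyl_like (fr T).
Proof.
case=> w12 w34 wp wc wt; rewrite /fr; split=> [a b c d|a b c d|a b c d|a b c d|a d].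
- rewrite /ev4 con_exchange -conN; apply: eq_con => i; rewrite -conN; apply: eq_con => j.
  rewrite -conN; apply: eq_con => k; rewrite -conN; apply: eq_con => l; exact: w12.
- rewrite /ev4 -conN; apply: eq_con => i; rewrite -conN; apply: eq_con => j.
  rewrite con_exchange -conN; apply: eq_con => k; rewrite -conN; apply: eq_con => l.
  exact: w34.
- by rewrite ev4_swap23 ev4_swap12 ev4_swap34 ev4_swap23; apply: eq_ev4 => *; exact: wp.
- rewrite (ev4_swap34 _ (u a) (u c)) (ev4_swap23 _ (u a) (u c)).
  rewrite (ev4_swap23 _ (u a) (u d)) (ev4_swap34 _ (u a) (u b) (u d)).
  by rewrite -!ev4D -[RHS](ev40 (u a) (u b) (u c) (u d)); apply: eq_ev4 => *; exact: wc.
rewrite -(sum_bar (fun i j => ev4 T (u a) (u i) (u j) (u d))) /ev4 -con_bigsum.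
rewrite -[RHS](con0 (u a)); apply: eq_con => x.
rewrite (frame_trace (fun b c => con (T x b c) (u d))).
rewrite -[RHS](con0 (u d)).
under eq_bigr do (under eq_bigr do rewrite -con_mull; rewrite -con_bigsum).
by rewrite -con_bigsum; apply: eq_con => y; exact: wt.
Qed.

End Frame.

(* The values at a point of the Weyl tensor [T], of its covariant derivative
   [NT] and of the Cotton tensor [Cot], of a frame [(u o0, u o3)] of the plane
   field and of the covariant derivatives [dX], [dY] of that frame. *)
Section Point.
Variables (K : fieldType) (G H : 'M[K]_4) (u : 'I_4 -> 'I_4 -> K).
Hypothesis K2 : forall x : K, 2 * x = 0 -> x = 0.
Hypothesis K3 : forall x : K, 3 * x = 0 -> x = 0.
Hypothesis Gsym : forall a b, G a b = G b a.
Hypothesis GH : G *m H = 1%:M.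
Hypothesis fu : forall i j, gd G (u i) (u j) = (j == bar i)%:R.
Variables (T : 'I_4 -> 'I_4 -> 'I_4 -> 'I_4 -> K)
  (NT : 'I_4 -> 'I_4 -> 'I_4 -> 'I_4 -> 'I_4 -> K) (Cot : 'I_4 -> 'I_4 -> 'I_4 -> K)
  (dX dY : 'I_4 -> 'I_4 -> K).
Hypothesis wT : weyl_tensor H T.
Hypothesis wN : forall e, weyl_tensor H (NT e).
Hypothesis divN : forall b c d, \sum_e \sum_a H e a * NT e a b c d = Cot b c d.
Let X := u o0.
Let Y := u o3.
Hypothesis dXX : forall e, gd G (dX e) X = 0.
Hypothesis dXY : forall e, gd G (dX e) Y + gd G X (dY e) = 0.
Hypothesis dYY : forall e, gd G (dY e) Y = 0.

Definition cotton_frame j k l := con (fun b => con (fun c => con (Cot b c) (u l)) (u k)) (u j).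

Hypothesis cot0 : antiselfdual_frame (cotton_frame o0).
Hypothesis cot3 : antiselfdual_frame (cotton_frame o3).

Definition ndir i j k l m := con (fun e => ev4 (NT e) (u j) (u k) (u l) (u m)) (u i).

Lemma ndir_weyl i : weyl_like (ndir i).
Proof.
pose NTi a b c d := con (fun e => NT e a b c d) (u i).
have E j k l m : ndir i j k l m = fr u NTi j k l m.
  rewrite /fr /ev4 /NTi /ndir /ev4 con_exchange; apply: eq_con => a.
  rewrite con_exchange; apply: eq_con => b; rewrite con_exchange; apply: eq_con => c.
  by rewrite con_exchange.
have [e1 e2 e3 e4 e5] : weyl_like (fr u NTi).
  apply: (fr_weyl Gsym GH fu); rewrite /NTi; split=> [a b c d|a b c d|a b c d|a b c d|a d].
  - by rewrite -conN; apply: eq_con => e; case: (wN e).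
  - by rewrite -conN; apply: eq_con => e; case: (wN e).
  - by apply: eq_con => e; case: (wN e).
  - by rewrite -!conD -[RHS](con0 (u i)); apply: eq_con => e; case: (wN e).
  - under eq_bigr do (under eq_bigr do rewrite -con_mull; rewrite -con_bigsum).
    by rewrite -con_bigsum -[RHS](con0 (u i)); apply: eq_con => e; case: (wN e).
by split=> *; rewrite !E.
Qed.

Lemma ndir_div j k l : frame_div ndir j k l = cotton_frame j k l.
Proof.
rewrite /frame_div -(sum_bar (fun i a => ndir i a j k l)) /ndir /ev4.
transitivity (\sum_e \sum_a H e a *
    con (fun b => con (fun c => con (NT e a b c) (u l)) (u k)) (u j)).
  exact: (frame_trace Gsym GH fu (fun e a =>
    con (fun b => con (fun c => con (NT e a b c) (u l)) (u k)) (u j))).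
under eq_bigr do (under eq_bigr do rewrite -con_mull; rewrite -con_bigsum).
rewrite -con_bigsum; apply: eq_con => b.
under eq_bigr do (under eq_bigr do rewrite -con_mull; rewrite -con_bigsum).
rewrite -con_bigsum; apply: eq_con => c.
under eq_bigr do (under eq_bigr do rewrite -con_mull; rewrite -con_bigsum).
by rewrite -con_bigsum; apply: eq_con => d.
Qed.

Lemma ndir_div0 : antiselfdual_frame (frame_div ndir o0).
Proof. by case: cot0 => c1 c2 c3; split; rewrite !ndir_div. Qed.

Lemma ndir_div3 : antiselfdual_frame (frame_div ndir o3).
Proof. by case: cot3 => c1 c2 c3; split; rewrite !ndir_div. Qed.

(** The component of the derivative of X transverse to the plane, the gamma of the overview; a, b,
    c, d are the tangential components of both derivatives. *)
Definition gam i := con (fun e => gd G (dX e) Y) (u i).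
Let a i := con (fun e => gd G (dX e) (u o1)) (u i).
Let b i := con (fun e => gd G (dX e) (u o2)) (u i).
Let c i := con (fun e => gd G (dY e) (u o1)) (u i).
Let d i := con (fun e => gd G (dY e) (u o2)) (u i).

Lemma bar0 : bar o0 = o1. Proof. exact: val_inj. Qed.
Lemma bar1 : bar o1 = o0. Proof. exact: val_inj. Qed.
Lemma bar2 : bar o2 = o3. Proof. exact: val_inj. Qed.
Lemma bar3 : bar o3 = o2. Proof. exact: val_inj. Qed.

Lemma dY0 e : gd G (dY e) X = - gd G (dX e) Y.
Proof.
by rewrite (gd_sym Gsym (dY e)); apply/eqP; rewrite -addr_eq0 addrC dXY.
Qed.

(** The p-component of the derivative of X is its product with X, which is zero, so three terms
    remain. [F] is an arbitrary linear functional so that the same expansion serves every slot of a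
    tensor. *)
Lemma con_dX (F : ('I_4 -> K) -> K) i :
  (forall v w, F (lincomb v w) = \sum_j v j * F (w j)) ->
  con (fun e => F (dX e)) (u i) = a i * F (u o0) + b i * F (u o3) + gam i * F (u o2).
Proof.
move=> Flin.
have E e : F (dX e) = gd G (dX e) (u o1) * F (u o0) + gd G (dX e) (u o2) * F (u o3)
   + gd G (dX e) Y * F (u o2).
  have {1}-> : dX e = lincomb (fun j => gd G (dX e) (u (bar j))) u.
    by apply/boolp.funext => k; exact: (frame_expand Gsym GH fu).
  rewrite Flin !big_ord_recl big_ord0 bar0 bar1 bar2 bar3 -/X dXX -/Y; ring.
by rewrite (eq_con _ E) !conD !con_mulr.
Qed.

Lemma con_dY (F : ('I_4 -> K) -> K) i :
  (forall v w, F (lincomb v w) = \sum_j v j * F (w j)) ->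
  con (fun e => F (dY e)) (u i) = c i * F (u o0) + d i * F (u o3) - gam i * F (u o1).
Proof.
move=> Flin.
have E e : F (dY e) = gd G (dY e) (u o1) * F (u o0) + gd G (dY e) (u o2) * F (u o3)
   - gd G (dX e) Y * F (u o1).
  have {1}-> : dY e = lincomb (fun j => gd G (dY e) (u (bar j))) u.
    by apply/boolp.funext => k; exact: (frame_expand Gsym GH fu).
  rewrite Flin !big_ord_recl big_ord0 bar0 bar1 bar2 bar3 -/X -/Y dY0 dYY; ring.
by rewrite (eq_con _ E) conB !conD !con_mulr.
Qed.

Lemma point0 : fr u T o0 o3 o0 o3 = 0 -> fr u T o0 o1 o0 o3 = 0 ->
  (forall e V, ev4 (NT e) X Y X V + ev4 T X Y (dX e) V
    + ev4 T X (dY e) X V + ev4 T (dX e) Y X V = 0) ->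
  (forall e V, ev4 (NT e) X Y Y V + ev4 T X Y (dY e) V
    + ev4 T X (dY e) Y V + ev4 T (dX e) Y Y V = 0) ->
  gam o0 * fr u T o0 o3 o1 o2 = 0 /\ gam o3 * fr u T o0 o3 o1 o2 = 0.
Proof.
move=> t0 t1 L0 L0'.
apply: (level0 K2 K3 (fr_weyl Gsym GH fu wT) ndir_weyl ndir_div0 ndir_div3
  (a := a) (b := b) (c := c) (d := d) t0 t1) => i l.
- rewrite -[RHS](con0 (u i)) -(eq_con (u i) (fun e => L0 e (u l))) !conD.
  rewrite (con_dX (F := fun Z => ev4 T X Y Z (u l))); last by move=> *; exact: ev4_lincomb3.
  rewrite (con_dY (F := fun Z => ev4 T X Z X (u l))); last by move=> *; exact: ev4_lincomb2.
  rewrite (con_dX (F := fun Z => ev4 T Z Y X (u l))); last by move=> *; exact: ev4_lincomb1.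
  by rewrite /ndir /fr -/X -/Y; ring.
- rewrite -[RHS](con0 (u i)) -(eq_con (u i) (fun e => L0' e (u l))) !conD.
  rewrite (con_dY (F := fun Z => ev4 T X Y Z (u l))); last by move=> *; exact: ev4_lincomb3.
  rewrite (con_dY (F := fun Z => ev4 T X Z Y (u l))); last by move=> *; exact: ev4_lincomb2.
  rewrite (con_dX (F := fun Z => ev4 T Z Y Y (u l))); last by move=> *; exact: ev4_lincomb1.
  by rewrite /ndir /fr -/X -/Y; ring.
Qed.

Lemma point1 : (forall k l, fr u T o0 o3 k l = 0) ->
  (forall e Z V, ev4 (NT e) X Y Z V + ev4 T X (dY e) Z V + ev4 T (dX e) Y Z V = 0) ->
  gam o0 * fr u T o0 o1 o1 o2 = 0 /\ gam o3 * fr u T o0 o1 o1 o2 = 0.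
Proof.
move=> t03 L1.
apply: (level1 K2 (fr_weyl Gsym GH fu wT) ndir_weyl ndir_div0 ndir_div3
  (a := a) (b := b) (c := c) (d := d) t03) => i k l.
rewrite -[RHS](con0 (u i)) -(eq_con (u i) (fun e => L1 e (u k) (u l))) !conD.
rewrite (con_dY (F := fun Z => ev4 T X Z (u k) (u l))); last by move=> *; exact: ev4_lincomb2.
rewrite (con_dX (F := fun Z => ev4 T Z Y (u k) (u l))); last by move=> *; exact: ev4_lincomb1.
by rewrite /ndir /fr -/X -/Y; ring.
Qed.

(** Taking Z = p and W = n in the commutator form gives C(U,V,m,p) - C(U,V,n,k). The frame vectors
    are inserted only after differentiation, so no derivative of p or n occurs. *)
Lemma point2 : (forall k l, fr u T o0 o3 k l = 0) -> fr u T o0 o1 o1 o2 = 0 ->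
  (forall j k, fr u T j k o0 o1 = fr u T j k o2 o3) ->
  (forall e U V Z W, commutator_form G (NT e) X Y U V Z W
  + (ev4 T U V (dX e) Z * gd G Y W - ev4 T U V Y Z * gd G (dX e) W
     - ev4 T U V (dX e) W * gd G Y Z + ev4 T U V Y W * gd G (dX e) Z)
  + (ev4 T U V X Z * gd G (dY e) W - ev4 T U V (dY e) Z * gd G X W
     - ev4 T U V X W * gd G (dY e) Z + ev4 T U V (dY e) W * gd G X Z) = 0) ->
  gam o0 * fr u T o1 o2 o1 o2 = 0 /\ gam o3 * fr u T o1 o2 o1 o2 = 0.
Proof.
move=> t03 t0112 tG L2.
apply: (level2 K2 (fr_weyl Gsym GH fu wT) ndir_weyl ndir_div0 ndir_div3 t03 t0112) => i j k.
have gY1 : gd G Y (u o1) = 0 by rewrite fu.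
have gY2 : gd G Y (u o2) = 1 by rewrite fu.
have gX1 : gd G X (u o1) = 1 by rewrite fu.
have gX2 : gd G X (u o2) = 0 by rewrite fu.
have w := fr_weyl Gsym GH fu wT.
(* [F1] and [F2] collect the terms linear in the derivatives of X and of Y, in the form that
   [con_dX] and [con_dY] expand. *)
pose F1 Z := ev4 T (u j) (u k) Z (u o1) - gd G Z (u o2) * ev4 T (u j) (u k) Y (u o1)
  + gd G Z (u o1) * ev4 T (u j) (u k) Y (u o2).
pose F2 Z := gd G Z (u o2) * ev4 T (u j) (u k) X (u o1)
  - gd G Z (u o1) * ev4 T (u j) (u k) X (u o2) + ev4 T (u j) (u k) Z (u o2).
have E e : ev4 (NT e) (u j) (u k) X (u o1) + ev4 (NT e) (u j) (u k) Y (u o2)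
    + F1 (dX e) + F2 (dY e) = 0.
  rewrite -(L2 e (u j) (u k) (u o1) (u o2)) /commutator_form /F1 /F2 gY1 gY2 gX1 gX2; ring.
have lin (x y : K) P Q S v w' : P (lincomb v w') = \sum_i v i * P (w' i) ->
  Q (lincomb v w') = \sum_i v i * Q (w' i) -> S (lincomb v w') = \sum_i v i * S (w' i) ->
  P (lincomb v w') - Q (lincomb v w') * x + S (lincomb v w') * y =
  \sum_i v i * (P (w' i) - Q (w' i) * x + S (w' i) * y).
  move=> -> -> ->; rewrite !big_distrl -sumrN -!big_split /=.
  by apply: eq_bigr => z _; ring.
have lin1 v w' : F1 (lincomb v w') = \sum_i v i * F1 (w' i).
  apply: (lin _ _ (fun Z => ev4 T (u j) (u k) Z (u o1)) (fun Z => gd G Z (u o2)) (fun Z => gd G Z (u o1)));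
  by [exact: ev4_lincomb3|exact: gd_lincomb].
have lin2 v w' : F2 (lincomb v w') = \sum_i v i * F2 (w' i).
  rewrite /F2; under eq_bigr do rewrite addrC addrA addrAC.
  rewrite addrC addrA addrAC.
  apply: (lin _ _ (fun Z => ev4 T (u j) (u k) Z (u o2)) (fun Z => gd G Z (u o1)) (fun Z => gd G Z (u o2)));
  by [exact: ev4_lincomb3|exact: gd_lincomb].
have con4 p q r s : con (fun e => p e + q e + r e + s e) (u i) =
  con p (u i) + con q (u i) + con r (u i) + con s (u i) by rewrite !conD.
have := con4 (fun e => ev4 (NT e) (u j) (u k) X (u o1))
  (fun e => ev4 (NT e) (u j) (u k) Y (u o2)) (fun e => F1 (dX e)) (fun e => F2 (dY e)).
rewrite (eq_con (u i) E) con0 (con_dX _ lin1) (con_dY _ lin2).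
have n32 : con (fun e => ev4 (NT e) (u j) (u k) (u o3) (u o2)) (u i) = - ndir i j k o2 o3.
  by case: (ndir_weyl i) => _ e _ _ _; exact: e.
rewrite /F1 /F2 /X /Y n32 -/(ndir i j k o0 o1) !fu bar0 bar1 bar2 bar3 /=.
have tG' := tG j k; rewrite /fr in tG'.
have t32 : ev4 T (u j) (u k) (u o3) (u o2) = - ev4 T (u j) (u k) (u o2) (u o3).
  by case: w => _ e _ _ _; exact: (e j k o3 o2).
have t21 : ev4 T (u j) (u k) (u o2) (u o1) = - ev4 T (u j) (u k) (u o1) (u o2).
  by case: w => _ e _ _ _; exact: (e j k o2 o1).
rewrite t32 t21 tG' /= => E0; rewrite [RHS]E0 /fr; ring.
Qed.

End Point.

(** * The Hodge star in a null frame *)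

Section Determinant.
Variable K : comNzRingType.

(** Entries given by a function on naturals leave the minors in the same shape, so the expansion can
    be iterated. *)
Lemma det_expand n (f : nat -> nat -> K) : \det (\matrix_(i < n.+1, j < n.+1) f i j) =
  \sum_(j < n.+1) f 0 j * ((-1) ^+ j * \det (\matrix_(i < n, k < n) f i.+1 (bump j k))).
Proof.
rewrite (expand_det_row _ ord0); apply: eq_bigr => j _; rewrite mxE /cofactor add0n.
by congr (_ * (_ * \det _)); apply/matrixP => i k; rewrite !mxE.
Qed.

Lemma det4E (f : nat -> nat -> K) : \det (\matrix_(i < 4, j < 4) f i j) =
    f 0 0 * (f 1 1 * (f 2 2 * f 3 3 - f 2 3 * f 3 2) - f 1 2 * (f 2 1 * f 3 3 - f 2 3 * f 3 1)
      + f 1 3 * (f 2 1 * f 3 2 - f 2 2 * f 3 1))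
  - f 0 1 * (f 1 0 * (f 2 2 * f 3 3 - f 2 3 * f 3 2) - f 1 2 * (f 2 0 * f 3 3 - f 2 3 * f 3 0)
      + f 1 3 * (f 2 0 * f 3 2 - f 2 2 * f 3 0))
  + f 0 2 * (f 1 0 * (f 2 1 * f 3 3 - f 2 3 * f 3 1) - f 1 1 * (f 2 0 * f 3 3 - f 2 3 * f 3 0)
      + f 1 3 * (f 2 0 * f 3 1 - f 2 1 * f 3 0))
  - f 0 3 * (f 1 0 * (f 2 1 * f 3 2 - f 2 2 * f 3 1) - f 1 1 * (f 2 0 * f 3 2 - f 2 2 * f 3 0)
      + f 1 2 * (f 2 0 * f 3 1 - f 2 1 * f 3 0)).
Proof.
have det2 (h : nat -> nat -> K) :
    \det (\matrix_(i < 2, j < 2) h i j) = h 0 0 * h 1 1 - h 0 1 * h 1 0.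
  rewrite det_expand !big_ord_recl big_ord0.
  rewrite !(det_expand 0%N (fun i k => h i.+1 (bump _ k))) !big_ord_recl !big_ord0 !det_mx00.
  rewrite /= /bump /=; ring.
have det3 (h : nat -> nat -> K) : \det (\matrix_(i < 3, j < 3) h i j) =
    h 0 0 * (h 1 1 * h 2 2 - h 1 2 * h 2 1) - h 0 1 * (h 1 0 * h 2 2 - h 1 2 * h 2 0)
    + h 0 2 * (h 1 0 * h 2 1 - h 1 1 * h 2 0).
  rewrite det_expand !big_ord_recl big_ord0.
  rewrite !(det2 (fun i k => h i.+1 (bump _ k))) /= /bump /=; ring.
rewrite det_expand !big_ord_recl big_ord0.
rewrite !(det3 (fun i k => f i.+1 (bump _ k))) /= /bump /=; ring.
Qed.

End Determinant.

Section LeviCivita.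
Variable R : realType.
Local Notation C := R[i].
Implicit Types (x y z t : 'I_4 -> C).

Lemma levi_civitaE (a b c d : 'I_4) : levi_civita R a b c d =
  \det (\matrix_(r < 4, s < 4) (nth 0 [:: val a; val b; val c; val d] r == s)%:R).
Proof.
congr (\det _); apply/matrixP; elim/ord4P => s; rewrite !mxE (tnth_nth a) /=; by [].
Qed.

Lemma con_delta (s : 'I_4) x : con (fun a => (a == s)%:R) x = x s.
Proof.
rewrite /con (bigD1 s) //= eqxx mul1r big1 ?addr0 // => a /negPf ->.
by rewrite mul0r.
Qed.

Lemma con_sumr (I : finType) (F : I -> 'I_4 -> C) x :
  con (fun a => \sum_i F i a) x = \sum_i con (F i) x.
Proof.
rewrite /con; under eq_bigr do rewrite big_distrl /=.
by rewrite exchange_big.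
Qed.

Lemma ev4_product (e : C) (p q r v : 'I_4 -> C) x y z t :
  ev4 (fun a b c d => e * (p a * (q b * (r c * v d)))) x y z t =
  e * (con p x * (con q y * (con r z * con v t))).
Proof.
transitivity (con (fun a => con (fun b => con (fun c =>
    e * (p a * (q b * (r c * con v t)))) z) y) x).
  by apply: eq_con => a; apply: eq_con => b; apply: eq_con => c; rewrite !con_mull.
transitivity (con (fun a => con (fun b => e * (p a * (q b * (con r z * con v t)))) y) x).
  by apply: eq_con => a; apply: eq_con => b; rewrite !con_mull con_mulr.
transitivity (con (fun a => e * (p a * (con q y * (con r z * con v t)))) x).
  by apply: eq_con => a; rewrite !con_mull con_mulr.
by rewrite con_mull con_mulr.
Qed.

Lemma ev4_levi_civita x y z t : ev4 (levi_civita R) x y z t =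
  \det (\matrix_(r < 4, s < 4) tnth [tuple x; y; z; t] r s).
Proof.
have E a b c d : levi_civita R a b c d = \sum_(s : 'S_4) (-1) ^+ s *
    ((a == s o0)%:R * ((b == s o1)%:R * ((c == s o2)%:R * (d == s o3)%:R))).
  rewrite /levi_civita /determinant; apply: eq_bigr => s _; congr (_ * _).
  by rewrite !big_ord_recl big_ord0 !mxE mulr1 !(tnth_nth a) /=.
rewrite (eq_ev4 _ _ _ _ E) /ev4 /determinant.
under eq_con => a do under eq_con => b do under eq_con => c do rewrite con_sumr.
under eq_con => a do under eq_con => b do rewrite con_sumr.
under eq_con => a do rewrite con_sumr.
rewrite con_sumr; apply: eq_bigr => s _.
transitivity (ev4 (fun a b c d => (-1) ^+ s * ((a == s o0)%:R * ((b == s o1)%:R *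
  ((c == s o2)%:R * (d == s o3)%:R)))) x y z t); first by [].
rewrite ev4_product !con_delta; congr (_ * _).
by rewrite !big_ord_recl big_ord0 mulr1 !mxE !(tnth_nth x).
Qed.

Lemma levi_civita_swap12 a b c d : levi_civita R b a c d = - levi_civita R a b c d.
Proof. by rewrite !levi_civitaE !(det4E (fun r s => (nth 0%N [:: _; _; _; _] r == s)%:R)) /=; ring. Qed.

Lemma levi_civita_swap23 a b c d : levi_civita R a c b d = - levi_civita R a b c d.
Proof. by rewrite !levi_civitaE !(det4E (fun r s => (nth 0%N [:: _; _; _; _] r == s)%:R)) /=; ring. Qed.

Lemma levi_civita_swap34 a b c d : levi_civita R a b d c = - levi_civita R a b c d.
Proof. by rewrite !levi_civitaE !(det4E (fun r s => (nth 0%N [:: _; _; _; _] r == s)%:R)) /=; ring. Qed.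

Lemma eqN0 (x : C) : x = - x -> x = 0.
Proof.
move=> E; have : x *+ 2 = 0 by rewrite mulr2n {1}E addNr.
by move/eqP; rewrite mulrn_eq0 => /eqP.
Qed.

Lemma levi_civita_rep a b c :
  [/\ levi_civita R a a b c = 0, levi_civita R a b a c = 0, levi_civita R a b c a = 0 &
  [/\ levi_civita R b a a c = 0, levi_civita R b a c a = 0 & levi_civita R b c a a = 0]].
Proof.
have e12 (x y z : 'I_4) : levi_civita R x x y z = 0 by apply: eqN0; rewrite {1}levi_civita_swap12.
have e23 (x y z : 'I_4) : levi_civita R x y y z = 0 by apply: eqN0; rewrite {1}levi_civita_swap23.
have e34 (x y z : 'I_4) : levi_civita R x y z z = 0 by apply: eqN0; rewrite {1}levi_civita_swap34.
split=> //; last split=> //.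
- by rewrite levi_civita_swap23 e12 oppr0.
- by rewrite levi_civita_swap34 levi_civita_swap23 e12 !oppr0.
- by rewrite levi_civita_swap34 e23 oppr0.
Qed.

Lemma levi_civita_0123 : levi_civita R o0 o1 o2 o3 = 1.
Proof. by rewrite levi_civitaE (det4E (fun r s => (nth 0%N [:: _; _; _; _] r == s)%:R)) /=; ring. Qed.

End LeviCivita.

Section HodgeFrame.
Variables (R : realType) (G : 'M[R[i]]_4) (w : R[i]) (u : 'I_4 -> 'I_4 -> R[i]).
Local Notation C := R[i].
Local Notation H := (invmx G).
Hypothesis Gsym : forall a b, G a b = G b a.
Hypothesis GH : G *m H = 1%:M.
Hypothesis fu : forall i j, gd G (u i) (u j) = (j == bar i)%:R.

Definition fr2 (F : 'M[C]_4) i j := con (fun a => con (F a) (u j)) (u i).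

Lemma fr2_mx F i j : fr2 F i j = (frame_mx u *m F *m (frame_mx u)^T) i j.
Proof.
rewrite -mulmxA mxE; apply: eq_bigr => a _; rewrite !mxE mulrC; congr (_ * _).
by apply: eq_bigr => b _; rewrite !mxE.
Qed.

Lemma ev4_levi_civita_frame i j k l :
  ev4 (levi_civita R) (u i) (u j) (u k) (u l) = levi_civita R i j k l * \det (frame_mx u).
Proof.
rewrite ev4_levi_civita -det_mulmx; congr (\det _); apply/matrixP => r s.
rewrite !mxE.
have -> : tnth [tuple u i; u j; u k; u l] r = u (tnth [tuple i; j; k; l] r).
  by elim/ord4P: r; rewrite !(tnth_nth (u i)) !(tnth_nth i).
under eq_bigr do rewrite !mxE.
move: (tnth _ r) => q; rewrite (bigD1 q) //= eqxx mul1r big1 ?addr0 //.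
by move=> t /negPf nt; rewrite eq_sym nt mul0r.
Qed.

Lemma raised_frame (F : 'M[C]_4) c d : (H *m F *m H^T) c d =
  \sum_k \sum_l fr2 F (bar k) (bar l) * (u k c * u l d).
Proof.
have HE := inverse_metric_frame Gsym GH fu.
set E := frame_mx u in HE.
have -> : H *m F *m H^T = E^T *m ((eta C *m (E *m F *m E^T)) *m (eta C)^T) *m E.
  by rewrite {1 2}HE !trmx_mul trmxK !mulmxA.
rewrite -mulmxA [LHS]mxE; apply: eq_bigr => k _.
rewrite [E^T c k]mxE [(_ *m E) k d]mxE big_distrr /=; apply: eq_bigr => l _.
have -> : (eta C *m (E *m F *m E^T) *m (eta C)^T) k l = fr2 F (bar k) (bar l).
  rewrite -[_ *m (eta C)^T]trmxK trmx_mul trmxK mxE eta_mul mxE eta_mul.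
  by rewrite fr2_mx.
rewrite !mxE; ring.
Qed.

(** The coordinate formula of the Hodge star persists in a null frame: raising an index becomes
    [bar], and the volume component is multiplied by the determinant of the frame. *)
Lemma fr2_hodge F i j : fr2 (hodge G w F) i j =
  2^-1 * (w * \det (frame_mx u)) *
  \sum_k \sum_l levi_civita R i j k l * fr2 F (bar k) (bar l).
Proof.
have E a b : hodge G w F a b = 2^-1 * w * \sum_k \sum_l fr2 F (bar k) (bar l) *
    con (fun c => con (levi_civita R a b c) (u l)) (u k).
  rewrite mxE; congr (_ * _).
  under eq_bigr do under eq_bigr do rewrite raised_frame big_distrr /=.
  under eq_bigr do rewrite exchange_big /=.
  rewrite exchange_big /=; apply: eq_bigr => k _.
  under eq_bigr do under eq_bigr do rewrite big_distrr /=.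
  under eq_bigr do rewrite exchange_big /=.
  rewrite exchange_big /=; apply: eq_bigr => l _; rewrite big_distrr /=.
  apply: eq_bigr => c _; rewrite mulrA mulrAC -con_mull.
  by apply: eq_bigr => d _; ring.
transitivity (con (fun a => con (fun b => 2^-1 * w * \sum_k \sum_l fr2 F (bar k) (bar l) *
    con (fun c => con (levi_civita R a b c) (u l)) (u k)) (u j)) (u i)).
  by apply: eq_con => a; apply: eq_con => b; exact: E.
transitivity (2^-1 * w * \sum_k \sum_l fr2 F (bar k) (bar l) *
   ev4 (levi_civita R) (u i) (u j) (u k) (u l)); last first.
  rewrite -!mulrA; congr (_ * _); congr (_ * _); rewrite big_distrr /=.
  apply: eq_bigr => k _; rewrite big_distrr /=; apply: eq_bigr => l _.
  by rewrite ev4_levi_civita_frame; ring.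
transitivity (con (fun a => 2^-1 * w * \sum_k \sum_l fr2 F (bar k) (bar l) *
    con (fun b => con (fun c => con (levi_civita R a b c) (u l)) (u k)) (u j)) (u i)).
  apply: eq_con => a; rewrite con_mull; congr (_ * _).
  rewrite con_sumr; apply: eq_bigr => k _; rewrite con_sumr; apply: eq_bigr => l _.
  exact: con_mull.
rewrite con_mull; congr (_ * _).
rewrite con_sumr; apply: eq_bigr => k _; rewrite con_sumr; apply: eq_bigr => l _.
exact: con_mull.
Qed.

Definition skew (F : 'I_4 -> 'I_4 -> C) := forall i j, F i j = - F j i.

Lemma fr2_skew (F : 'M[C]_4) : skew F -> skew (fr2 F).
Proof.
move=> sF i j; rewrite /fr2 con_exchange -conN; apply: eq_con => a; rewrite -conN.
by apply: eq_con => b; exact: sF.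
Qed.

Lemma skew0 F i : skew F -> F i i = 0.
Proof. by move=> sF; apply: eqN0; exact: sF. Qed.

(** [s] is the component of the volume form in the frame. When it is 1, the components 03 and 12 are
    preserved, 02 and 13 change sign, and 01 and 23 are exchanged with a sign. *)
Lemma hodge_table (F : 'M[C]_4) (s := w * \det (frame_mx u)) : skew F ->
  [/\ fr2 (hodge G w F) o0 o1 = - s * fr2 F o2 o3, fr2 (hodge G w F) o2 o3 = - s * fr2 F o0 o1 &
  [/\ fr2 (hodge G w F) o0 o2 = - s * fr2 F o0 o2, fr2 (hodge G w F) o1 o3 = - s * fr2 F o1 o3,
     fr2 (hodge G w F) o0 o3 = s * fr2 F o0 o3 & fr2 (hodge G w F) o1 o2 = s * fr2 F o1 o2]].
Proof.
move=> /fr2_skew sF.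
have z i := skew0 i sF.
have h2 : 2 * 2^-1 = 1 :> C by rewrite divff // pnatr_eq0.
have half (x y : C) : x = 2 * y -> 2^-1 * s * x = s * y.
  by move=> ->; rewrite mulrA [_ * s]mulrC -[s * _ * 2]mulrA [2^-1 * 2]mulrC h2 mulr1.
have [z1 z2 z3 [z4 z5 z6]] : [/\ forall a b c, levi_civita R a a b c = 0,
   forall a b c, levi_civita R a b a c = 0, forall a b c, levi_civita R a b c a = 0 &
   [/\ forall a b c, levi_civita R b a a c = 0, forall a b c, levi_civita R b a c a = 0 &
   forall a b c, levi_civita R b c a a = 0]].
  by do !split; move=> a b c; case: (levi_civita_rep R a b c) => ? ? ? [].
have e0123 := levi_civita_0123 R.
have e0213 : levi_civita R o0 o2 o1 o3 = -1 by rewrite levi_civita_swap23 e0123.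
have e0312 : levi_civita R o0 o3 o1 o2 = 1.
  by rewrite levi_civita_swap23 levi_civita_swap34 opprK.
have e1203 : levi_civita R o1 o2 o0 o3 = 1.
  by rewrite levi_civita_swap23 levi_civita_swap12 opprK.
have e1302 : levi_civita R o1 o3 o0 o2 = -1.
  by rewrite levi_civita_swap23 levi_civita_swap12 opprK levi_civita_swap34 e0123.
have e2301 : levi_civita R o2 o3 o0 o1 = 1.
  by rewrite levi_civita_swap23 levi_civita_swap12 opprK levi_civita_swap34 levi_civita_swap23 e0123 opprK.
do !split; rewrite fr2_hodge -/s ?mulNr -?mulrN; apply: half;
  rewrite !big_ord_recl !big_ord0 ?z1 ?z2 ?z3 ?z4 ?z5 ?z6 ?bar0 ?bar1 ?bar2 ?bar3 ?z;
  rewrite ?(levi_civita_swap34 _ _ _ o0 o1) ?(levi_civita_swap34 _ _ _ o0 o2)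
    ?(levi_civita_swap34 _ _ _ o0 o3) ?(levi_civita_swap34 _ _ _ o1 o2)
    ?(levi_civita_swap34 _ _ _ o1 o3) ?(levi_civita_swap34 _ _ _ o2 o3);
  rewrite ?e0123 ?e0213 ?e0312 ?e1203 ?e1302 ?e2301;
  rewrite ?(sF o1 o0) ?(sF o2 o0) ?(sF o3 o0) ?(sF o2 o1) ?(sF o3 o1) ?(sF o3 o2); ring.
Qed.

End HodgeFrame.

(** * Passage from row vectors and matrices to frame components *)

Section Bridge.
Variable R : realType.
Local Notation C := R[i].
Implicit Types (G F : 'M[C]_4) (w : C) (u v m p n k : 'rV[C]_4).

Lemma gdotE G u v : (forall a b, G a b = G b a) -> gdot G u v = gd G (u 0) (v 0).
Proof.
move=> Gs; rewrite gd_sym // /gdot mxE /gd; apply: eq_bigr => b _.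
rewrite !mxE; congr (_ * _); apply: eq_bigr => a _.
by rewrite Gs mulrC.
Qed.

Lemma eval4E (W : tensor4 R) (u1 u2 u3 u4 : 'rV[C]_4) :
  eval4 W u1 u2 u3 u4 = ev4 W (u1 0) (u2 0) (u3 0) (u4 0).
Proof.
apply: eq_bigr => a _; rewrite /con big_distrl /=; apply: eq_bigr => b _.
rewrite !big_distrl /=; apply: eq_bigr => c _; rewrite !big_distrl /=.
by apply: eq_bigr => d _; ring.
Qed.

Definition frv m p n k (i : 'I_4) : 'I_4 -> C := nth 0 [:: m; p; n; k] i ord0.

Section Frame.
Variables (G : 'M[C]_4) (w : C).
Hypothesis Gsym : forall a b, G a b = G b a.
Hypothesis Gunit : G \in unitmx.
Let GH : G *m invmx G = 1%:M := mulmxV Gunit.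

Definition null_products m p n k : Prop :=
  [/\ gdot G m p = 1 /\ gdot G n k = 1,
      [/\ gdot G m m = 0, gdot G p p = 0, gdot G n n = 0 & gdot G k k = 0] &
      [/\ gdot G m n = 0, gdot G m k = 0, gdot G p n = 0 & gdot G p k = 0]].

Lemma gdotC u v : gdot G u v = gdot G v u.
Proof. by rewrite !gdotE // gd_sym. Qed.

Lemma null_products_frame m p n k : null_products m p n k ->
  forall i j, gd G (frv m p n k i) (frv m p n k j) = (j == bar i)%:R.
Proof.
move=> [[mp nk] [mm pp nn kk] [mn mk pn pk]] i j.
rewrite /frv -gdotE //.
elim/ord4P: i; elim/ord4P: j; rewrite ?bar0 ?bar1 ?bar2 ?bar3 /= ?mp ?nk ?mm ?pp ?nn ?kk ?mn ?mk ?pn ?pk //;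
  by rewrite gdotC.
Qed.

(** The 2-form obtained by lowering m /\ k has component 1 on p /\ n, where the star multiplies by
    the volume component; selfduality of the plane therefore forces that component to be 1. *)
Lemma frame_orientation m p n k : null_products m p n k ->
  hodge_bivector G w (wedge m k) = wedge m k ->
  w * \det (frame_mx (frv m p n k)) = 1.
Proof.
move=> np sd; have fu := null_products_frame np; set u := frv m p n k in fu *.
pose F := G *m wedge m k *m G^T.
have hF : hodge G w F = F.
  rewrite {2}/F -sd /hodge_bivector -/F !mulmxA GH mul1mx -mulmxA -trmx_mul.
  by rewrite GH trmx1 mulmx1.
pose P a := con (G a) (m 0); pose Q a := con (G a) (k 0).
have FE a b : F a b = P a * Q b - Q a * P b.
  have GP (v : 'rV[C]_4) a' : (G *m v^T) a' 0 = con (G a') (v 0).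
    by rewrite mxE; apply: eq_bigr => c _; rewrite mxE.
  have GP' (v : 'rV[C]_4) a' : (v *m G^T) 0 a' = con (G a') (v 0).
    by rewrite mxE; apply: eq_bigr => c _; rewrite mxE mulrC.
  rewrite /F /wedge mulmxBr mulmxBl !mulmxA -!(mulmxA _ _ G^T) 2!mxE !mxE.
  by rewrite !big_ord1 !GP !GP'.
have sF : skew F by move=> a b; rewrite !FE; ring.
have F12 : fr2 u F o1 o2 = 1.
  have -> : fr2 u F o1 o2 = con P (u o1) * con Q (u o2) - con Q (u o1) * con P (u o2).
    rewrite /fr2 -!con_mulr -conB; apply: eq_con => a.
    by rewrite -!con_mull -conB; apply: eq_con => b; rewrite FE.
  have cP i : con P (u i) = gd G (u i) (u o0) by [].
  have cQ i : con Q (u i) = gd G (u i) (u o3) by [].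
  by rewrite !cP !cQ !fu bar1 bar2 /=; ring.
have [_ _ [_ _ _]] := hodge_table w Gsym GH fu sF.
by rewrite hF F12 mulr1.
Qed.

Section Oriented.
Variable u : 'I_4 -> 'I_4 -> C.
Hypothesis fu : forall i j, gd G (u i) (u j) = (j == bar i)%:R.
Hypothesis s1 : w * \det (frame_mx u) = 1.

Lemma antiselfdual_fr2 F : skew F -> antiselfdual_2form G w F -> antiselfdual_frame (fr2 u F).
Proof.
move=> sF asd; have [] := hodge_table w Gsym GH fu sF.
have N i j : fr2 u (- F) i j = - fr2 u F i j.
  by rewrite /fr2 -conN; apply: eq_con => a; rewrite -conN; apply: eq_con => b; rewrite mxE.
rewrite asd s1 !N !mulN1r !mul1r => h1 _ [_ _ h3 h4]; split.
- by apply: eqN0.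
- by apply: eqN0.
- exact: oppr_inj.
Qed.

Lemma fr2_inj F : (forall i j, fr2 u F i j = 0) -> F = 0.
Proof.
move=> F0; have E : frame_mx u *m F *m (frame_mx u)^T = 0.
  by apply/matrixP => i j; rewrite -fr2_mx F0 mxE.
have E1 : frame_mx u *m (G *m ((frame_mx u)^T *m eta C)) = 1%:M.
  by rewrite !mulmxA (frame_mxE Gsym fu) eta2.
have E2 := mulmx1C E1.
have E3 : (frame_mx u)^T *m (G *m ((frame_mx u)^T *m eta C))^T = 1%:M.
  by rewrite -trmx_mul E2 trmx1.
set A := G *m _ in E2 E3; set Em := frame_mx u in E E2 E3.
have -> : F = (A *m Em) *m F *m (Em^T *m A^T) by rewrite E2 E3 mul1mx mulmx1.
have -> : A *m Em *m F *m (Em^T *m A^T) = A *m (Em *m F *m Em^T) *m A^T by rewrite !mulmxA.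
by rewrite E mulmx0 mul0mx.
Qed.

Lemma antiselfdual_of_fr2 F : skew F -> antiselfdual_frame (fr2 u F) ->
  antiselfdual_2form G w F.
Proof.
move=> sF [f03 f12 f01]; have [] := hodge_table w Gsym GH fu sF.
rewrite s1 !mulN1r !mul1r => h01 h23 [h02 h13 h03 h12].
apply/eqP; rewrite -addr_eq0; apply/eqP; apply: fr2_inj => i j.
have -> : fr2 u (hodge G w F + F) i j = fr2 u (hodge G w F) i j + fr2 u F i j.
  by rewrite /fr2 -conD; apply: eq_con => a; rewrite -conD; apply: eq_con => b; rewrite mxE.
have sh : skew (fr2 u (hodge G w F)).
  move=> i' j'; rewrite !(fr2_hodge w Gsym GH fu) -mulrN -sumrN; congr (_ * _).
  apply: eq_bigr => k _; rewrite -sumrN; apply: eq_bigr => l _.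
  by rewrite levi_civita_swap12 mulNr.
have s2 := fr2_skew u sF.
elim/ord4P: i; elim/ord4P: j; rewrite ?(skew0 _ sh) ?(skew0 _ s2);
 rewrite ?(sh o1 o0) ?(sh o2 o0) ?(sh o3 o0) ?(sh o2 o1) ?(sh o3 o1) ?(sh o3 o2);
 rewrite ?(s2 o1 o0) ?(s2 o2 o0) ?(s2 o3 o0) ?(s2 o2 o1) ?(s2 o3 o1) ?(s2 o3 o2);
 rewrite ?h01 ?h23 ?h02 ?h13 ?h03 ?h12 ?f03 ?f12 ?f01; ring.
Qed.

End Oriented.
End Frame.
End Bridge.

(** * Principal planes *)

Lemma quartic_poly_deriv (K : comNzRingType) (c0 c1 c2 c3 c4 z : K) :
  (c4 *: 'X^4 - c3 *: 'X^3 + c2 *: 'X^2 + c1 *: 'X + c0%:P)^`().[z] =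
  4 * c4 * z ^+ 3 - 3 * c3 * z ^+ 2 + 2 * c2 * z + c1.
Proof.
rewrite !(derivD, derivN, derivZ, derivXn, derivX, derivC).
by rewrite !(hornerD, hornerN, hornerZ, hornerMn, hornerXn, hornerX, hornerC) /=; ring.
Qed.

Section Principal.
Variable R : realType.
Local Notation C := R[i].
Variables (G : 'M[C]_4) (w : C).
Hypothesis Gsym : forall a b, G a b = G b a.
Hypothesis Gunit : G \in unitmx.
Let GH : G *m invmx G = 1%:M := mulmxV Gunit.
Implicit Types (u v m p n k X Y : 'rV[C]_4).

Lemma C_mul2 (x : C) : 2 * x = 0 -> x = 0.
Proof. by move/eqP; rewrite mulf_eq0 pnatr_eq0 => /eqP. Qed.

Lemma C_mul3 (x : C) : 3 * x = 0 -> x = 0.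
Proof. by move/eqP; rewrite mulf_eq0 pnatr_eq0 => /eqP. Qed.

Lemma gdot_linl a b u v x : gdot G (a *: u + b *: v) x = a * gdot G u x + b * gdot G v x.
Proof. by rewrite /gdot !mulmxDl -!scalemxAl !mxE. Qed.

Lemma gdot_linr a b u v x : gdot G x (a *: u + b *: v) = a * gdot G x u + b * gdot G x v.
Proof. by rewrite !(gdotC Gsym x) gdot_linl. Qed.

Lemma con_lin (S : 'I_4 -> C) a b u v :
  con S ((a *: u + b *: v) 0) = a * con S (u 0) + b * con S (v 0).
Proof.
by rewrite /con !big_distrr -big_split /=; apply: eq_bigr => c _; rewrite !mxE; ring.
Qed.

Lemma con_lin_fun (S S' : 'I_4 -> C) a b (x : 'I_4 -> C) :
  con (fun c => a * S c + b * S' c) x = a * con S x + b * con S' x.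
Proof. by rewrite conD !con_mull. Qed.

Section Eval.
Variable W : tensor4 R.

Lemma eval4_lin1 a b u v x y z :
  eval4 W (a *: u + b *: v) x y z = a * eval4 W u x y z + b * eval4 W v x y z.
Proof. by rewrite !eval4E; exact: con_lin. Qed.

Lemma eval4_lin2 a b u v x y z :
  eval4 W x (a *: u + b *: v) y z = a * eval4 W x u y z + b * eval4 W x v y z.
Proof. by rewrite !eval4E /ev4 -con_lin_fun; apply: eq_con => c; exact: con_lin. Qed.

Lemma eval4_lin3 a b u v x y z :
  eval4 W x y (a *: u + b *: v) z = a * eval4 W x y u z + b * eval4 W x y v z.
Proof.
rewrite !eval4E /ev4 -con_lin_fun; apply: eq_con => c; rewrite -con_lin_fun.
by apply: eq_con => d; exact: con_lin.
Qed.

Lemma eval4_lin4 a b u v x y z :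
  eval4 W x y z (a *: u + b *: v) = a * eval4 W x y z u + b * eval4 W x y z v.
Proof.
rewrite !eval4E /ev4 -con_lin_fun; apply: eq_con => c; rewrite -con_lin_fun.
by apply: eq_con => d; rewrite -con_lin_fun; apply: eq_con => e; exact: con_lin.
Qed.

End Eval.

Lemma double_root (q : {poly C}) z : ('X - z%:P) ^+ 2 %| q -> q.[z] = 0 /\ q^`().[z] = 0.
Proof.
move=> /dvdpP[r ->]; rewrite expr2.
split; rewrite ?derivM ?derivB ?derivX ?derivC;
  rewrite !(hornerD, hornerN, hornerM, hornerX, hornerC); ring.
Qed.

(** Psi_0 = Psi_1 = 0: for a Weyl tensor C(m,p,m,k) = - C(m,k,n,k), and the left side is the
    representative kept by [weyl_sort]. *)
Definition principal_frame (W : tensor4 R) m p n k :=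
  null_products G m p n k /\
  eval4 W m k m k = 0 /\ eval4 W m p m k = 0.

Lemma null_products_rotate m p n k z : null_products G m p n k ->
  null_products G (1 *: m + z *: n) p n (1 *: k + (- z) *: p).
Proof.
move=> [[mp nk] [mm pp nn kk] [mn mk pn pk]].
have [pm kn] : gdot G p m = 1 /\ gdot G k n = 1 by rewrite !(gdotC Gsym _ m) (gdotC Gsym k) mp nk.
have [nm km np kp] : [/\ gdot G n m = 0, gdot G k m = 0, gdot G n p = 0 & gdot G k p = 0].
  by rewrite !(gdotC Gsym _ m) !(gdotC Gsym _ p) mn mk pn pk.
do !split; rewrite ?gdot_linl ?gdot_linr ?mp ?nk ?mm ?pp ?nn ?kk ?mn ?mk ?pn ?pk
  ?pm ?kn ?nm ?km ?np ?kp; ring.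
Qed.

Lemma null_products_swap m p n k : null_products G m p n k -> null_products G n k m p.
Proof.
move=> [[mp nk] [mm pp nn kk] [mn mk pn pk]].
have [pm kn] : gdot G p m = 1 /\ gdot G k n = 1 by rewrite !(gdotC Gsym _ m) (gdotC Gsym k) mp nk.
have [nm km nq kp] : [/\ gdot G n m = 0, gdot G k m = 0, gdot G n p = 0 & gdot G k p = 0].
  by rewrite !(gdotC Gsym _ m) !(gdotC Gsym _ p) mn mk pn pk.
by do !split.
Qed.

Section Rotation.
Variables (W : tensor4 R) (v : 'I_4 -> 'rV[C]_4) (t : tensor4 R).
Hypothesis tE : forall a b c d, eval4 W (v a) (v b) (v c) (v d) = t a b c d.
Hypothesis wt : weyl_like t.
Let q := weyl_quartic W (v o0) (v o1) (v o2) (v o3).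

Lemma quartic_horner z : q.[z] = t o1 o2 o1 o2 * z ^+ 4 - 4 * t o1 o2 o0 o1 * z ^+ 3
  + 6 * t o0 o3 o1 o2 * z ^+ 2 + 4 * t o0 o3 o2 o3 * z + t o0 o3 o0 o3.
Proof. by rewrite /q /weyl_quartic !tE !(hornerD, hornerN, hornerZ, hornerXn, hornerX, hornerC). Qed.

Lemma quartic_deriv_horner z : q^`().[z] = 4 * t o1 o2 o1 o2 * z ^+ 3
  - 12 * t o1 o2 o0 o1 * z ^+ 2 + 12 * t o0 o3 o1 o2 * z + 4 * t o0 o3 o2 o3.
Proof. by rewrite /q /weyl_quartic !tE quartic_poly_deriv; ring. Qed.

(** The origin of the quartic: in the frame turned by z its value is the new Psi_0 and its
    derivative is four times the new Psi_1, so a multiple root is a frame with both equal to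
    zero. *)
Lemma rotated_components z
  (m' := 1 *: v o0 + z *: v o2) (k' := 1 *: v o3 + (- z) *: v o1) :
  eval4 W m' k' m' k' = q.[z] /\ 4 * eval4 W m' (v o1) m' k' = - q^`().[z].
Proof.
rewrite quartic_horner quartic_deriv_horner /m' /k'.
by split; rewrite !(eval4_lin1, eval4_lin2, eval4_lin3, eval4_lin4) !tE;
  weyl_sort C_mul2 wt; ring.
Qed.

(** A multiple root at infinity means Psi_4 = Psi_3 = 0, and exchanging (m, p) with (n, k) turns
    these into Psi_0 and Psi_1. *)
Lemma quartic_infinity : (size q <= 3)%N ->
  eval4 W (v o2) (v o1) (v o2) (v o1) = 0 /\ eval4 W (v o2) (v o3) (v o2) (v o1) = 0.
Proof.
move=> sq; have q4 := nth_default 0 (leq_trans sq (isT : (3 <= 4)%N)).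
have q3 := nth_default 0 sq.
rewrite /q /weyl_quartic !tE in q3 q4.
rewrite !(coefD, coefN, coefZ, coefXn, coefX, coefC) /= in q3 q4.
have t4 : t o1 o2 o1 o2 = 0 by rewrite -q4; ring.
have t3 : t o1 o2 o0 o1 = 0.
  by apply: C_mul2; apply: C_mul2; rewrite -oppr0 -q3; ring.
rewrite !tE; weyl_sort C_mul2 wt; rewrite t4.
move: t3; weyl_sort C_mul2 wt => ->; split; ring.
Qed.

End Rotation.

Lemma principal_frame_of_plane W S : weyl_tensor (invmx G) W ->
  multiple_principal_plane G w W S ->
  exists m p n k, principal_frame W m p n k /\ S = <<[:: m; k]>>%VS.
Proof.
move=> wW [m [p [n [k [[h1 h2 h3 _] [z mz ->]]]]]].
have np : null_products G m p n k by [].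
have fu := null_products_frame Gsym np.
have wt := fr_weyl Gsym GH fu wW.
pose v (i : 'I_4) : 'rV[C]_4 := nth 0 [:: m; p; n; k] i.
have tE a b c d : eval4 W (v a) (v b) (v c) (v d) = fr (frv m p n k) W a b c d.
  by rewrite eval4E.
case: z mz => [z|] /= mz.
  have [q0 q1] := double_root mz.
  have [e0 e1] := rotated_components tE wt z.
  exists (1 *: m + z *: n), p, n, (1 *: k + (- z) *: p); split.
    split; first exact: null_products_rotate.
    split; first exact: etrans e0 q0.
    have e4 := etrans e1 (congr1 (fun x => - x) q1).
    have mul4 (x : C) : 4 * x = - 0 -> x = 0.
      by rewrite oppr0 => /eqP; rewrite mulf_eq0 pnatr_eq0 => /eqP.
    exact: mul4 e4.
  by rewrite !scale1r scaleNr.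
exists n, k, m, p; split=> //; split; first exact: null_products_swap.
exact: (quartic_infinity tE wt mz).
Qed.

(** A change of basis of the plane is compensated on the complementary null plane by the inverse
    transpose, which preserves all products. *)
Lemma adapted_frame m p n k a b c d : null_products G m p n k -> a * d - b * c != 0 ->
  let D := (a * d - b * c)^-1 in
  null_products G (a *: m + b *: k) ((D * d) *: p + (- (D * c)) *: n)
    ((D * a) *: n + (- (D * b)) *: p) (c *: m + d *: k).
Proof.
move=> [[mp nk] [mm pp nn kk] [mn mk pn pk]] D0 D.
have [pm kn] : gdot G p m = 1 /\ gdot G k n = 1 by rewrite !(gdotC Gsym _ m) (gdotC Gsym k) mp nk.
have [nm km nq kp] : [/\ gdot G n m = 0, gdot G k m = 0, gdot G n p = 0 & gdot G k p = 0].
  by rewrite !(gdotC Gsym _ m) !(gdotC Gsym _ p) mn mk pn pk.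
have DD : D * (a * d - b * c) = 1 by rewrite mulVf.
clearbody D; have {DD} DD : D * a * d = 1 + D * b * c by rewrite -DD; ring.
do !split; rewrite ?gdot_linl ?gdot_linr ?mp ?nk ?mm ?pp ?nn ?kk ?mn ?mk ?pn ?pk
  ?pm ?kn ?nm ?km ?nq ?kp; ring: DD.
Qed.

Lemma span2P m k v : v \in <<[:: m; k]>>%VS -> exists a b, v = a *: m + b *: k.
Proof.
rewrite span_cons span_seq1 => /memv_addP[x /vlineP[a ->] [y /vlineP[b ->] ->]].
by exists a, b.
Qed.

Lemma independent_coordinates m k a b c d :
  free [:: a *: m + b *: k; c *: m + d *: k] -> a * d - b * c != 0.
Proof.
set X := _ + b *: k; set Y := _ + d *: k => fXY; apply/eqP => D0.
have lin x y : x *: X + y *: Y = 0 -> x = 0 /\ y = 0.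
  move=> E; move: fXY; rewrite free_cons span_seq1 seq1_free => /andP[nX nY].
  have x0 : x = 0.
    apply/eqP/negPn/negP => nx; case/negP: nX; apply/vlineP; exists (- (x^-1 * y)).
    apply: (scalerI nx); rewrite scalerA mulrN mulVKf // scaleNr.
    by apply/eqP; rewrite -addr_eq0 E.
  split=> //; move: E; rewrite x0 scale0r add0r => /eqP; rewrite scaler_eq0.
  by rewrite (negPf nY) orbF => /eqP.
have lm (x y x' y' : C) v v' : x *: (x' *: v + y' *: v') + y *: (a *: v + b *: v') =
   (x * x' + y * a) *: v + (x * y' + y * b) *: v'.
  by rewrite !scalerDr !scalerA !scalerDl addrACA.
(* The coefficients come from d X - b Y = (a d - b c) m; below, c X - a Y is used likewise. All four
   coordinates then vanish, and so do X and Y. *)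
have [d0 /eqP] : d = 0 /\ - b = 0.
  apply: lin; rewrite /X /Y !scalerDr !scalerA addrACA -!scalerDl.
  have -> : d * a + - b * c = 0 by rewrite -D0; ring.
  have -> : d * b + - b * d = 0 by ring.
  by rewrite !scale0r addr0.
rewrite oppr_eq0 => /eqP b0.
have [c0 /eqP] : c = 0 /\ - a = 0.
  apply: lin; rewrite /X /Y !scalerDr !scalerA addrACA -!scalerDl.
  have -> : c * a + - a * c = 0 by ring.
  have -> : c * b + - a * d = 0 by rewrite -[RHS]oppr0 -D0; ring.
  by rewrite !scale0r addr0.
rewrite oppr_eq0 => /eqP a0.
have [/eqP] : (1 : C) = 0 /\ (0 : C) = 0.
  by apply: lin; rewrite /X /Y a0 b0 c0 d0 !scale0r ?addr0 !scaler0 ?addr0.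
by rewrite oner_eq0.
Qed.

End Principal.

Section Evaluation.
Variables (R : realType) (U : set 'rV[R]_4) (oU : open U) (p : {x | U x}).
Implicit Types f g : sring oU.

Lemma evpM f g : evp p (f * g) = evp p f * evp p g. Proof. exact: rmorphM. Qed.
Lemma evpD f g : evp p (f + g) = evp p f + evp p g. Proof. exact: rmorphD. Qed.
Lemma evpB f g : evp p (f - g) = evp p f - evp p g. Proof. exact: rmorphB. Qed.
Lemma evpN f : evp p (- f) = - evp p f. Proof. exact: rmorphN. Qed.
Lemma evp0 : evp p (0 : sring oU) = 0. Proof. exact: rmorph0. Qed.
Lemma evp1 : evp p (1 : sring oU) = 1. Proof. exact: rmorph1. Qed.
Lemma evp_nat n : evp p (n%:R : sring oU) = n%:R. Proof. exact: rmorph_nat. Qed.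
Lemma evp_sum (I : finType) (F : I -> sring oU) : evp p (\sum_i F i) = \sum_i evp p (F i).
Proof. exact: rmorph_sum. Qed.

Lemma evp_MBM f1 f2 f3 f4 :
  evp p (f1 * f2 - f3 * f4) = evp p f1 * evp p f2 - evp p f3 * evp p f4.
Proof. by rewrite evpB !evpM. Qed.

Lemma evpD3 f1 f2 f3 : evp p (f1 + f2 + f3) = evp p f1 + evp p f2 + evp p f3.
Proof. by rewrite !evpD. Qed.

Lemma evp_MBBM f1 f2 f3 f4 h1 h2 h3 h4 :
  evp p (f1 * h1 - f2 * h2 - f3 * h3 + f4 * h4) =
  evp p f1 * evp p h1 - evp p f2 * evp p h2 - evp p f3 * evp p h3 + evp p f4 * evp p h4.
Proof. by rewrite evpD !evpB !evpM. Qed.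

End Evaluation.

(** * Coordinate curvature as evaluation of the algebraic curvature *)

Section LocalMetric.
Variables (R : realType) (U : set 'rV[R]_4) (oU : open U).
Local Notation C := R[i].
Local Notation V := 'rV[R]_4.
Local Notation A := (sring oU).
Variable g : V -> 'M[C]_4.
Hypothesis gs : forall a b, csmooth U (fun x => g x a b).
Hypothesis gsym : forall x, U x -> (g x)^T = g x.
Hypothesis gunit : forall x, U x -> g x \in unitmx.

Definition gA : 'M[A]_4 := \matrix_(a, b) (to_sfun oU (gs a b) : A).

Lemma evp_gA (p : {x | U x}) a b : evp p (gA a b) = g (sval p) a b.
Proof. by rewrite mxE evp_to_sfun. Qed.

Lemma map_gA (p : {x | U x}) : map_mx (evp p) gA = g (sval p).
Proof. by apply/matrixP => a b; rewrite mxE evp_gA. Qed.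

Lemma evp_det (p : {x | U x}) : evp p (\det gA) = \det (g (sval p)).
Proof. by rewrite -det_map_mx map_gA. Qed.

Lemma det_gA_neq0 x : U x -> (\det gA : A) x != 0.
Proof.
move=> Ux; rewrite -[X in X != _]/(evp (exist _ x Ux) (\det gA)) evp_det.
by have := gunit Ux; rewrite unitmxE unitfE.
Qed.

Definition inv_det : A := to_sfun oU (csmoothV oU det_gA_neq0 (sfun_smooth (\det gA : A))).

(** The ring is not a field: the inverse metric is the adjugate times the pointwise inverse of the
    determinant, which is smooth because the determinant has no zeros on [U]. *)
Definition hA : 'M[A]_4 := inv_det *: \adj gA.

Lemma gA_hA : gA *m hA = 1%:M.
Proof.
rewrite /hA -scalemxAr mul_mx_adj scale_scalar_mx; congr (_%:M).
apply: evp_ext => p; rewrite evpM evp1 evp_det; have -> : evp p inv_det = (\det (g (sval p)))^-1 by rewrite -evp_det; exact: evp_to_sfun.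
by rewrite mulVf //; have := gunit (svalP p); rewrite unitmxE unitfE.
Qed.

Lemma map_hA (p : {x | U x}) : map_mx (evp p) hA = invmx (g (sval p)).
Proof.
have E : g (sval p) *m map_mx (evp p) hA = 1%:M.
  by rewrite -map_gA -map_mxM gA_hA map_mx1.
by rewrite -[LHS]mul1mx -(mulVmx (gunit (svalP p))) -mulmxA E mulmx1.
Qed.

Lemma evp_hA (p : {x | U x}) a b : evp p (hA a b) = invmx (g (sval p)) a b.
Proof. by rewrite -map_hA [RHS]mxE. Qed.

Lemma gA_sym a b : gA a b = gA b a.
Proof.
apply: evp_ext => p; rewrite !evp_gA.
by have /matrixP/(_ b a) := gsym (svalP p); rewrite [LHS]mxE.
Qed.

Definition halfA : A := sfun_cst oU (2^-1 : C).
Definition twelfthA : A := sfun_cst oU (12^-1 : C).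

Lemma halfA_E : 2 * halfA = 1.
Proof.
by apply: evp_ext => p; rewrite evpM evp1 evp_nat evp_cst mulfV // pnatr_eq0.
Qed.

Lemma twelfthA_E : 12 * twelfthA = 1.
Proof.
by apply: evp_ext => p; rewrite evpM evp1 evp_nat evp_cst mulfV // pnatr_eq0.
Qed.

Let D : 'I_4 -> A -> A := @sfun_D R U oU.
Let GamA := Gam D gA hA halfA.
Let RmA := Rm D gA hA halfA.
Let RicA := Ric D gA hA halfA.
Let SchA := Sch D gA hA halfA twelfthA.

(** Each level of the curvature is identified at all points of [U] before the next, so that [evp_D]
    can transfer the derivatives the next level takes. *)
Lemma christoffelE (p : {x | U x}) a b c : christoffel g a b c (sval p) = evp p (GamA a b c).
Proof.
rewrite /GamA /Gam evpM evp_cst evp_sum; congr (_ * _); apply: eq_bigr => d _.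
have E e a' b' : cpartial e (fun y => g y a' b') (sval p) = evp p (D e (gA a' b')).
  by apply: evp_D => q; rewrite evp_gA.
by rewrite evpM evpB evpD evp_hA !E.
Qed.

Lemma riemann_upE (p : {x | U x}) a b c d :
  riemann_up g a b c d (sval p) = evp p (RmA c d a b).
Proof.
rewrite /RmA RmE evpD evpB evp_sum /riemann_up.
congr (_ - _ + _).
- exact (@evp_D _ _ _ _ _ c p (fun q => christoffelE q a d b)).
- exact (@evp_D _ _ _ _ _ d p (fun q => christoffelE q a c b)).
apply: eq_bigr => e _; rewrite (christoffelE p a c e) (christoffelE p e d b).
rewrite (christoffelE p a d e) (christoffelE p e c b).
exact (esym (evp_MBM p (GamA a c e) (GamA e d b) (GamA a d e) (GamA e c b))).
Qed.

Lemma riemannE (p : {x | U x}) a b c d :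
  riemann g a b c d (sval p) = evp p (riem D gA hA halfA a b c d).
Proof.
rewrite /riem evp_sum; apply: eq_bigr => e _.
by rewrite (evpM p (gA a e)) evp_gA riemann_upE.
Qed.

Lemma ricciE (p : {x | U x}) a b : ricci g a b (sval p) = evp p (RicA a b).
Proof. by rewrite /RicA /Ric evp_sum; apply: eq_bigr => c _; rewrite riemann_upE. Qed.

Lemma scalarE (p : {x | U x}) : scalar_curvature g (sval p) = evp p (Scal D gA hA halfA).
Proof.
rewrite /Scal evp_sum; apply: eq_bigr => a _; rewrite evp_sum; apply: eq_bigr => b _.
by rewrite (evpM p (hA a b)) evp_hA ricciE.
Qed.

Lemma schoutenE (p : {x | U x}) a b : schouten g a b (sval p) = evp p (SchA a b).
Proof.
rewrite /SchA /Sch evpB (evpM p halfA) (evpM p (twelfthA * _)) (evpM p twelfthA).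
by rewrite !evp_cst evp_gA -ricciE -scalarE.
Qed.

Definition WeylA := Weyl D gA hA halfA twelfthA.
Definition CotA := Cot D gA hA halfA twelfthA.

Lemma weylE (p : {x | U x}) a b c d : weyl g (sval p) a b c d = evp p (WeylA a b c d).
Proof.
have E a' b' c' d' : evp p (gA a' b' * SchA c' d') =
    g (sval p) a' b' * schouten g c' d' (sval p).
  by rewrite (evpM p (gA a' b')) evp_gA -schoutenE.
by rewrite /WeylA /Weyl evpB evpD evpB evpD !E -riemannE.
Qed.

Lemma nabla_schoutenE (p : {x | U x}) b c a :
  nabla_schouten g b c a (sval p) = evp p (nab2 D gA hA halfA SchA b c a).
Proof.
rewrite /nab2 /cs !evpB !evp_sum /nabla_schouten big_split /= opprD addrA.
congr (_ - _ - _).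
- exact (@evp_D _ _ _ _ _ b p (fun q => schoutenE q c a)).
- apply: eq_bigr => e _; rewrite (christoffelE p e b c) (schoutenE p e a).
  exact (esym (evpM p (GamA e b c) (SchA e a))).
- apply: eq_bigr => e _; rewrite (christoffelE p e b a) (schoutenE p c e).
  exact (esym (evpM p (GamA e b a) (SchA c e))).
Qed.

Lemma cottonE (p : {x | U x}) a b c : cotton g a b c (sval p) = evp p (CotA a b c).
Proof. by rewrite /CotA /Cot evpB /cotton !nabla_schoutenE. Qed.

End LocalMetric.

Section CurvatureTensors.
Variables (A : comPzRingType) (D : 'I_4 -> A -> A).
Hypothesis DD : forall e, {morph D e : x y / x + y}.
Hypothesis DM : forall e x y, D e (x * y) = D e x * y + x * D e y.
Hypothesis DC : forall a b x, D a (D b x) = D b (D a x).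
Variables (g h : 'M[A]_4) (i2 i12 : A).
Hypothesis gsym : forall a b, g a b = g b a.
Hypothesis gh : g *m h = 1%:M.
Hypothesis i2E : 2 * i2 = 1.
Hypothesis i12E : 12 * i12 = 1.

Lemma Weyl_weyl_tensor : weyl_tensor h (Weyl D g h i2 i12).
Proof.
split.
- exact: (Weyl_anti12 DD DM DC i12 gsym gh i2E).
- exact: Weyl_anti34.
- exact: (Weyl_pair DD DM DC i12 gsym gh i2E).
- exact: (Weyl_cyc DD DM DC i12 gsym gh i2E).
- exact: (trace23_Weyl DD DM DC gsym gh i2E i12E).
Qed.

Local Notation cs := (cs D g h i2).

(** The algebraic symmetries are linear and commute with the connection terms; trace-freeness
    survives because the inverse metric is parallel. *)
Lemma nab4_weyl_tensor T e : weyl_tensor h T -> weyl_tensor h (nab4 D g h i2 T e).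
Proof.
case=> w12 w34 wp wc wt.
have neg S S' x : (forall f, S f = - S' f) -> cs S e x = - cs S' e x.
  by move=> E; rewrite -csN; apply: eq_cs.
split=> [a b c d|a b c d|a b c d|a b c d|a d].
- rewrite /nab4 (w12 a b c d) (DN DD).
  rewrite (neg _ _ a (fun f => w12 f b c d)) (neg _ _ b (fun f => w12 a f c d)).
  by rewrite (neg _ _ c (fun f => w12 a b f d)) (neg _ _ d (fun f => w12 a b c f)); ring.
- rewrite /nab4 (w34 a b c d) (DN DD).
  rewrite (neg _ _ a (fun f => w34 f b c d)) (neg _ _ b (fun f => w34 a f c d)).
  by rewrite (neg _ _ c (fun f => w34 a b f d)) (neg _ _ d (fun f => w34 a b c f)); ring.
- rewrite /nab4 (wp a b c d).
  rewrite (eq_cs _ _ _ _ _ a (fun f => wp f b c d)) (eq_cs _ _ _ _ _ b (fun f => wp a f c d)).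
  by rewrite (eq_cs _ _ _ _ _ c (fun f => wp a b f d)) (eq_cs _ _ _ _ _ d (fun f => wp a b c f)); ring.
- have z S1 S2 S3 x : (forall f, S1 f + S2 f + S3 f = 0) -> cs S1 e x + cs S2 e x + cs S3 e x = 0.
    move=> E; rewrite -!csD; apply: big1 => f _; by rewrite E mulr0.
  have da : D e (T a b c d) + D e (T a c d b) + D e (T a d b c) = 0.
    by rewrite -!DD wc (D0 DD).
  have za := z _ _ _ a (fun f => wc f b c d); have zb := z _ _ _ b (fun f => wc a f c d).
  have zc := z _ _ _ c (fun f => wc a b f d); have zd := z _ _ _ d (fun f => wc a b c f).
  rewrite /nab4 -[RHS]subr0 -{2}zd -[X in _ = X - _]subr0 -{2}zc -[X in _ = X - _ - _]subr0.
  by rewrite -{2}zb -[X in _ = X - _ - _ - _]subr0 -{2}za -{1}da; ring.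
- rewrite (trace23_nab4 DD DM gsym gh i2E).
  rewrite (eq_nab2 _ _ _ _ _ _ _ (S' := fun _ _ => 0)); last exact: wt.
  by rewrite /nab2 (D0 DD) /cs !big1 ?subr0 // => f _; rewrite mulr0.
Qed.

End CurvatureTensors.

Lemma weyl_tensor_morph (A K : comPzRingType) (f : {rmorphism A -> K}) H T :
  weyl_tensor H T -> weyl_tensor (map_mx f H) (fun a b c d => f (T a b c d)).
Proof.
case=> w12 w34 wp wc wt; split=> [a b c d|a b c d|a b c d|a b c d|a d].
- by rewrite -rmorphN -w12.
- by rewrite -rmorphN -w34.
- by rewrite wp.
- by rewrite -!rmorphD wc rmorph0.
transitivity (f (\sum_b \sum_c H b c * T a b c d)); last by rewrite wt rmorph0.
rewrite rmorph_sum; apply: eq_bigr => b _; rewrite rmorph_sum; apply: eq_bigr => c _.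
by rewrite rmorphM mxE.
Qed.

Section Morph.
Variables (A K : comPzRingType) (f : {rmorphism A -> K}).

Lemma con_morph S X : f (con S X) = con (fun a => f (S a)) (fun a => f (X a)).
Proof. by rewrite rmorph_sum; apply: eq_bigr => a _; rewrite rmorphM. Qed.

Lemma ev4_morph T X Y Z V : f (ev4 T X Y Z V) =
  ev4 (fun a b c d => f (T a b c d)) (fun a => f (X a)) (fun a => f (Y a))
    (fun a => f (Z a)) (fun a => f (V a)).
Proof.
rewrite con_morph; apply: eq_con => a; rewrite con_morph; apply: eq_con => b.
by rewrite con_morph; apply: eq_con => c; rewrite con_morph.
Qed.

Lemma gd_morph g X Y : f (gd g X Y) = gd (map_mx f g) (fun a => f (X a)) (fun a => f (Y a)).
Proof.
rewrite con_morph; apply: eq_con => a; rewrite con_morph; apply: eq_con => b.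
by rewrite mxE.
Qed.

End Morph.

(** * The local argument *)

Section AdaptedFrame.
Variable R : realType.
Local Notation C := R[i].
Variables (G : 'M[C]_4) (w : C) (W : tensor4 R).
Hypothesis Gsym : forall a b, G a b = G b a.
Hypothesis Gunit : G \in unitmx.
Hypothesis wW : weyl_tensor (invmx G) W.
Let GH : G *m invmx G = 1%:M := mulmxV Gunit.

(** The frame exists at one point only, with X and Y in the places of m and k. The last clause is
    Psi_0 = Psi_1 = 0 written with X and Y alone, hence differentiable. *)
Definition adapted (X Y : 'I_4 -> C) (u : 'I_4 -> 'I_4 -> C) : Prop :=
  [/\ forall i j, gd G (u i) (u j) = (j == bar i)%:R, w * \det (frame_mx u) = 1,
      u o0 = X, u o3 = Y &
      forall V, ev4 W X Y X V = 0 /\ ev4 W X Y Y V = 0].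

Lemma ev4_frame0 u (X Y Z : 'I_4 -> C) :
  (forall i j, gd G (u i) (u j) = (j == bar i)%:R) ->
  (forall l, ev4 W X Y Z (u l) = 0) -> forall V, ev4 W X Y Z V = 0.
Proof.
move=> fu z V.
have -> : V = lincomb (fun i => gd G V (u (bar i))) u.
  by apply/funext => a; exact: (frame_expand Gsym GH fu).
by rewrite ev4_lincomb4 big1 // => i _; rewrite z mulr0.
Qed.

Lemma ev4_frame00 u (X Y : 'I_4 -> C) :
  (forall i j, gd G (u i) (u j) = (j == bar i)%:R) ->
  (forall k l, ev4 W X Y (u k) (u l) = 0) -> forall Z V, ev4 W X Y Z V = 0.
Proof.
move=> fu z Z V.
have -> : Z = lincomb (fun i => gd G Z (u (bar i))) u.
  by apply/funext => a; exact: (frame_expand Gsym GH fu).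
rewrite ev4_lincomb3 big1 // => i _; rewrite (ev4_frame0 fu) ?mulr0 // => l; exact: z.
Qed.

(** X /\ Y is a multiple of m /\ k, so the constraint belongs to the plane and passes to any of its
    bases. *)
Lemma principal_constraint m p n k a b c d V : principal_frame G W m p n k ->
  let X := a *: m + b *: k in let Y := c *: m + d *: k in
  eval4 W X Y X V = 0 /\ eval4 W X Y Y V = 0.
Proof.
move=> [np [e0 e1]] X Y.
have fu := null_products_frame Gsym np.
have wt := fr_weyl Gsym GH fu wW.
have t0 : fr (frv m p n k) W o0 o3 o0 o3 = 0 by rewrite -e0 eval4E.
have t1 : fr (frv m p n k) W o0 o1 o0 o3 = 0 by rewrite -e1 eval4E.
have pc := principal_components (@C_mul2 R) wt t0 t1.
have mkm x : eval4 W m k m x = 0.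
  by rewrite eval4E; apply: (ev4_frame0 fu) => l; case: (pc l).
have mkk x : eval4 W m k k x = 0.
  by rewrite eval4E; apply: (ev4_frame0 fu) => l; case: (pc l).
have skw x y z t : eval4 W x y z t = - eval4 W y x z t.
  rewrite !eval4E ev4_swap12 /ev4 -conN; apply: eq_con => i; rewrite -conN; apply: eq_con => j.
  rewrite -conN; apply: eq_con => i'; rewrite -conN; apply: eq_con => j'.
  by case: wW => e _ _ _ _; exact: e.
have skw0 x z t : eval4 W x x z t = 0 by apply: eqN0; exact: skw.
by rewrite /X /Y; split; rewrite !(eval4_lin1, eval4_lin2, eval4_lin3) !skw0 !(skw k m) !mkm !mkk; ring.
Qed.

Lemma adapted_frame_exists (X Y : 'rV[C]_4) : free [:: X; Y] ->
  multiple_principal_plane G w W <<[:: X; Y]>>%VS ->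
  selfdual_space G w <<[:: X; Y]>>%VS ->
  exists u, adapted (X 0) (Y 0) u.
Proof.
move=> fXY /(principal_frame_of_plane Gsym Gunit wW)[m [p [n [k [pf SE]]]]] sd.
have Xin : X \in <<[:: X; Y]>>%VS by apply: memv_span; rewrite inE eqxx.
have Yin : Y \in <<[:: X; Y]>>%VS by apply: memv_span; rewrite !inE eqxx orbT.
have [a [b Xab]] : exists a b, X = a *: m + b *: k by apply: span2P; rewrite -SE.
have [c [d Ycd]] : exists c d, Y = c *: m + d *: k by apply: span2P; rewrite -SE.
have D0 : a * d - b * c != 0 by apply: (@independent_coordinates _ m k); rewrite -Xab -Ycd.
have np := adapted_frame Gsym pf.1 D0.
rewrite /= -Xab -Ycd in np.
set p' := _ + _ in np; set n' := _ + (- _) *: p in np.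
exists (frv X p' n' Y); split=> //.
- exact: (null_products_frame Gsym np).
- exact: (frame_orientation Gsym Gunit np (sd _ _ Xin Yin)).
move=> V; have -> : V = (\row_j V j : 'rV[C]_4) 0 by apply/funext => j; rewrite mxE.
have := principal_constraint a b c d (\row_j V j) pf.
by rewrite /= -Xab -Ycd -!eval4E.
Qed.

(** A totally null plane in dimension four is its own orthogonal: the components of v along p and n
    are its products with m and k. *)
Lemma null_plane_orthogonal m p n k v : null_products G m p n k ->
  gdot G v m = 0 -> gdot G v k = 0 -> v \in <<[:: m; k]>>%VS.
Proof.
move=> np vm vk; have fu := null_products_frame Gsym np.
have -> : v = gdot G v p *: m + gdot G v n *: k.
  apply/rowP => j; rewrite (frame_expand Gsym GH fu (v 0) j) /lincomb.
  rewrite !big_ord_recl big_ord0 bar0 bar1 bar2 bar3 /frv /= -!gdotE // vm vk !mxE; ring.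
by apply: memvD; apply: memvZ; apply: memv_span; rewrite !inE eqxx ?orbT.
Qed.

(** For fixed c and d the form W(.,.,c,d) is orthogonal to the selfdual bivectors, hence
    antiselfdual, and its selfdual half vanishes. *)
Lemma selfdual_part_eq0 X Y u : adapted X Y u ->
  (forall k l, fr u W o0 o3 k l = 0) -> fr u W o0 o1 o1 o2 = 0 ->
  fr u W o1 o2 o1 o2 = 0 -> forall a b c d, selfdual_part G w W a b c d = 0.
Proof.
move=> [fu s1 _ _ _] t03 t0112 t1212 a b c d.
have sv := selfdual_components_vanish (@C_mul2 R) (fr_weyl Gsym GH fu wW) t03 t0112 t1212.
pose F : 'M[C]_4 := \matrix_(e, f) W e f c d.
have sF : skew F by move=> e f; rewrite !mxE; case: wW => w12 _ _ _ _; exact: w12.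
have FE i j : fr2 u F i j = ev4 W (u i) (u j) (fun x => (x == c)%:R) (fun x => (x == d)%:R).
  apply: eq_con => e; apply: eq_con => f; rewrite mxE.
  rewrite (@eq_con _ _ (fun x => W e f x d)); last first.
    by move=> x; rewrite /con (bigD1 d) //= eqxx mulr1 big1 ?addr0 // => y /negPf ->; rewrite mulr0.
  by rewrite /con (bigD1 c) //= eqxx mulr1 big1 ?addr0 // => y /negPf ->; rewrite mulr0.
have asd : antiselfdual_2form G w F.
  apply: (antiselfdual_of_fr2 Gsym Gunit fu s1 sF); split; rewrite !FE.
  - exact: (ev4_frame00 fu t03).
  - by apply: (ev4_frame00 fu) => k l; case: (sv k l).
  apply/eqP; rewrite -subr_eq0; apply/eqP.
  pose Z := fun x : 'I_4 => (x == c)%:R : C; pose V := fun x : 'I_4 => (x == d)%:R : C.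
  rewrite -/Z -/V.
  have -> : Z = lincomb (fun i => gd G Z (u (bar i))) u.
    by apply/funext => x; exact: (frame_expand Gsym GH fu).
  have -> : V = lincomb (fun i => gd G V (u (bar i))) u.
    by apply/funext => x; exact: (frame_expand Gsym GH fu).
  rewrite !ev4_lincomb3 -sumrB big1 // => i _; rewrite !ev4_lincomb4 -mulrBr -sumrB.
  rewrite big1 ?mulr0 // => j _.
  by have [_] := sv i j; rewrite /fr => ->; rewrite subrr.
rewrite /selfdual_part -/F asd !mxE subrr mulr0 //.
Qed.

(** Expanding [Z] and [V] in the frame leaves only values of the Weyl tensor on m /\ k and on m /\ p
    - n /\ k, both zero. *)
Lemma commutator_form_eq0 X Y u : adapted X Y u ->
  (forall j k, fr u W j k o0 o1 = fr u W j k o2 o3) ->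
  (forall k l, fr u W o0 o3 k l = 0) ->
  forall P Q Z V, commutator_form G W X Y P Q Z V = 0.
Proof.
move=> [fu _ uX uY _] tG t03 P Q Z V.
have wt := fr_weyl Gsym GH fu wW.
have expand B : B = lincomb (fun i => gd G B (u (bar i))) u.
  by apply/funext => x; exact: (frame_expand Gsym GH fu).
have tauG A B : ev4 W A B (u o0) (u o1) = ev4 W A B (u o2) (u o3).
  rewrite (expand A) (expand B) !ev4_lincomb1; apply: eq_bigr => i _; congr (_ * _).
  rewrite !ev4_lincomb2; apply: eq_bigr => j _; congr (_ * _); exact: tG.
have tau03 A B : ev4 W A B (u o0) (u o3) = 0.
  rewrite (expand A) (expand B) !ev4_lincomb1 big1 // => i _.
  rewrite ev4_lincomb2 big1 ?mulr0 // => j _.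
  by have := wl_pair wt i j o0 o3; rewrite t03 /fr => ->; rewrite mulr0.
have skw A B S S' : ev4 W A B S S' = - ev4 W A B S' S.
  rewrite (ev4_swap34 _ _ _ S S') /ev4 -conN; apply: eq_con => i; rewrite -conN; apply: eq_con => j.
  rewrite -conN; apply: eq_con => i'; rewrite -conN; apply: eq_con => j'.
  by case: wW => _ e _ _ _; exact: e.
have skw0 A B S : ev4 W A B S S = 0 by apply: eqN0; exact: skw.
have exp4 A B S S' : ev4 W A B S S' = gd G S' (u o1) * ev4 W A B S (u o0)
   + gd G S' (u o0) * ev4 W A B S (u o1) + gd G S' (u o3) * ev4 W A B S (u o2)
   + gd G S' (u o2) * ev4 W A B S (u o3).
  rewrite {1}(expand S') ev4_lincomb4 !big_ord_recl big_ord0 bar0 bar1 bar2 bar3; ring.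
rewrite /commutator_form -uX -uY (exp4 P Q (u o0) Z) (exp4 P Q (u o3) Z)
  (exp4 P Q (u o0) V) (exp4 P Q (u o3) V) !skw0 tau03 (skw P Q (u o3) (u o0)) tau03
  tauG (skw P Q (u o3) (u o2)) !(gd_sym Gsym (u o0)) !(gd_sym Gsym (u o3)); ring.
Qed.

End AdaptedFrame.

Section LocalTheorem.
Variables (R : realType) (U : set 'rV[R]_4) (oU : open U).
Local Notation C := R[i].
Local Notation V := 'rV[R]_4.
Local Notation A := (sring oU).
Variable g : V -> 'M[C]_4.
Hypothesis gs : forall a b, csmooth U (fun x => g x a b).
Hypothesis gsym : forall x, U x -> (g x)^T = g x.
Hypothesis gunit : forall x, U x -> g x \in unitmx.

Definition derivation : 'I_4 -> A -> A := @sfun_D R U oU.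
Local Notation D := derivation.
Local Notation gR := (gA oU gs).
Local Notation hR := (hA oU gs gunit).
Local Notation i2 := (halfA oU).
Local Notation T := (WeylA oU gs gunit).
Local Notation nab := (nabv D gR hR i2).

Lemma derivationD e : {morph D e : x y / x + y}. Proof. exact: sfun_DD. Qed.
Lemma derivationM e x y : D e (x * y) = D e x * y + x * D e y. Proof. exact: sfun_DM. Qed.
Lemma derivationC a b x : D a (D b x) = D b (D a x). Proof. exact: sfun_DC. Qed.

Let DD := derivationD.
Let DM := derivationM.
Let DC := derivationC.
Let GS := gA_sym oU gs gsym.
Let GHA := gA_hA oU gs gunit.
Let I2 := halfA_E oU.
Let I12 := twelfthA_E oU.

Implicit Types (p : {x | U x}) (X Y Z : 'I_4 -> A).

Definition at_ p X : 'I_4 -> C := fun a => evp p (X a).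

Lemma Gsym p a b : g (sval p) a b = g (sval p) b a.
Proof. by have /matrixP/(_ b a) := gsym (svalP p); rewrite [LHS]mxE. Qed.

Lemma weyl_at p : weyl g (sval p) = fun a b c d => evp p (T a b c d).
Proof.
by do 4!(apply/funext => ?); exact: weylE.
Qed.

Lemma weyl_tensor_at p : weyl_tensor (invmx (g (sval p))) (weyl g (sval p)).
Proof.
rewrite weyl_at -(map_hA oU gs gunit).
exact: (weyl_tensor_morph _ (Weyl_weyl_tensor DD DM DC GS GHA I2 I12)).
Qed.

Lemma nabla_weyl_tensor_at p e : weyl_tensor (invmx (g (sval p)))
  (fun a b c d => evp p (nab4 D gR hR i2 T e a b c d)).
Proof.
rewrite -(map_hA oU gs gunit).
apply: (weyl_tensor_morph _ (nab4_weyl_tensor DD DM GS GHA I2 e _)).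
exact: (Weyl_weyl_tensor DD DM DC GS GHA I2 I12).
Qed.

Lemma gd_at p X Y : evp p (gd gR X Y) = gd (g (sval p)) (at_ p X) (at_ p Y).
Proof. by rewrite -(map_gA oU gs); exact: gd_morph. Qed.

Lemma ev4_at p S X Y Z Q : evp p (ev4 S X Y Z Q) =
  ev4 (fun a b c d => evp p (S a b c d)) (at_ p X) (at_ p Y) (at_ p Z) (at_ p Q).
Proof. exact: ev4_morph. Qed.

Lemma div_at p b c d : \sum_e \sum_a invmx (g (sval p)) e a *
    evp p (nab4 D gR hR i2 T e a b c d) = cotton g b c d (sval p).
Proof.
rewrite (cottonE oU gs gunit) /CotA -(div_Weyl DD DM DC GS GHA I2 I12).
rewrite evp_sum; apply: eq_bigr => e _; rewrite evp_sum; apply: eq_bigr => a _.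
by rewrite (evpM p (hR e a)) evp_hA.
Qed.

Lemma skew_derivative X Y e : gd gR X Y = 0 -> gd gR (nab X e) Y + gd gR X (nab Y e) = 0.
Proof. by move=> XY; rewrite -(leibniz_gd DD DM GS GHA I2) XY (D0 DD). Qed.

(** Any vector at a point is the value of a constant field, so identities over the ring yield
    identities for arbitrary vectors at that point. *)
Definition cst_field (v : 'I_4 -> C) : 'I_4 -> A := fun a => sfun_cst oU (v a).

Lemma at_cst p v : at_ p (cst_field v) = v.
Proof. by apply/funext => a; exact: evp_cst. Qed.

Variables (w : V -> C) (X Y : 'I_4 -> A).

Definition nabla_obstruction p Z := con (fun e => gd (g (sval p)) (at_ p (nab X e)) (at_ p Y)) (at_ p Z).

Hypothesis XY_adapted : forall p, exists u,
  adapted (g (sval p)) (w (sval p)) (weyl g (sval p)) (at_ p X) (at_ p Y) u.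
Hypothesis XY_cotton : forall p,
  antiselfdual_2form (g (sval p)) (w (sval p))
    (\matrix_(b, c) \sum_a at_ p X a * cotton g a b c (sval p)) /\
  antiselfdual_2form (g (sval p)) (w (sval p))
    (\matrix_(b, c) \sum_a at_ p Y a * cotton g a b c (sval p)).
Hypothesis XY_obstruction : forall p,
  nabla_obstruction p X != 0 \/ nabla_obstruction p Y != 0.

Lemma cotton_frame_antiselfdual p u (Z : 'I_4 -> C) j :
  adapted (g (sval p)) (w (sval p)) (weyl g (sval p)) (at_ p X) (at_ p Y) u ->
  u j = Z -> antiselfdual_2form (g (sval p)) (w (sval p))
    (\matrix_(b, c) \sum_a Z a * cotton g a b c (sval p)) ->
  antiselfdual_frame (cotton_frame u (fun a b c => cotton g a b c (sval p)) j).
Proof.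
move=> [fu s1 _ _ _] <- asd.
set F := \matrix_(b, c) _ in asd.
have sF : skew F.
  move=> b c; rewrite !mxE -sumrN; apply: eq_bigr => a _; rewrite /cotton; ring.
have := antiselfdual_fr2 (@Gsym p) (gunit (svalP p)) fu s1 sF asd.
have E k l : fr2 u F k l = cotton_frame u (fun a b c => cotton g a b c (sval p)) j k l.
  rewrite /fr2 /cotton_frame con_exchange [RHS]con_exchange.
  transitivity (con (fun c => con (fun b => con (fun a => cotton g a b c (sval p)) (u j)) (u k)) (u l)).
    apply: eq_con => c; apply: eq_con => b; rewrite mxE; apply: eq_bigr => a _; exact: mulrC.
  rewrite -[RHS]con_exchange [in RHS](@eq_con _ _ (fun a => con (fun c => con (fun b => cotton g a b c (sval p)) (u k)) (u l))); last first.
    by move=> a; rewrite con_exchange.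
  rewrite [RHS]con_exchange; apply: eq_con => c; exact: con_exchange.
by case=> f1 f2 f3; split; rewrite -!E.
Qed.

Lemma XY_null : [/\ gd gR X X = 0, gd gR X Y = 0 & gd gR Y Y = 0].
Proof.
split; apply: evp_ext => p; have [u [fu _ uX uY _]] := XY_adapted p;
  by rewrite gd_at -?uX -?uY fu evp0.
Qed.

Section AtPoint.
Variables (p : {x | U x}) (u : 'I_4 -> 'I_4 -> C).
Local Notation G := (g (sval p)).
Local Notation W := (weyl g (sval p)).
Hypothesis au : adapted G (w (sval p)) W (at_ p X) (at_ p Y) u.
Let dX e := at_ p (nab X e).
Let dY e := at_ p (nab Y e).

Lemma dXX e : gd G (dX e) (u o0) = 0.
Proof.
have [_ _ -> _ _] := au; have [XX _ _] := XY_null.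
apply: (@C_mul2 R); rewrite -gd_at mulr_natl mulr2n -evpD.
by rewrite -[X in _ + X](gd_sym GS) // skew_derivative // evp0.
Qed.

Lemma dYY e : gd G (dY e) (u o3) = 0.
Proof.
have [_ _ _ -> _] := au; have [_ _ YY] := XY_null.
apply: (@C_mul2 R); rewrite -gd_at mulr_natl mulr2n -evpD.
by rewrite -[X in _ + X](gd_sym GS) // skew_derivative // evp0.
Qed.

Lemma dXY e : gd G (dX e) (u o3) + gd G (u o0) (dY e) = 0.
Proof.
have [_ _ -> -> _] := au; have [_ XY _] := XY_null.
by rewrite -!gd_at -evpD skew_derivative // evp0.
Qed.

Lemma cotton_frame0 : antiselfdual_frame (cotton_frame u (fun a b c => cotton g a b c (sval p)) o0).
Proof. by have [_ _ uX _ _] := au; apply: (cotton_frame_antiselfdual au uX); case: (XY_cotton p). Qed.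

Lemma cotton_frame3 : antiselfdual_frame (cotton_frame u (fun a b c => cotton g a b c (sval p)) o3).
Proof. by have [_ _ _ uY _] := au; apply: (cotton_frame_antiselfdual au uY); case: (XY_cotton p). Qed.

Lemma obstruction_kills x : gam G u dX o0 * x = 0 /\ gam G u dX o3 * x = 0 -> x = 0.
Proof.
have [_ _ uX uY _] := au.
have g0 : gam G u dX o0 = nabla_obstruction p X by rewrite /gam /nabla_obstruction uX uY.
have g3 : gam G u dX o3 = nabla_obstruction p Y by rewrite /gam /nabla_obstruction uY.
rewrite g0 g3 => -[/eqP e0 /eqP e3]; apply/eqP.
by case: (XY_obstruction p) => n; [move: e0|move: e3]; rewrite mulf_eq0 (negPf n).
Qed.

Lemma Psi2_eq0 : (forall Q, ev4 T X Y X Q = 0) -> (forall Q, ev4 T X Y Y Q = 0) ->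
  fr u W o0 o3 o1 o2 = 0.
Proof.
move=> L0 L0'; have [fu s1 uX uY L] := au.
apply: obstruction_kills.
apply: (point0 (@C_mul2 R) (@C_mul3 R) (@Gsym p) (mulmxV (gunit (svalP p))) fu
  (weyl_tensor_at p) (nabla_weyl_tensor_at p) (div_at p) dXX dXY dYY cotton_frame0 cotton_frame3).
- by rewrite /fr uX uY; case: (L (at_ p Y)).
- have w' := fr_weyl (@Gsym p) (mulmxV (gunit (svalP p))) fu (weyl_tensor_at p).
  by rewrite (wl_pair w') /fr uX uY; case: (L (u o1)).
- move=> e Q; rewrite uX uY -(at_cst p Q) weyl_at -!ev4_at -!evpD.
  by rewrite (derive_constraint0 DD DM gR hR i2 L0) evp0.
- move=> e Q; rewrite uX uY -(at_cst p Q) weyl_at -!ev4_at -!evpD.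
  by rewrite (derive_constraint0' DD DM gR hR i2 L0') evp0.
Qed.

Lemma Psi3_eq0 : (forall k l, fr u W o0 o3 k l = 0) ->
  (forall P Q, ev4 T X Y P Q = 0) -> fr u W o0 o1 o1 o2 = 0.
Proof.
move=> t03 L1; have [fu s1 uX uY _] := au.
apply: obstruction_kills.
apply: (point1 (@C_mul2 R) (@Gsym p) (mulmxV (gunit (svalP p))) fu
  (weyl_tensor_at p) (nabla_weyl_tensor_at p) (div_at p) dXX dXY dYY cotton_frame0 cotton_frame3) => //.
move=> e P Q; rewrite uX uY -(at_cst p P) -(at_cst p Q) weyl_at -!ev4_at -!evpD.
by rewrite (derive_constraint1 DD DM gR hR i2 L1) evp0.
Qed.

Lemma Psi4_eq0 : (forall k l, fr u W o0 o3 k l = 0) -> fr u W o0 o1 o1 o2 = 0 ->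
  (forall P Q B E, commutator_form gR T X Y P Q B E = 0) -> fr u W o1 o2 o1 o2 = 0.
Proof.
move=> t03 t0112 L2; have [fu s1 uX uY _] := au.
have w' := fr_weyl (@Gsym p) (mulmxV (gunit (svalP p))) fu (weyl_tensor_at p).
apply: obstruction_kills.
apply: (point2 (@C_mul2 R) (@Gsym p) (mulmxV (gunit (svalP p))) fu
  (weyl_tensor_at p) (nabla_weyl_tensor_at p) (div_at p) dXX dXY dYY cotton_frame0 cotton_frame3) => //.
  exact: (level1_components (@C_mul2 R) w' t03 t0112).
move=> e P Q B E.
rewrite uX uY -(at_cst p P) -(at_cst p Q) -(at_cst p B) -(at_cst p E) /commutator_form weyl_at.
have := congr1 (evp p) (derive_commutator_form DD DM GS GHA I2 L2 e
  (cst_field P) (cst_field Q) (cst_field B) (cst_field E)).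
by rewrite evpD3 /commutator_form !evp_MBBM evp0 !ev4_at !gd_at.
Qed.

End AtPoint.

(** At each stage a vanishing obtained in the frame of every single point is restated through X and
    Y, lifted by [evp_ext] to an identity in the ring, and only then differentiated for the next
    stage. *)
Theorem local_selfdual_weyl_eq0 p a b c d :
  selfdual_part (g (sval p)) (w (sval p)) (weyl g (sval p)) a b c d = 0.
Proof.
have L0 Q : ev4 T X Y X Q = 0.
  apply: evp_ext => q; have [u [_ _ _ _ L]] := XY_adapted q.
  by rewrite ev4_at -weyl_at evp0; case: (L (at_ q Q)).
have L0' Q : ev4 T X Y Y Q = 0.
  apply: evp_ext => q; have [u [_ _ _ _ L]] := XY_adapted q.
  by rewrite ev4_at -weyl_at evp0; case: (L (at_ q Q)).
have t03 q u (au : adapted (g (sval q)) (w (sval q)) (weyl g (sval q)) (at_ q X) (at_ q Y) u) k l :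
    fr u (weyl g (sval q)) o0 o3 k l = 0.
  have [fu _ uX uY L] := au.
  have w' := fr_weyl (@Gsym q) (mulmxV (gunit (svalP q))) fu (weyl_tensor_at q).
  apply: (level0_components (@C_mul2 R) w' _ _ (Psi2_eq0 au L0 L0')).
    by rewrite /fr uX uY; case: (L (at_ q Y)).
  by rewrite (wl_pair w') /fr uX uY; case: (L (u o1)).
have L1 P Q : ev4 T X Y P Q = 0.
  apply: evp_ext => q; have [u au] := XY_adapted q; have [fu _ uX uY _] := au.
  rewrite ev4_at -weyl_at evp0.
  apply: (ev4_frame00 (@Gsym q) (gunit (svalP q)) fu) => k l.
  by rewrite -uX -uY; exact: t03.
have t0112 q u (au : adapted (g (sval q)) (w (sval q)) (weyl g (sval q)) (at_ q X) (at_ q Y) u) :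
    fr u (weyl g (sval q)) o0 o1 o1 o2 = 0 by apply: (Psi3_eq0 au _ L1) => k l; exact: t03.
have L2 P Q B E : commutator_form gR T X Y P Q B E = 0.
  apply: evp_ext => q; have [u au] := XY_adapted q; have [fu _ _ _ _] := au.
  have w' := fr_weyl (@Gsym q) (mulmxV (gunit (svalP q))) fu (weyl_tensor_at q).
  have := commutator_form_eq0 (@Gsym q) (gunit (svalP q)) (weyl_tensor_at q) au
    (level1_components (@C_mul2 R) w' (t03 q u au) (t0112 q u au)) (t03 q u au)
    (at_ q P) (at_ q Q) (at_ q B) (at_ q E).
  by rewrite /commutator_form weyl_at evp_MBBM !ev4_at !gd_at evp0.
have [u au] := XY_adapted p.
apply: (selfdual_part_eq0 (@Gsym p) (gunit (svalP p)) (weyl_tensor_at p) au (t03 p u au)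
  (t0112 p u au)).
exact: (Psi4_eq0 au (t03 p u au) (t0112 p u au) L2).
Qed.

End LocalTheorem.

(** * Brackets of global sections *)

Lemma not_free2 (K : fieldType) (vT : vectType K) (X Y : vT) : ~~ free [:: X; Y] ->
  exists S s t, X = s *: S /\ Y = t *: S.
Proof.
rewrite free_cons span_seq1 seq1_free negb_and !negbK => /orP[/vlineP[c ->]|/eqP ->].
  by exists Y, c, 1; rewrite scale1r.
by exists X, 1, 0; rewrite scale1r scale0r.
Qed.

Section LocalFields.
Variables (R : realType) (U : set 'rV[R]_4) (oU : open U).
Local Notation C := R[i].
Local Notation V := 'rV[R]_4.
Local Notation A := (sring oU).
Variable g : V -> 'M[C]_4.
Hypothesis gs : forall a b, csmooth U (fun x => g x a b).
Hypothesis gsym : forall x, U x -> (g x)^T = g x.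
Hypothesis gunit : forall x, U x -> g x \in unitmx.
Local Notation D := (@derivation R U oU).
Local Notation gR := (gA oU gs).
Local Notation nab := (nabv D gR (hA oU gs gunit) (halfA oU)).
Implicit Types (p : {x | U x}).

Let GS := gA_sym oU gs gsym.
Let GHA := gA_hA oU gs gunit.
Let I2 := halfA_E oU.

Definition smooth_field (F : V -> 'rV[C]_4) := forall a, csmooth U (fun x => F x 0 a).

Definition field F (sF : smooth_field F) : 'I_4 -> A := fun a => to_sfun oU (sF a).

Lemma at_field p F (sF : smooth_field F) : at_ p (field sF) = F (sval p) 0.
Proof. by apply/funext => a; rewrite /at_ /field evp_to_sfun. Qed.

Lemma at_bracket p F H (sF : smooth_field F) (sH : smooth_field H) :
  at_ p (bracket D (field sF) (field sH)) = lie_bracket F H (sval p) 0.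
Proof.
apply/funext => a; rewrite /at_ /bracket evp_sum mxE; apply: eq_bigr => b _.
rewrite evp_MBM.
have E F' (sF' : smooth_field F') a' b' :
    cpartial b' (fun y => F' y 0 a') (sval p) = evp p (D b' (field sF' a')).
  by apply: evp_D => q; rewrite evp_to_sfun.
by rewrite -!E !evp_to_sfun.
Qed.

Lemma gdot_at p F H (sF : smooth_field F) (sH : smooth_field H) :
  evp p (gd gR (field sF) (field sH)) = gdot (g (sval p)) (F (sval p)) (H (sval p)).
Proof. by rewrite gd_at !at_field gdotE //; exact: (Gsym gsym p). Qed.

Lemma gdot_bracket p (X Y Z : V -> 'rV[C]_4)
    (sX : smooth_field X) (sY : smooth_field Y) (sZ : smooth_field Z) :
  gd gR (field sX) (field sZ) = 0 -> gd gR (field sY) (field sZ) = 0 ->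
  gdot (g (sval p)) (lie_bracket X Y (sval p)) (Z (sval p)) =
  \sum_b (Y (sval p) 0 b * gd (g (sval p)) (X (sval p) 0) (at_ p (nab (field sZ) b))
        - X (sval p) 0 b * gd (g (sval p)) (Y (sval p) 0) (at_ p (nab (field sZ) b))).
Proof.
move=> XZ YZ.
rewrite gdotE; last exact: (Gsym gsym p).
rewrite -(at_bracket p sX sY) -(at_field p sZ) -gd_at.
rewrite (gd_bracket (@derivationD R U oU) (@derivationM R U oU) GS GHA I2 XZ YZ) evp_sum.
apply: eq_bigr => b _; rewrite evp_MBM !gd_at !at_field.
by rewrite !evp_to_sfun.
Qed.

(** The formula of [gdot_bracket] is alternating in the values of X and Y at the point, so it
    vanishes when both are multiples of one vector. *)
Lemma gdot_bracket_dependent p (X Y Z : V -> 'rV[C]_4)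
    (sX : smooth_field X) (sY : smooth_field Y) (sZ : smooth_field Z) S s t :
  gd gR (field sX) (field sZ) = 0 -> gd gR (field sY) (field sZ) = 0 ->
  X (sval p) = s *: S -> Y (sval p) = t *: S ->
  gdot (g (sval p)) (lie_bracket X Y (sval p)) (Z (sval p)) = 0.
Proof.
move=> XZ YZ Xs Yt; rewrite (gdot_bracket p XZ YZ) Xs Yt; apply: big1 => b _.
have E r (Q : 'I_4 -> C) : gd (g (sval p)) ((r *: S) 0) Q = r * gd (g (sval p)) (S 0) Q.
  by rewrite /gd /con big_distrr; apply: eq_bigr => a _; rewrite /= !mxE; ring.
by rewrite !E !mxE; ring.
Qed.

Section Obstruction.
Variables (X Y : V -> 'rV[C]_4) (sX : smooth_field X) (sY : smooth_field Y).
Hypothesis XX : gd gR (field sX) (field sX) = 0.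
Hypothesis XY : gd gR (field sX) (field sY) = 0.
Hypothesis YY : gd gR (field sY) (field sY) = 0.

Lemma gdot_nabla_self p (Z : V -> 'rV[C]_4) (sZ : smooth_field Z) b :
  gd gR (field sZ) (field sZ) = 0 ->
  gd (g (sval p)) (Z (sval p) 0) (at_ p (nab (field sZ) b)) = 0.
Proof.
move=> ZZ; rewrite -(at_field p sZ); apply: (@C_mul2 R).
rewrite -gd_at mulr_natl mulr2n -evpD.
by rewrite -[in X in X + _](gd_sym GS) (skew_derivative gsym gunit b ZZ) evp0.
Qed.

(** The derivative of g(X,X) = 0 removes one of the two terms of [gdot_bracket]. Together with
    [gdot_bracket_Y], this identifies the obstruction with the products of the bracket with X and
    Y. *)
Lemma gdot_bracket_X p : gdot (g (sval p)) (lie_bracket X Y (sval p)) (X (sval p)) =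
  - nabla_obstruction gs gunit (field sX) (field sY) p (field sX).
Proof.
have YX : gd gR (field sY) (field sX) = 0 by rewrite (gd_sym GS).
rewrite (gdot_bracket p XX YX) /nabla_obstruction /con -sumrN; apply: eq_bigr => b _.
rewrite (gdot_nabla_self p b XX) mulr0 sub0r !at_field (gd_sym (Gsym gsym p) (Y _ 0)).
by rewrite mulrC.
Qed.

Lemma gdot_bracket_Y p : gdot (g (sval p)) (lie_bracket X Y (sval p)) (Y (sval p)) =
  - nabla_obstruction gs gunit (field sX) (field sY) p (field sY).
Proof.
rewrite (gdot_bracket p XY YY) /nabla_obstruction /con -sumrN; apply: eq_bigr => b _.
rewrite (gdot_nabla_self p b YY) mulr0 subr0 mulrC -mulNr at_field; congr (_ * _).
rewrite -!(at_field p sX) -?(at_field p sY) -!gd_at -evpN; congr (evp p _).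
by apply/eqP; rewrite -addr_eq0 addrC (skew_derivative gsym gunit b XY).
Qed.

End Obstruction.
End LocalFields.

(** * From local vanishing to integrability on the manifold *)

Section GlobalTheorem.
Variables (R : realType) (M : manifold4 R) (g : cmetric M) (w : orientation g) (N : plane_field M).
Hypothesis generic : N_generic w.
Hypothesis N_null : totally_null g N.
Hypothesis N_selfdual : selfdual w N.
Hypothesis N_principal : multiple_principal w N.
Hypothesis N_cotton : forall Z : cvector_field M, section_of N Z -> cotton_antiselfdual w Z.
Local Notation C := R[i].
Local Notation V := 'rV[R]_4.

Section Chart.
Variables (i : chart M) (U : set V) (oU : open U) (UI : U `<=` img i).

Lemma chart_smooth a b : csmooth U (fun x => g i x a b).
Proof. exact: csmooth_sub UI (gmx_smooth g i a b). Qed.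

Lemma chart_sym x : U x -> (g i x)^T = g i x.
Proof. by move=> /UI; exact: gmx_sym. Qed.

Lemma chart_unit x : U x -> g i x \in unitmx.
Proof. by move=> /UI; exact: gmx_nondeg. Qed.

Lemma section_smooth (X : cvector_field M) : smooth_field U (X i).
Proof. by move=> a; exact: csmooth_sub UI (vf_smooth X i a). Qed.

Lemma null_on (X Y : V -> 'rV[C]_4) (sX : smooth_field U X) (sY : smooth_field U Y) :
  (forall x, U x -> X x \in N i x /\ Y x \in N i x) ->
  gd (gA oU chart_smooth) (field oU sX) (field oU sY) = 0.
Proof.
move=> inN; apply: evp_ext => p; rewrite (gdot_at oU chart_smooth chart_sym) evp0.
by have [hX hY] := inN _ (svalP p); exact: (N_null (UI (svalP p))).
Qed.

Lemma orthogonal_plane x v : U x -> (forall u, u \in N i x -> gdot (g i x) v u = 0) ->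
  v \in N i x.
Proof.
move=> Ux vN; pose p : {x | U x} := exist _ x Ux.
have [m [p' [n [k [[np _] NE]]]]] := principal_frame_of_plane
  (Gsym chart_sym p) (chart_unit Ux)
  (weyl_tensor_at oU chart_smooth chart_sym chart_unit p) (N_principal (UI Ux)).
rewrite NE; apply: (null_plane_orthogonal (Gsym chart_sym p) (chart_unit Ux) np);
  apply: vN; rewrite NE; apply: memv_span; by rewrite !inE eqxx ?orbT.
Qed.

Lemma plane_span x (X Y : 'rV[C]_4) : U x -> X \in N i x -> Y \in N i x ->
  free [:: X; Y] -> N i x = <<[:: X; Y]>>%VS.
Proof.
move=> Ux hX hY fXY; apply/eqP; rewrite eq_sym eqEdim; apply/andP; split.
  by apply/span_subvP => v; rewrite !inE => /orP[/eqP ->|/eqP ->].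
by rewrite plane_dim; [move: fXY; rewrite /free => /eqP ->|exact: UI].
Qed.

Variables (X Y : cvector_field M).
Hypotheses (hX : section_of N X) (hY : section_of N Y).
Local Notation br := (lie_bracket (X i) (Y i)).

Lemma sections_in x : U x -> X i x \in N i x /\ Y i x \in N i x.
Proof. by move=> /UI Ix; split; [exact: hX|exact: hY]. Qed.

Lemma dependent_bracket x : U x -> ~~ free [:: X i x; Y i x] ->
  gdot (g i x) (br x) (X i x) = 0 /\ gdot (g i x) (br x) (Y i x) = 0.
Proof.
move=> Ux /not_free2[S [s [t [Xs Yt]]]]; pose p : {x | U x} := exist _ x Ux.
have sX := section_smooth X; have sY := section_smooth Y.
have nXX : gd (gA oU chart_smooth) (field oU sX) (field oU sX) = 0.
  by apply: null_on => y /sections_in[].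
have nYX : gd (gA oU chart_smooth) (field oU sY) (field oU sX) = 0.
  by apply: null_on => y /sections_in[].
have nXY : gd (gA oU chart_smooth) (field oU sX) (field oU sY) = 0.
  by apply: null_on => y /sections_in[].
have nYY : gd (gA oU chart_smooth) (field oU sY) (field oU sY) = 0.
  by apply: null_on => y /sections_in[].
split.
- exact: (gdot_bracket_dependent chart_sym chart_unit (p := p) nXX nYX Xs Yt).
- exact: (gdot_bracket_dependent chart_sym chart_unit (p := p) nXY nYY Xs Yt).
Qed.

Lemma selfdual_weyl_eq0_of_bracket :
  (forall x, U x -> gdot (g i x) (br x) (X i x) != 0 \/ gdot (g i x) (br x) (Y i x) != 0) ->
  forall x, U x -> forall a b c d, selfdual_weyl w i x a b c d = 0.
Proof.
move=> br0 x Ux; pose p : {x | U x} := exist _ x Ux.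
have sX := section_smooth X; have sY := section_smooth Y.
have nXX : gd (gA oU chart_smooth) (field oU sX) (field oU sX) = 0.
  by apply: null_on => y /sections_in[].
have nXY : gd (gA oU chart_smooth) (field oU sX) (field oU sY) = 0.
  by apply: null_on => y /sections_in[].
have nYY : gd (gA oU chart_smooth) (field oU sY) (field oU sY) = 0.
  by apply: null_on => y /sections_in[].
apply: (local_selfdual_weyl_eq0 (oU := oU) (gs := chart_smooth) chart_sym (gunit := chart_unit)
  (w := w i) (X := field oU sX) (Y := field oU sY) _ _ _ p).
- move=> q; rewrite !at_field; have Uq := svalP q.
  have [qX qY] := sections_in Uq.
  have fq : free [:: X i (sval q); Y i (sval q)].
    apply: contraT => /(dependent_bracket Uq)[e1 e2].
    by case: (br0 _ Uq); rewrite ?e1 ?e2 eqxx.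
  have NE := plane_span Uq qX qY fq.
  apply: (adapted_frame_exists (Gsym chart_sym q) (chart_unit Uq)
    (weyl_tensor_at oU chart_smooth chart_sym chart_unit q) fq); rewrite -NE.
  + exact: (N_principal (UI Uq)).
  + exact: (N_selfdual (UI Uq)).
- move=> q; rewrite !at_field; have Iq := UI (svalP q).
  by split; [exact: (N_cotton hX Iq)|exact: (N_cotton hY Iq)].
- move=> q; case: (br0 _ (svalP q)) => n; [left|right]; move: n.
  + by rewrite (gdot_bracket_X chart_sym chart_unit nXX nXY q) oppr_eq0.
  + by rewrite (gdot_bracket_Y chart_sym chart_unit nXY nYY q) oppr_eq0.
Qed.

End Chart.

(** By continuity of the chart, [U] pulls back to a neighbourhood of a point of the manifold; it
    would lie in the closed set [F], whose interior is empty. *)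
Lemma selfdual_weyl_not_open (i : chart M) (U : set V) x : open U -> U `<=` img i -> U x ->
  ~ (forall y, U y -> forall a b c d, selfdual_weyl w i y a b c d = 0).
Proof.
move=> oU UI Ux z.
have [q iq qx] := UI x Ux.
have [F [_ F0 ZF]] := generic.
suff : F° q by rewrite F0.
have near_dom : \forall r \near q, dom i r.
  by apply: open_nbhs_nbhs; split=> //; exact: dom_open.
have near_U : \forall r \near q, U (phi i r).
  have c : phi i @ q --> phi i q := phi_cont iq.
  apply: c; rewrite qx; exact: open_nbhs_nbhs.
apply: filterS (filterI near_dom near_U) => r [dr Ur].
by apply: ZF; exists i => // a b c d; exact: z.
Qed.

Lemma bracket_sections (X Y : cvector_field M) : section_of N X -> section_of N Y ->
  forall i x, img i x -> lie_bracket (X i) (Y i) x \in N i x.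
Proof.
move=> hX hY i x Ix.
have oI : open (img i) by exact: img_open.
have sI : img i `<=` img i by move=> y.
have [fXY|nfXY] := boolP (free [:: X i x; Y i x]); last first.
  (* Here X and Y do not span N at x, so the bracket is tested against the local sections that
     express the smoothness of N. *)
  have [W [X0 [Y0 [[oW Wx WI] [sm NE]]]]] := plane_smooth N Ix.
  have sX := section_smooth WI X; have sY := section_smooth WI Y.
  have sX0 : smooth_field W X0 by move=> a; case: (sm a).
  have sY0 : smooth_field W Y0 by move=> a; case: (sm a).
  have inN y : W y -> X0 y \in N i y /\ Y0 y \in N i y.
    by move=> Wy; rewrite NE //; split; apply: memv_span; rewrite !inE eqxx ?orbT.
  pose p : {x | W x} := exist _ x Wx.
  have [S [s [t [Xs Yt]]]] := not_free2 nfXY.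
  have key Z (sZ : smooth_field W Z) : (forall y, W y -> Z y \in N i y) ->
      gdot (g i x) (lie_bracket (X i) (Y i) x) (Z x) = 0.
    move=> ZN.
    have nXZ : gd (gA oW (chart_smooth WI)) (field oW sX) (field oW sZ) = 0.
      by apply: null_on => y Wy; split; [exact: hX (WI _ Wy)|exact: ZN].
    have nYZ : gd (gA oW (chart_smooth WI)) (field oW sY) (field oW sZ) = 0.
      by apply: null_on => y Wy; split; [exact: hY (WI _ Wy)|exact: ZN].
    exact: (gdot_bracket_dependent (chart_sym WI) (chart_unit WI) (p := p) nXZ nYZ Xs Yt).
  apply: (orthogonal_plane oW WI Wx) => v; rewrite NE // => /span2P[a [b ->]].
  rewrite (gdot_linr (Gsym (chart_sym WI) p)) (key _ sX0) ?(key _ sY0) ?mulr0 ?addr0 //.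
    by move=> y /inN[].
  by move=> y /inN[].
have [Xx Yx] := sections_in sI hX hY Ix.
(* Taken as a smooth function, so that it remains nonzero on a neighbourhood of any point where it
   is nonzero. *)
pose K (Z : cvector_field M) : sring oI := gd (gA oI (chart_smooth sI))
  (bracket (@derivation R _ oI) (field oI (section_smooth sI X)) (field oI (section_smooth sI Y)))
  (field oI (section_smooth sI Z)).
have KE (Z : cvector_field M) y : img i y ->
    K Z y = gdot (g i y) (lie_bracket (X i) (Y i) y) (Z i y).
  move=> Iy; pose p : {x | img i x} := exist _ y Iy.
  rewrite -[LHS]/(evp p (K Z)) gd_at at_bracket at_field gdotE //.
  exact: (Gsym (chart_sym sI) p).
have K_eq0 Z : Z = X \/ Z = Y -> gdot (g i x) (lie_bracket (X i) (Y i) x) (Z i x) = 0.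
  move=> ZXY; apply/eqP/negPn/negP; rewrite -KE // => nz.
  have := csmooth_neq0_open oI (sfun_smooth (K Z)) Ix nz.
  rewrite -[X in X -> _]/(nbhs x (fun y => K Z y != 0)) => nK.
  have : nbhs x (img i `&` (fun y => K Z y != 0)).
    by apply: filterI => //; exact: open_nbhs_nbhs.
  rewrite nbhsE => -[U [oU Ux] UK].
  have UI : U `<=` img i by move=> y /UK[].
  apply: (selfdual_weyl_not_open oU UI Ux).
  apply: (selfdual_weyl_eq0_of_bracket oU UI hX hY) => y /UK[Iy].
  by rewrite KE // => ny; case: ZXY ny => ->; [left|right].
apply: (orthogonal_plane oI sI Ix) => v.
rewrite (plane_span sI Ix Xx Yx fXY) => /span2P[a [b ->]].
rewrite (gdot_linr (Gsym (chart_sym sI) (exist _ x Ix))).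
by rewrite (K_eq0 X (or_introl erefl)) (K_eq0 Y (or_intror erefl)) !mulr0 addr0.
Qed.

End GlobalTheorem.

Theorem theorem5p32 (R : realType) (M : manifold4 R) (g : cmetric M)
    (w : orientation g) (N : plane_field M) :
  N_generic w ->
  (forall p : M, algebraically_special_at w p) ->
  totally_null g N -> selfdual w N -> multiple_principal w N ->
  (forall Z : cvector_field M, section_of N Z -> cotton_antiselfdual w Z) ->
  integrable_planes N.
Proof.
by move=> gen _ nul sd mp cot X Y hX hY i x Ix; apply: bracket_sections; eassumption.
Qed.
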